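(* Let $\rho:B\twoheadrightarrow\Gamma$ be a Fell bundle over an étale groupoid $\Gamma$. If $\rho$ is unit-full then $\mathcal{M}^\rho$ is isomorphic to the multiplier algebra $\mathsf{M}(\mathcal{C}^\rho_{\mathsf r})$ via the map $$m\mapsto(m^{\mathsf R},m^{\mathsf L}),$$ where $m^{\mathsf R}(a)=am$ and $m^{\mathsf L}(a)=ma$ for $a\in\mathcal{C}^\rho_{\mathsf r}$.
   Context: Groupoids. For a groupoid $\Gamma$, $\mathsf{s}(\gamma)=\gamma^{-1}\gamma$, $\mathsf{r}(\gamma)=\gamma\gamma^{-1}$, $\Gamma^0\subseteq\Gamma$ is the set of units, and $\Gamma^2$ is the set of composable pairs ($(\alpha,\beta)\in\Gamma^2$ iff $\mathsf{s}(\alpha)=\mathsf{r}(\beta)$). For $x\in\Gamma^0$, $\Gamma x=\{\gamma:\mathsf{s}(\gamma)=x\}$. An étale groupoid is a groupoid with a topology making product and inverse continuous and such that $\mathsf{s}$ is an open map. No Hausdorff, local compactness or countability assumption is made, even on $\Gamma^0$. A slice is a subset on which $\mathsf{s}$ and $\mathsf{r}$ are injective. A subset $K\subseteq\Gamma$ is biclosed if $\mathsf{s}[K]$ and $\mathsf{r}[K]$ are closed in $\Gamma^0$; it is bicompact if it is a biclosed compact subset of an open slice. Fell bundles. A semigroupoid is a set with a partial binary operation such that $(ab)c$ is defined iff $a(bc)$ is, in which case they are equal; a *-semigroupoid also has an involution with $a^{**}=a$ and $(ab)^*=b^*a^*$ whenever $ab$ is defined. A unit of a semigroupoid $S$ is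 $u\in S$ with $ua=a$ whenever $ua$ is defined and $au=a$ whenever $au$ is defined; $S^0$ is the set of units. A Banach bundle is an open continuous surjection $\rho:B\twoheadrightarrow X$ of topological spaces such that each fibre $B_x=\rho^{-1}\{x\}$ is a complex Banach space (zero $0_x$); for each $\lambda\in\mathbb{C}$, $b\mapsto\lambda b$ is continuous on $B$; addition is continuous on $\{(a,b):\rho(a)=\rho(b)\}$; the norm is upper semicontinuous on $B$; and $\rho(b_\lambda)\to x$, $\|b_\lambda\|\to0$ imply $b_\lambda\to0_x$ for nets. A Fell bundle is a Banach bundle $\rho:B\twoheadrightarrow\Gamma$ such that: (1) $B$ is a *-semigroupoid with continuous product and involution, products are bilinear and $*$ is antilinear; (2) the norm is submultiplicative, $\Gamma$ is an étale groupoid, $ab$ is defined iff $(\rho(a),\rho(b))\in\Gamma^2$, in which case $\rho(ab)=\rho(a)\rho(b)$, and $\rho(a^* )=\rho(a)^{-1}$; (3) for all $b\in B$, $\|b^*b\|=\|b\|^2$ and there is $a\in B_{\rho(b^*b)}$ with $a^*a=b^*b$. Sections. $\mathcal{S}^\rho$ is the vector space (pointwise operations) of all, possibly discontinuous, sections $a:\Gamma\to B$, $\rho\circ a=\mathrm{id}_\Gamma$. Put $\mathrm{supp}(a)=\{\gamma:a(\gamma)\ne0_\gamma\}$ and $a^*(\gamma)=a(\gamma^{-1})^*$. The convolution $ab(\gamma)=\sum_{\gamma=\alpha\beta}a(\alpha)b(\beta)$ is ''defined'' if for every $\gamma\in\Gamma$ the net of finite partial sums converges in norm in $B_\gamma$.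 $\mathcal{F}^\rho$ denotes the finitely supported sections. Define $[0,\infty]$-valued norms by $$\|a\|_2=\sup_{x\in\Gamma^0}\ \sup_{F\subseteq\Gamma x\text{ finite}}\Big\|\sum_{\gamma\in F}a(\gamma)^*a(\gamma)\Big\|^{1/2},\qquad \|a\|_{\mathsf b}=\sup_{f\in\mathcal{F}^\rho}\frac{\|af\|_2}{\|f\|_2}\quad(0/0=0).$$ Let $\mathcal{S}^\rho_{\mathsf b}=\{a:\|a\|_{\mathsf b}<\infty\}$. The big C*-algebra is $\mathcal{B}^\rho=\{a\in\mathcal{S}^\rho_{\mathsf b}:a^*a\text{ and }aa^*\text{ are defined}\}$, with convolution, $*$ and norm $\|\cdot\|_{\mathsf b}$. For $Y\subseteq\Gamma$, $\mathcal{C}^\rho(Y)$ is the set of $a\in\mathcal{S}^\rho$ with $\mathrm{supp}(a)\subseteq Y$ that are, as functions on $\Gamma$, continuous at every point of $Y$. $\mathcal{C}^\rho_{\mathsf c}=\mathrm{span}\{a\in\mathcal{C}^\rho(K):K\subseteq\Gamma\text{ bicompact}\}$, and $\mathcal{C}^\rho_{\mathsf r}=\mathrm{cl}_{\mathsf b}(\mathcal{C}^\rho_{\mathsf c})$ is its $\|\cdot\|_{\mathsf b}$-closure, a C*-subalgebra of $\mathcal{B}^\rho$. The reduced diagonal is $\mathcal{D}^\rho_{\mathsf r}=\{a\in\mathcal{C}^\rho_{\mathsf r}:\mathrm{supp}(a)\subseteq\Gamma^0\}$. Multipliers. $\rho$ is unit-full if for every $x\in\Gamma^0$ there is $d\in\mathcal{D}^\rho_{\mathsf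 r}$ with $d(x)\in B^0$. The $\rho$-multipliers are $\mathcal{M}^\rho=\{a\in\mathcal{S}^\rho:za\in\mathcal{C}^\rho_{\mathsf r}\text{ and }az\in\mathcal{C}^\rho_{\mathsf r}\text{ for all }z\in\mathcal{D}^\rho_{\mathsf r}\}$, with convolution, the involution $*$ and norm $\|\cdot\|_{\mathsf b}$. For a C*-algebra $A$, a left multiplier is a linear $l:A\to A$ with $l(ab)=l(a)b$ and a right multiplier is a linear $r:A\to A$ with $r(ab)=ar(b)$, for all $a,b\in A$; for such a map $m$ put $m^*(a)=m(a^* )^*$. The multiplier algebra $\mathsf{M}(A)$ is the C*-algebra of pairs $(r,l)$ of a right multiplier $r$ and a left multiplier $l$ with $r(a)b=al(b)$ for all $a,b\in A$, with $(q,k)(r,l)=(r\circ q,k\circ l)$, $(r,l)^*=(l^*,r^* )$ and $\|(r,l)\|=\|r\|=\|l\|$. *)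

(* Defs.v *)
From HB Require Import structures.
From mathcomp Require Import all_boot all_order all_algebra finmap.
From mathcomp Require Import complex.
From mathcomp Require Import all_classical all_reals all_analysis.
From mathcomp.analysis.showcase Require Import summability.

Set Implicit Arguments.
Unset Strict Implicit.
Unset Printing Implicit Defensive.
Import Order.TTheory GRing.Theory Num.Theory.
Import numFieldNormedType.Exports.

Local Open Scope classical_set_scope.
Local Open Scope ring_scope.
Local Open Scope complex_scope.

(** Partial operations are total functions [mul] together with a domain of
    definition [def]; the values of [mul] outside [def] are irrelevant. *)

Definition partial_unit (T : Type) (def : T -> T -> Prop) (mul : T -> T -> T)
    (u : T) : Prop :=
  (forall a, def u a -> mul u a = a) /\ (forall a, def a u -> mul a u = a).

(** Composability [s(a) = r(b)] is spelled out as [a^-1 a = b b^-1]. *)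
HB.mixin Record isGroupoid (G : Type) := {
  gmul : G -> G -> G;
  ginv : G -> G;
  ginvK : involutive ginv;
  gmulA : forall a b c : G,
    gmul (ginv a) a = gmul b (ginv b) -> gmul (ginv b) b = gmul c (ginv c) ->
    [/\ gmul (ginv (gmul a b)) (gmul a b) = gmul c (ginv c),
        gmul (ginv a) a = gmul (gmul b c) (ginv (gmul b c)) &
        gmul (gmul a b) c = gmul a (gmul b c)];
  gmulK : forall a b : G, gmul (ginv a) a = gmul b (ginv b) ->
    gmul (ginv a) (gmul a b) = b /\ gmul (gmul a b) (ginv b) = a
}.

#[short(type="groupoidType")]
HB.structure Definition Groupoid := {G of isGroupoid G}.

Definition src (G : groupoidType) (g : G) : G := gmul (ginv g) g.
Definition rng (G : groupoidType) (g : G) : G := gmul g (ginv g).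
Definition composable (G : groupoidType) (a b : G) : Prop := src a = rng b.
Definition gunits (G : groupoidType) : set G :=
  [set u | partial_unit (@composable G) gmul u].

(** [src] is required to be open as a map from [G] to [G]; in particular the
    unit space is open. *)
HB.mixin Record isEtale G of Topological G & isGroupoid G := {
  gmul_continuous :
    {within [set p : G * G | composable p.1 p.2],
      continuous (fun p : G * G => gmul p.1 p.2)};
  ginv_continuous : continuous (@ginv G);
  src_open : forall U : set G, open U -> open (@src G @` U)
}.

#[short(type="etaleGroupoidType")]
HB.structure Definition EtaleGroupoid :=
  {G of Topological G & isGroupoid G & isEtale G}.

Definition slice (G : groupoidType) (K : set G) : Prop :=
  set_inj K (@src G) /\ set_inj K (@rng G).

Definition biclosed (G : etaleGroupoidType) (K : set G) : Prop :=
  closed (@src G @` K : set (subspace (@gunits G))) /\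
  closed (@rng G @` K : set (subspace (@gunits G))).

Definition bicompact (G : etaleGroupoidType) (K : set G) : Prop :=
  [/\ biclosed K, compact K &
      exists O : set G, [/\ open O, slice O & K `<=` O]].

(** The total space of a family of fibres. This is [{x & E x}], wrapped so as
    not to inherit the disjoint union topology. *)
Record tot (X : Type) (E : X -> Type) := Tot { tbase : X; tvec : E tbase }.

Record bundle (R : realType) (X : topologicalType) := Bundle {
  fib : X -> completeNormedModType R[i];
  tot_open : set_system (tot fib);
  tot_openT : tot_open setT;
  tot_openI : setI_closed tot_open;
  tot_open_bigU : forall (I : Type) (f : I -> set (tot fib)),
    (forall i, tot_open (f i)) -> tot_open (\bigcup_i f i)
}.

Definition tspace (R : realType) (X : topologicalType) (F : bundle R X) : Type :=
  tot (fib F).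

HB.instance Definition _ R X (F : bundle R X) := gen_eqMixin (tspace F).
HB.instance Definition _ R X (F : bundle R X) := gen_choiceMixin (tspace F).
HB.instance Definition _ R X (F : bundle R X) :=
  isOpenTopological.Build (tspace F)
    (@tot_openT R X F) (@tot_openI R X F) (@tot_open_bigU R X F).

Definition inj_tot R X (F : bundle R X) (x : X) (v : fib F x) : tspace F :=
  @Tot X (fib F) x v.

Definition bproj R X (F : bundle R X) (b : tspace F) : X := tbase b.

(** The norm of a normed [R[i]]-module takes its values in [R[i]]. *)
Definition vnorm (R : realType) (E : normedModType R[i]) (v : E) : R :=
  complex.Re `|v|.

Definition tnorm R X (F : bundle R X) (b : tspace F) : R := vnorm (tvec b).

(** The vector [b] seen in the fibre over [x], or [0] when [b] is not there. *)
Definition at_fib R X (F : bundle R X) (x : X) (b : tspace F) : fib F x :=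
  match pselect (tbase b = x) with
  | left e => ecast y (fib F y) e (tvec b)
  | right _ => 0
  end.

Definition tscale R X (F : bundle R X) (c : R[i]) (b : tspace F) : tspace F :=
  inj_tot (c *: tvec b : fib F (tbase b)).

Definition tadd R X (F : bundle R X) (a b : tspace F) : tspace F :=
  inj_tot (tvec a + at_fib (tbase a) b : fib F (tbase a)).

(** Surjectivity of [bproj] holds by construction; convergence of nets is
    expressed with filters. *)
Record banach_bundle R X (F : bundle R X) : Prop := {
  bproj_continuous : continuous (@bproj R X F);
  bproj_open : forall U : set (tspace F), open U -> open (@bproj R X F @` U);
  tscale_continuous : forall c : R[i], continuous (@tscale R X F c);
  tadd_continuous :
    {within [set p : tspace F * tspace F | bproj p.1 = bproj p.2],
      continuous (fun p : tspace F * tspace F => tadd p.1 p.2)};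
  tnorm_usc : forall r : R, open [set b : tspace F | tnorm b < r];
  tnorm_cvg0 : forall (x : X) (N : set_system (tspace F)), ProperFilter N ->
    bproj b @[b --> N] --> x -> tnorm b @[b --> N] --> (0 : R) ->
    N --> inj_tot (0 : fib F x)
}.

(** The product [a b] is defined when the base points are composable, so the
    semigroupoid law "[(ab)c] is defined iff [a(bc)] is" is inherited from the
    groupoid.  That [ab] lies over the product and [a^*] over the inverse of
    the base points is built into the types of [fmul] and [fstar]. *)
Record fellBundle (R : realType) (G : etaleGroupoidType) := FellBundle {
  fbundle :> bundle R G;
  fbundle_banach : banach_bundle fbundle;
  fmul : forall g h : G, fib fbundle g -> fib fbundle h ->
    fib fbundle (gmul g h);
  fstar : forall g : G, fib fbundle g -> fib fbundle (ginv g);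
  tmul := fun a b : tspace fbundle => inj_tot (fmul (tvec a) (tvec b));
  tstar := fun a : tspace fbundle => inj_tot (fstar (tvec a));
  tmulA : forall a b c : tspace fbundle,
    composable (bproj a) (bproj b) -> composable (bproj b) (bproj c) ->
    tmul (tmul a b) c = tmul a (tmul b c);
  tstarK : forall a, tstar (tstar a) = a;
  tstarM : forall a b : tspace fbundle, composable (bproj a) (bproj b) ->
    tstar (tmul a b) = tmul (tstar b) (tstar a);
  tmul_continuous :
    {within [set p : tspace fbundle * tspace fbundle |
              composable (bproj p.1) (bproj p.2)],
      continuous (fun p : tspace fbundle * tspace fbundle => tmul p.1 p.2)};
  tstar_continuous : continuous tstar;
  fmul_linearl : forall (g h : G) (c : R[i]) (a a' : fib fbundle g)
      (b : fib fbundle h), composable g h ->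
    fmul (c *: a + a') b = c *: fmul a b + fmul a' b;
  fmul_linearr : forall (g h : G) (c : R[i]) (a : fib fbundle g)
      (b b' : fib fbundle h), composable g h ->
    fmul a (c *: b + b') = c *: fmul a b + fmul a b';
  fstar_antilinear : forall (g : G) (c : R[i]) (a a' : fib fbundle g),
    fstar (c *: a + a') = c^* *: fstar a + fstar a';
  tnormM : forall a b : tspace fbundle, composable (bproj a) (bproj b) ->
    tnorm (tmul a b) <= tnorm a * tnorm b;
  tnorm_starM : forall b : tspace fbundle,
    tnorm (tmul (tstar b) b) = tnorm b ^+ 2;
  tpositive : forall b : tspace fbundle, exists a : tspace fbundle,
    bproj a = bproj (tmul (tstar b) b) /\
    tmul (tstar a) a = tmul (tstar b) b
}.

Definition tcomposable R G (F : fellBundle R G) (a b : tspace F) : Prop :=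
  composable (bproj a) (bproj b).

Definition tunits R G (F : fellBundle R G) : set (tspace F) :=
  [set u | partial_unit (@tcomposable R G F) (@tmul R G F) u].

Definition sect (R : realType) (X : topologicalType) (F : bundle R X) : Type :=
  forall x : X, fib F x.

HB.instance Definition _ R X (F : bundle R X) := gen_eqMixin (sect F).
HB.instance Definition _ R X (F : bundle R X) := gen_choiceMixin (sect F).

Lemma sect_addA R X (F : bundle R X) :
  associative (fun a b : sect F => (fun x => a x + b x) : sect F).
Proof. by move=> a b c; apply: functional_extensionality_dep => x; rewrite addrA. Qed.

Lemma sect_addC R X (F : bundle R X) :
  commutative (fun a b : sect F => (fun x => a x + b x) : sect F).
Proof. by move=> a b; apply: functional_extensionality_dep => x; rewrite addrC. Qed.

Lemma sect_add0 R X (F : bundle R X) :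
  left_id ((fun x => 0) : sect F)
    (fun a b : sect F => (fun x => a x + b x) : sect F).
Proof. by move=> a; apply: functional_extensionality_dep => x; rewrite add0r. Qed.

Lemma sect_addN R X (F : bundle R X) :
  left_inverse ((fun x => 0) : sect F)
    (fun a : sect F => (fun x => - a x) : sect F)
    (fun a b : sect F => (fun x => a x + b x) : sect F).
Proof. by move=> a; apply: functional_extensionality_dep => x; rewrite addNr. Qed.

HB.instance Definition _ R X (F : bundle R X) :=
  GRing.isZmodule.Build (sect F)
    (@sect_addA R X F) (@sect_addC R X F) (@sect_add0 R X F) (@sect_addN R X F).

Definition sect_scale R X (F : bundle R X) (c : R[i]) (a : sect F) : sect F :=
  fun x => c *: a x.

Lemma sect_scaleA R X (F : bundle R X) (c d : R[i]) (a : sect F) :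
  sect_scale c (sect_scale d a) = sect_scale (c * d) a.
Proof. by apply: functional_extensionality_dep => x; rewrite /sect_scale scalerA. Qed.

Lemma sect_scale1 R X (F : bundle R X) : left_id 1 (@sect_scale R X F).
Proof. by move=> a; apply: functional_extensionality_dep => x; rewrite /sect_scale scale1r. Qed.

Lemma sect_scaleDr R X (F : bundle R X) :
  right_distributive (@sect_scale R X F) +%R.
Proof. by move=> c a b; apply: functional_extensionality_dep => x; exact: scalerDr. Qed.

Lemma sect_scaleDl R X (F : bundle R X) (a : sect F) :
  {morph (@sect_scale R X F)^~ a : c d / c + d}.
Proof. by move=> c d; apply: functional_extensionality_dep => x; exact: scalerDl. Qed.

HB.instance Definition _ R X (F : bundle R X) :=
  GRing.Zmodule_isLmodule.Build R[i] (sect F)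
    (@sect_scaleA R X F) (@sect_scale1 R X F)
    (@sect_scaleDr R X F) (@sect_scaleDl R X F).

Definition tot_sect R X (F : bundle R X) (a : sect F) (x : X) : tspace F :=
  inj_tot (a x).

Definition sect_supp R X (F : bundle R X) (a : sect F) : set X :=
  [set x | a x <> 0].

Definition finsupp_sect R X (F : bundle R X) : set (sect F) :=
  [set f : sect F | finite_set (sect_supp f)].
Arguments finsupp_sect {R X} F _.

Definition sect_star R G (F : fellBundle R G) (a : sect F) : sect F :=
  fun g => at_fib g (tstar (tot_sect a (ginv g))).

Definition factorizations (G : groupoidType) (g : G) : set (G * G) :=
  [set p | composable p.1 p.2 /\ gmul p.1 p.2 = g].

Definition convol_term R (G : etaleGroupoidType) (F : fellBundle R G)
    (a b : sect F) (g : G) (p : factorizations g) : fib F g :=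
  at_fib g (tmul (tot_sect a (val p).1) (tot_sect b (val p).2)).

Definition convol_defined R G (F : fellBundle R G) (a b : sect F) : Prop :=
  forall g : G, cvg (partial_sum (@convol_term R G F a b g) @ totally).

Definition convol R G (F : fellBundle R G) (a b : sect F) : sect F :=
  fun g => lim (partial_sum (@convol_term R G F a b g) @ totally).

(** Adding [0] to the set only matters when [G] is empty. *)
Definition norm2 R G (F : fellBundle R G) (a : sect F) : \bar R :=
  ereal_sup ([set 0%E] `|`
    [set e | exists (x : G) (A : set G),
      [/\ gunits x, finite_set A, A `<=` [set g | src g = x] &
          e = (Num.sqrt (vnorm (\sum_(g \in A)
                at_fib x (tmul (tstar (tot_sect a g)) (tot_sect a g)))))%:E]]).

(** In [\bar R], [0 / 0 = 0 * +oo = 0]. *)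
Definition bnorm R G (F : fellBundle R G) (a : sect F) : \bar R :=
  ereal_sup [set (norm2 (convol a f) / norm2 f)%E | f in finsupp_sect F].

Definition Csect R X (F : bundle R X) (Y : set X) : set (sect F) :=
  [set a : sect F | sect_supp a `<=` Y /\
           forall x, Y x -> {for x, continuous (tot_sect a)}].
Arguments Csect {R X} F Y _.

Definition Cc R G (F : fellBundle R G) : set (sect F) :=
  [set a : sect F | exists (n : nat) (c : 'I_n -> R[i]) (s : 'I_n -> sect F),
    (forall i, exists2 K : set G, bicompact K & Csect F K (s i)) /\
    a = \sum_(i < n) c i *: s i].
Arguments Cc {R G} F _.

Definition Cr R G (F : fellBundle R G) : set (sect F) :=
  [set a : sect F | forall eps : R, 0 < eps ->
    exists2 c, Cc F c & (bnorm (a - c)%R < eps%:E)%E].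
Arguments Cr {R G} F _.

Definition Dr R G (F : fellBundle R G) : set (sect F) :=
  [set a : sect F | Cr F a /\ sect_supp a `<=` @gunits G].
Arguments Dr {R G} F _.

Definition unit_full R (G : etaleGroupoidType) (F : fellBundle R G) : Prop :=
  forall x : G, gunits x -> exists2 d, Dr F d & tunits (tot_sect d x).

Definition rho_multipliers R G (F : fellBundle R G) : set (sect F) :=
  [set a : sect F | forall z, Dr F z ->
    [/\ convol_defined z a, Cr F (convol z a),
        convol_defined a z & Cr F (convol a z)]].
Arguments rho_multipliers {R G} F _.

(** The data of a normed *-algebra realized as a subset [alg_carrier] of a vector
    space; only the restriction of the operations to [alg_carrier] matters. *)
Record starAlgebra (R : realType) := StarAlgebra {
  alg_ambient :> lmodType R[i];
  alg_carrier : set alg_ambient;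
  alg_mul : alg_ambient -> alg_ambient -> alg_ambient;
  alg_adj : alg_ambient -> alg_ambient;
  alg_norm : alg_ambient -> \bar R
}.

Definition star_closed R (A : starAlgebra R) : Prop :=
  [/\ alg_carrier (0 : A),
      forall (c : R[i]) (a b : A),
        alg_carrier a -> alg_carrier b -> alg_carrier (c *: a + b),
      forall a b : A, alg_carrier a -> alg_carrier b -> alg_carrier (alg_mul a b) &
      forall a : A, alg_carrier a -> alg_carrier (alg_adj a)].

Definition star_isomorphism R (A B : starAlgebra R) (phi : A -> B) : Prop :=
  set_bij (@alg_carrier R A) (@alg_carrier R B) phi /\
  [/\ forall (c : R[i]) (a b : A), alg_carrier a -> alg_carrier b ->
        phi (c *: a + b) = c *: phi a + phi b,
      forall a b : A, alg_carrier a -> alg_carrier b ->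
        phi (alg_mul a b) = alg_mul (phi a) (phi b),
      forall a : A, alg_carrier a -> phi (alg_adj a) = alg_adj (phi a) &
      forall a : A, alg_carrier a -> alg_norm (phi a) = alg_norm a].

(** Linear maps from [alg_carrier A] to itself; to make them equal exactly when
    they agree on [alg_carrier A], they are extended by [0] to all of [A]. *)
Definition linear_endo R (A : starAlgebra R) (m : A -> A) : Prop :=
  [/\ forall a, alg_carrier a -> alg_carrier (m a),
      forall (c : R[i]) a b, alg_carrier a -> alg_carrier b ->
        m (c *: a + b) = c *: m a + m b &
      forall a, ~ alg_carrier a -> m a = 0].

Definition left_multiplier R (A : starAlgebra R) (l : A -> A) : Prop :=
  linear_endo l /\
  forall a b, alg_carrier a -> alg_carrier b -> l (alg_mul a b) = alg_mul (l a) b.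

Definition right_multiplier R (A : starAlgebra R) (r : A -> A) : Prop :=
  linear_endo r /\
  forall a b, alg_carrier a -> alg_carrier b -> r (alg_mul a b) = alg_mul a (r b).

Definition endo_adj R (A : starAlgebra R) (m : A -> A) : A -> A :=
  fun a => alg_adj (m (alg_adj a)).

Definition opnorm R (A : starAlgebra R) (m : A -> A) : \bar R :=
  ereal_sup [set alg_norm (m a) | a in
    [set a : A | alg_carrier a /\ (alg_norm a <= 1)%E]].

(** Pairs [(r, l)]; the operator norms of [r] and [l] coincide, and [l] is the
    one used as the norm. *)
Definition multiplier_algebra R (A : starAlgebra R) : starAlgebra R :=
  @StarAlgebra R ((A -> A) * (A -> A))%type
    [set p | [/\ right_multiplier p.1, left_multiplier p.2 &
       forall a b, alg_carrier a -> alg_carrier b -> alg_mul (p.1 a) b = alg_mul a (p.2 b)]]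
    (fun p q => (q.1 \o p.1, p.2 \o q.2))
    (fun p => (endo_adj p.2, endo_adj p.1))
    (fun p => opnorm p.2).

Definition sect_algebra R G (F : fellBundle R G) (A : set (sect F)) :
    starAlgebra R :=
  @StarAlgebra R (sect F) A (@convol R G F) (@sect_star R G F) (@bnorm R G F).

Definition multiplier_map R G (F : fellBundle R G) :
    sect_algebra (F := F) (rho_multipliers F) ->
    multiplier_algebra (sect_algebra (F := F) (Cr F)) :=
  fun m => (patch (fun=> 0) (Cr F) (fun a => convol a m),
            patch (fun=> 0) (Cr F) (fun a => convol m a)).
Arguments multiplier_map {R G} F _.

(* Main.v *)
(* The unit fibres of [F] are unital C*-algebras. A section [a] acts on the
   finitely supported sections over a source fibre, a Hilbert module over such an
   algebra, and [||a||_b] is its operator norm; the adjoint of [a] acts as [a^*].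
   Positivity in the unit fibres, and hence the Cauchy-Schwarz inequality, rests
   on square roots obtained as limits of iterations, without spectral theory.

   If [s] is continuous on a bicompact set then [s s^*] is diagonal, and the
   diagonal elements [z = 1 - (1 - s s^* / N)^n], which satisfy [0 <= z <= 1],
   give [z s -> s]. Thus the diagonal contains approximate units for [C_r] as well
   as elements [z] in [0, 1] that are almost [1] at finitely many given units.

   A multiplier [m] is bounded by a gliding hump argument on the products [m z];
   then [m] multiplies all of [C_r] into [C_r], and multipliers form a *-algebra.
   The elements [z] that are almost [1] give that [||m||_b] is the norm of
   [a |-> m a]. Finally let [(r, l)] be a multiplier of [C_r], and for each unit
   [x] let [d_x] be diagonal with [d_x(x)] the unit of the fibre at [x]. Then
   [r(d_x)(g)], with [x] the range of [g], is the value at [g] of the only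
   section [m] that can induce [(r, l)], and [r(a) d_x = a l(d_x)] and
   [d_x l(a) = r(d_x) a] show that it does. *)
Require Import Defs.
From HB Require Import structures.
From mathcomp Require Import all_boot all_order all_algebra finmap.
From mathcomp Require Import complex ring lra.
From mathcomp Require Import all_classical all_reals all_analysis.
From mathcomp.analysis.showcase Require Import summability.
Set Implicit Arguments.
Unset Strict Implicit.
Unset Printing Implicit Defensive.
Import Order.TTheory GRing.Theory Num.Theory.
Import numFieldNormedType.Exports.
Local Open Scope classical_set_scope.
Local Open Scope ring_scope.
Local Open Scope complex_scope.

(** No separation or local compactness is assumed, so neither bump functions nor partitions of unity
    are at hand. The diagonal elements needed are built from sections [s s^*] and [d^* d] by
    polynomials without constant term and norm limits. Unit-fullness enters twice: [d(x)] makes the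
    unit fibre unital, which this treatment of positivity requires, and [d] itself spreads that unit
    to a diagonal section. A multiplier is an arbitrary section, with no bound and no convergence
    assumed. Products with diagonal sections have a single term and always exist. On this footing
    the bound comes first; then [m^* m] is checked on one source fibre at a time, where [m] agrees
    with some [m d]. Only after that are associativity and closure arguments usable, and hence the
    section induced by [(r, l)] is compared with them on the diagonal first. In the gliding hump the
    weighted sum of local units is only known to be at least [2^-n / 2] on the [n]-th finite set, so
    the [n]-th hump must beat [n] times the inverse of that number. Operators are handled through
    finite blocks, rows [E] and columns [H] in one source fibre; no completed Hilbert module
    appears. *)

(** * Unital C*-algebras *)

(* [abel] decides identities of abelian groups by comparing coefficients. *)
Inductive abel_term := ATvar of nat | AT0 | ATadd of abel_term & abel_term | ATopp of abel_term.

Fixpoint abel_eval (V : zmodType) (s : seq V) (e : abel_term) : V :=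
  match e with
  | ATvar n => nth 0 s n
  | AT0 => 0
  | ATadd a b => abel_eval s a + abel_eval s b
  | ATopp a => - abel_eval s a
  end.

Fixpoint abel_coef (e : abel_term) (i : nat) : int :=
  match e with
  | ATvar n => if n == i then 1 else 0
  | AT0 => 0
  | ATadd a b => abel_coef a i + abel_coef b i
  | ATopp a => - abel_coef a i
  end.

Lemma abel_evalE (V : zmodType) (s : seq V) e :
  abel_eval s e = \sum_(i < size s) nth 0 s i *~ abel_coef e i.
Proof.
elim: e => [n||a IHa b IHb|a IHa] /=.
- have [ns|sn] := ltnP n (size s); last first.
    rewrite nth_default // big1 // => i _.
    by rewrite gtn_eqF // (leq_trans (ltn_ord i)).
  rewrite (bigD1 (Ordinal ns)) //= eqxx mulr1z big1 ?addr0 // => i ni.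
  by case: eqP => // E; case/eqP: ni; apply: val_inj.
- by rewrite big1 // => i _; rewrite mulr0z.
- by rewrite IHa IHb -big_split; apply: eq_bigr => i _; rewrite mulrzDr.
- by rewrite IHa -sumrN; apply: eq_bigr => i _; rewrite mulrNz.
Qed.

Lemma abel_sound (V : zmodType) (s : seq V) a b :
  all (fun i => abel_coef a i == abel_coef b i) (iota 0 (size s)) ->
  abel_eval s a = abel_eval s b.
Proof.
move=> /allP H; rewrite !abel_evalE; apply: eq_bigr => i _.
by rewrite (eqP (H i _)) // mem_iota /=.
Qed.

Ltac abel_index x l :=
  match l with
  | ?y :: ?t =>
    match constr:(tt) with
    | _ => let _ := match constr:(tt) with _ => unify x y end in constr:(0%N)
    | _ => let n := abel_index x t in constr:(S n)
    end
  end.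

Ltac abel_atoms e l :=
  match e with
  | @GRing.add _ ?a ?b => let l' := abel_atoms a l in abel_atoms b l'
  | @GRing.opp _ ?a => abel_atoms a l
  | @GRing.zero _ => l
  | @GRing.natmul _ ?a 2 => abel_atoms a l
  | _ => match constr:(tt) with
         | _ => let _ := abel_index e l in l
         | _ => constr:(e :: l)
         end
  end.

Ltac abel_reify e l :=
  match e with
  | @GRing.add _ ?a ?b =>
    let a' := abel_reify a l in let b' := abel_reify b l in constr:(ATadd a' b')
  | @GRing.opp _ ?a => let a' := abel_reify a l in constr:(ATopp a')
  | @GRing.zero _ => constr:(AT0)
  | @GRing.natmul _ ?a 2 => let a' := abel_reify a l in constr:(ATadd a' a')
  | _ => let n := abel_index e l in constr:(ATvar n)
  end.

Ltac abel :=
  match goal with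
  | |- @eq ?T ?a ?b =>
    let l := abel_atoms a (@nil T) in
    let l := abel_atoms b l in
    let a' := abel_reify a l in
    let b' := abel_reify b l in
    exact: (@abel_sound _ l a' b' isT)
  end.

(* The ring structure is put on an alias of [V] because the libraries have no
   scalar multiplication on rings where [1 = 0] is allowed, as in a zero fibre. *)
Record cstarAlg (R : realType) (V : lmodType R[i]) := CstarAlg {
  cmul : V -> V -> V;
  cone : V;
  cnormV : V -> R;
  cstarV : V -> V;
  cmulA_ : associative cmul;
  cmul1l_ : left_id cone cmul;
  cmul1r_ : right_id cone cmul;
  cmulDl_ : left_distributive cmul +%R;
  cmulDr_ : right_distributive cmul +%R;
  cscaleAl_ : forall (c : R[i]) (a b : V), c *: (cmul a b) = cmul (c *: a) b;
  cscaleAr_ : forall (c : R[i]) (a b : V), c *: (cmul a b) = cmul a (c *: b);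
  cnormD_ : forall a b, cnormV (a + b) <= cnormV a + cnormV b;
  cnormZ_ : forall (r : R) a, cnormV (r%:C *: a) = `|r| * cnormV a;
  cnorm_eq0_ : forall a, cnormV a = 0 -> a = 0;
  cnormM_ : forall a b, cnormV (cmul a b) <= cnormV a * cnormV b;
  cnorm_starM_ : forall a, cnormV (cmul (cstarV a) a) = cnormV a ^+ 2;
  cstarK_ : involutive cstarV;
  cstarM_ : forall a b, cstarV (cmul a b) = cmul (cstarV b) (cstarV a);
  cstarD_ : forall a b, cstarV (a + b) = cstarV a + cstarV b;
  cstarZ_ : forall (c : R[i]) a, cstarV (c *: a) = c^* *: cstarV a;
  cnorm_complete_ : forall u : nat -> V,
    (forall e : R, 0 < e -> exists n, forall p q, (n <= p)%N -> (n <= q)%N ->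
       cnormV (u p - u q) <= e) ->
    exists l, forall e : R, 0 < e -> exists n, forall p, (n <= p)%N ->
       cnormV (u p - l) <= e
}.

Definition calg (R : realType) (V : lmodType R[i]) (D : cstarAlg V) : Type := V.

HB.instance Definition _ R V (D : @cstarAlg R V) := GRing.Lmodule.copy (calg D) V.
HB.instance Definition _ R V (D : @cstarAlg R V) :=
  GRing.Zmodule_isPzRing.Build (calg D) (cmulA_ D) (cmul1l_ D) (cmul1r_ D)
    (cmulDl_ D) (cmulDr_ D).

(** * Norm, involution and square roots by iteration *)

Section CstarTheory.
Variables (R : realType) (V : lmodType R[i]) (D : cstarAlg V).
Local Notation A := (calg D).
Implicit Types (a b h u v w : A) (r t e : R).
Definition cnorm (a : A) : R := cnormV D a.
Definition cstar (a : A) : A := cstarV D a.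
Local Notation N := cnorm.
Local Notation "a ^#" := (cstar a).
Local Notation "r *r a" := (r%:C *: a) (at level 40).

Lemma cscaleAl (c : R[i]) a b : c *: (a * b) = (c *: a) * b.
Proof. exact: (cscaleAl_ D). Qed.
Lemma cscaleAr (c : R[i]) a b : c *: (a * b) = a * (c *: b).
Proof. exact: (cscaleAr_ D). Qed.
Lemma cnormD a b : N (a + b) <= N a + N b. Proof. exact: (cnormD_ D). Qed.
Lemma cnormZ r a : N (r *r a) = `|r| * N a. Proof. exact: (cnormZ_ D). Qed.
Lemma cnorm_eq0 a : N a = 0 -> a = 0. Proof. exact: cnorm_eq0_. Qed.
Lemma cnormM a b : N (a * b) <= N a * N b. Proof. exact: (cnormM_ D). Qed.
Lemma cnorm_starM a : N (a^# * a) = N a ^+ 2. Proof. exact: cnorm_starM_. Qed.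
Lemma cstarK a : a^#^# = a. Proof. exact: (cstarK_ D). Qed.
Lemma cstarM a b : (a * b)^# = b^# * a^#. Proof. exact: (cstarM_ D). Qed.
Lemma cstarD a b : (a + b)^# = a^# + b^#. Proof. exact: (cstarD_ D). Qed.
Lemma cstarZ (c : R[i]) a : (c *: a)^# = conjc c *: a^#.
Proof. exact: (cstarZ_ D). Qed.

Lemma cnorm0 : N 0 = 0.
Proof. by have := cnormZ 0 (0 : A); rewrite scaler0 normr0 mul0r. Qed.

Lemma cnormN a : N (- a) = N a.
Proof.
by have := cnormZ (-1) a; rewrite rmorphN1 scaleN1r normrN normr1 mul1r.
Qed.

Lemma cnorm_ge0 a : 0 <= N a.
Proof. by have := cnormD a (- a); rewrite subrr cnorm0 cnormN; lra. Qed.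

Lemma cnormB a b : N (a - b) <= N a + N b.
Proof. by rewrite -(cnormN b) cnormD. Qed.

Lemma cdistC a b : N (a - b) = N (b - a).
Proof. by rewrite -cnormN opprB. Qed.

Lemma cnorm_le0 a : (forall e, 0 < e -> N a <= e) -> a = 0.
Proof.
move=> H; apply: cnorm_eq0; apply/eqP; rewrite eq_le cnorm_ge0 andbT.
by apply/ler_addgt0Pl => e e0; rewrite addr0; exact: H.
Qed.

Lemma cstar0 : (0 : A)^# = 0.
Proof. by have := cstarZ 0 (0 : A); rewrite !scale0r conjc0 scale0r. Qed.

Lemma cstarN a : (- a)^# = - a^#.
Proof. by apply/eqP; rewrite -addr_eq0 -cstarD addNr cstar0. Qed.

Lemma cstarB a b : (a - b)^# = a^# - b^#.
Proof. by rewrite cstarD cstarN. Qed.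

Lemma cstar1 : (1 : A)^# = 1.
Proof. by rewrite -[LHS]mul1r -{1}(cstarK (1 : A)) -cstarM mul1r cstarK. Qed.

Lemma cstarZr r a : (r *r a)^# = r *r a^#.
Proof. by rewrite cstarZ /= oppr0. Qed.

Lemma cstarZi a : ('i *: a)^# = - ('i *: a^#).
Proof.
by rewrite cstarZ -scaleNr; congr (_ *: _); apply/eqP; rewrite eq_complex /= oppr0 !eqxx.
Qed.

Lemma cnorm_star a : N a^# = N a.
Proof.
suff H b : N b <= N b^# by apply/eqP; rewrite eq_le H andbT -{2}(cstarK a) H.
have := cnormM b^# b; rewrite cnorm_starM expr2.
have [->|] := eqVneq (N b) 0; first by rewrite !cnorm_ge0.
by move=> b0; rewrite ler_pM2r // lt_def b0 cnorm_ge0.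
Qed.

Lemma cnormMstar a : N (a * a^#) = N a ^+ 2.
Proof. by rewrite -{1}(cstarK a) cnorm_starM cnorm_star. Qed.

Lemma cnorm1_le1 : N 1 <= 1.
Proof.
have := cnorm_starM (1 : A); rewrite cstar1 mul1r expr2.
have := cnorm_ge0 1; set n := N 1 => n0 /esym nn.
have [->|nz] := eqVneq n 0; first by [].
by have -> : n = 1 by apply: (mulfI nz); rewrite mulr1.
Qed.

Definition csa a := a^# = a.

Lemma csa_sqr a : csa a -> N (a * a) = N a ^+ 2.
Proof. by move=> h; rewrite -{1}h cnorm_starM. Qed.

Lemma csa1 : csa 1. Proof. exact: cstar1. Qed.
Lemma csa0 : csa 0. Proof. exact: cstar0. Qed.
Lemma csaD a b : csa a -> csa b -> csa (a + b).
Proof. by rewrite /csa cstarD => -> ->. Qed.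
Lemma csaN a : csa a -> csa (- a).
Proof. by rewrite /csa cstarN => ->. Qed.
Lemma csaB a b : csa a -> csa b -> csa (a - b).
Proof. by move=> ? ?; apply/csaD/csaN. Qed.
Lemma csaZ r a : csa a -> csa (r *r a).
Proof. by rewrite /csa cstarZr => ->. Qed.
Lemma csaM a b : csa a -> csa b -> GRing.comm a b -> csa (a * b).
Proof. by rewrite /csa cstarM => -> -> ->. Qed.
Lemma csa_starM a : csa (a^# * a).
Proof. by rewrite /csa cstarM cstarK. Qed.
Lemma csaX a n : csa a -> csa (a ^+ n).
Proof.
move=> ha; elim: n => [|n IH]; first exact: csa1.
by rewrite exprS; apply: csaM => //; exact: commrX.
Qed.

Lemma csa_lim a : (forall e, 0 < e -> exists2 b, csa b & N (a - b) <= e) -> csa a.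
Proof.
move=> H; apply/eqP; rewrite -subr_eq0; apply/eqP/cnorm_le0 => e e0.
have [|b hb hn] := H (e / 2); first by lra.
have -> : a^# - a = (a - b)^# - (a - b).
  by rewrite cstarB hb opprB addrA subrK.
by have := cnormB (a - b)^# (a - b); rewrite cnorm_star; lra.
Qed.

Lemma commr_lim a w : (forall e, 0 < e -> exists2 b, w * b = b * w & N (a - b) <= e) ->
  w * a = a * w.
Proof.
move=> H; apply/eqP; rewrite -subr_eq0; apply/eqP/cnorm_le0 => e e0.
have w0 := cnorm_ge0 w.
have [|b hb hn] := H (e / (2 * (N w + 1))).
  by rewrite divr_gt0 //; lra.
have -> : w * a - a * w = w * (a - b) - (a - b) * w.
  by rewrite mulrBr mulrBl hb opprB addrA subrK.
have := cnormB (w * (a - b)) ((a - b) * w).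
have := cnormM w (a - b); have := cnormM (a - b) w.
move: hn; rewrite ler_pdivlMr; last by lra.
have := cnorm_ge0 (a - b).
set x := N (a - b) => x0 hx h1 h2 h3.
by nra.
Qed.

Lemma cnorm_half a : N (2^-1 *r a) = N a / 2.
Proof. by rewrite cnormZ ger0_norm ?invr_ge0 // mulrC. Qed.

Lemma half_double a : 2^-1 *r (a + a) = a.
Proof.
rewrite -mulr2n -[a *+ 2]scaler_nat scalerA.
suff -> : (2^-1)%:C * 2%:R = 1 :> R[i] by rewrite scale1r.
by rewrite -(rmorph_nat (real_complex R)) -rmorphM mulVf.
Qed.

Section SquareRoot.
Variable z : A.
Hypotheses (z1 : N z <= 1) (zsa : csa z).

(* Converges to [1 - sqrt (1 - z)] for [|z| <= 1], dominated by the case [z = 1] in [R]. *)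
Fixpoint sqrt_it n : A :=
  if n is m.+1 then 2^-1 *r (z + sqrt_it m * sqrt_it m) else 0.
Fixpoint sqrt_maj n : R := if n is m.+1 then (1 + sqrt_maj m ^+ 2) / 2 else 0.

Lemma sqrt_maj01 n : 0 <= sqrt_maj n <= 1.
Proof.
elim: n => [|n /andP[h1 h2]] /=; first by rewrite lexx ler01.
by apply/andP; split; nra.
Qed.

Lemma sqrt_it_le n : N (sqrt_it n) <= sqrt_maj n.
Proof.
elim: n => [|n IH] /=; first by rewrite cnorm0.
rewrite cnorm_half.
have := cnormD z (sqrt_it n * sqrt_it n).
have := cnormM (sqrt_it n) (sqrt_it n).
have n0 := cnorm_ge0 (sqrt_it n); have := ler_pM n0 n0 IH IH.
by rewrite -expr2; move: z1; lra.
Qed.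

(** For consecutive iterates [x], [y] the next increment is half of [y (y - x) + (y - x) x]. The
    majorant obeys the same recursion in [R], so the domination of increments propagates. *)
Lemma sqrt_itS n : N (sqrt_it n.+1 - sqrt_it n) <= sqrt_maj n.+1 - sqrt_maj n.
Proof.
elim: n => [|n IH].
  rewrite /= subr0 mul0r addr0 cnorm_half.
  by rewrite expr0n /= addr0 subr0; move: z1; lra.
set y := sqrt_it n.+1 in IH *; set x := sqrt_it n in IH *.
have E : sqrt_it n.+2 - y = 2^-1 *r (y * (y - x) + (y - x) * x).
  rewrite /= -/y {2}/y /= -/x -scalerBr; congr (_ *: _).
  by rewrite mulrBr mulrBl addrA subrK opprD addrACA subrr add0r.
rewrite E cnorm_half.
have := cnormD (y * (y - x)) ((y - x) * x).
have := cnormM y (y - x); have := cnormM (y - x) x.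
have := sqrt_it_le n; have := sqrt_it_le n.+1; rewrite -/y -/x.
have := cnorm_ge0 y; have := cnorm_ge0 x; have := cnorm_ge0 (y - x).
have -> : sqrt_maj n.+2 = (1 + sqrt_maj n.+1 ^+ 2) / 2 by [].
have : sqrt_maj n.+1 = (1 + sqrt_maj n ^+ 2) / 2 by [].
move: IH (sqrt_maj01 n) (sqrt_maj01 n.+1) => + /andP[+ +] /andP[+ +].
move: (sqrt_maj n.+1) (sqrt_maj n) => t s.
move=> h1 h2 h3 h4 h5 ht h6 h7 h8 h9 h10 h11 h12 h13.
have h14 : N (y - x) * N x <= (t - s) * s by apply: ler_pM.
have h15 : N y * N (y - x) <= t * (t - s) by apply: ler_pM.
nra.
Qed.

Lemma sqrt_it_dist n (k : nat) : N (sqrt_it (n + k) - sqrt_it n) <= sqrt_maj (n + k) - sqrt_maj n.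
Proof.
elim: k => [|k IH]; first by rewrite addn0 !subrr cnorm0.
rewrite addnS; have := sqrt_itS (n + k).
have := cnormD (sqrt_it (n + k).+1 - sqrt_it (n + k)) (sqrt_it (n + k) - sqrt_it n).
rewrite addrA subrK; lra.
Qed.

Lemma sqrt_it_lim : exists y, forall e, 0 < e -> exists n, forall p, (n <= p)%N ->
       N (sqrt_it p - y) <= e.
Proof.
apply: (@cnorm_complete_ _ _ D sqrt_it) => e e0.
(* The majorant increases and is bounded by 1, hence is Cauchy; its limit need not be known. *)
have hs : has_sup (range sqrt_maj).
  split; first by exists (sqrt_maj 0); exists 0%N.
  by exists 1 => _ [n _ <-]; case/andP: (sqrt_maj01 n).
have [|_ [n _ <-] hn] := sup_adherent (eps := e / 2) _ hs; first by lra.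
exists n => p q np nq; rewrite -/(N _).
have dst m : (n <= m)%N -> N (sqrt_it m - sqrt_it n) <= e / 2.
  move=> nm; have := sqrt_it_dist n (m - n); rewrite subnKC //.
  have : sqrt_maj m <= sup (range sqrt_maj).
    by apply: ub_le_sup; [case: hs | exists m].
  lra.
have := cnormB (sqrt_it p - sqrt_it n) (sqrt_it q - sqrt_it n).
have -> : sqrt_it p - sqrt_it n - (sqrt_it q - sqrt_it n) = sqrt_it p - sqrt_it q.
  by rewrite opprB addrA subrK.
have := dst _ np; have := dst _ nq; lra.
Qed.

Lemma sqrt_it_sa n : csa (sqrt_it n).
Proof.
elim: n => [|n IH] /=; first exact: csa0.
by apply/csaZ/csaD => //; apply: csaM.
Qed.

Lemma sqrt_it_comm w n : w * z = z * w -> w * sqrt_it n = sqrt_it n * w.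
Proof.
move=> wz; elim: n => [|n IH] /=; first by rewrite mulr0 mul0r.
rewrite -cscaleAr -cscaleAl; congr (_ *: _).
by rewrite mulrDr mulrDl wz !mulrA IH -!mulrA IH.
Qed.

Lemma csqrt1B : exists y, [/\ csa y, N y <= 1,
  forall w, w * z = z * w -> w * y = y * w & (1 - y) * (1 - y) = 1 - z].
Proof.
have [y hy] := sqrt_it_lim.
have y1 : N y <= 1.
  apply/ler_addgt0Pl => e e0; have [n /(_ n (leqnn n)) hn] := hy _ e0.
  have := cnormB (sqrt_it n) (sqrt_it n - y); rewrite opprB addrC subrK.
  by have := sqrt_it_le n; have /andP[h1 h2] := sqrt_maj01 n; lra.
exists y; split=> //.
- apply: csa_lim => e /hy [n /(_ n (leqnn n)) hn].
  by exists (sqrt_it n); [exact: sqrt_it_sa | rewrite cdistC].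
- move=> w wz; apply: commr_lim => e /hy [n /(_ n (leqnn n)) hn].
  by exists (sqrt_it n); [exact: sqrt_it_comm | rewrite cdistC].
(* The limit form of the recursion [2 u' = z + u u]. *)
have -> : z = y + y - y * y.
  apply/eqP; rewrite -subr_eq0; apply/eqP/cnorm_le0 => e e0.
  have [|n hn] := hy (e / 4); first by lra.
  have Hn := hn n (leqnn n); have HSn := hn n.+1 (leqnSn n).
  set u := sqrt_it n in Hn; set u' := sqrt_it n.+1 in HSn.
  have zE : z = u' + u' - u * u.
    rewrite -[LHS](addrK (u * u)); congr (_ - _).
    rewrite -scalerDr half_double //.
  have -> : z - (y + y - y * y) =
     ((u' - y) + (u' - y)) - (u * (u - y) + (u - y) * y).
    by rewrite {1}zE mulrBr mulrBl; abel.
  have := cnormB ((u' - y) + (u' - y)) (u * (u - y) + (u - y) * y).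
  have := cnormD (u' - y) (u' - y).
  have := cnormD (u * (u - y)) ((u - y) * y).
  have := cnormM u (u - y); have := cnormM (u - y) y.
  have := sqrt_it_le n; have /andP[h1 h2] := sqrt_maj01 n; rewrite -/u.
  have := cnorm_ge0 u; have := cnorm_ge0 y; have := cnorm_ge0 (u - y).
  nra.
by rewrite mulrBr mulr1 mulrBl mul1r; abel.
Qed.

End SquareRoot.
End CstarTheory.

(** * Positive elements without spectra *)

Section CstarPositive.
Variables (R : realType) (V : lmodType R[i]) (D : cstarAlg V).
Local Notation A := (calg D).
Implicit Types (a b h k u v w : A) (r t e : R).
Local Notation N := (@cnorm R V D).
Local Notation "a ^#" := (cstar a).
Local Notation "r *r a" := (r%:C *: a) (at level 40).

Definition crs r : A := r *r (1 : A).

Lemma crs_mull r a : crs r * a = r *r a.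
Proof. by rewrite /crs -cscaleAl mul1r. Qed.
Lemma crs_mulr r a : a * crs r = r *r a.
Proof. by rewrite /crs -cscaleAr mulr1. Qed.
Lemma crsD r t : crs (r + t) = crs r + crs t.
Proof. by rewrite /crs rmorphD scalerDl. Qed.
Lemma crsN r : crs (- r) = - crs r.
Proof. by rewrite /crs rmorphN scaleNr. Qed.
Lemma crsB r t : crs (r - t) = crs r - crs t.
Proof. by rewrite crsD crsN. Qed.
Lemma crsM r t : crs (r * t) = crs r * crs t.
Proof. by rewrite crs_mull /crs rmorphM scalerA. Qed.
Lemma crs1 : crs 1 = 1. Proof. by rewrite /crs scale1r. Qed.
Lemma crs0 : crs 0 = 0. Proof. by rewrite /crs scale0r. Qed.
Lemma csa_crs r : csa (crs r). Proof. exact/csaZ/csa1. Qed.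
Lemma crs_comm r a : GRing.comm a (crs r).
Proof. by rewrite /GRing.comm crs_mull crs_mulr. Qed.
Lemma cnorm_crs r : N (crs r) <= `|r|.
Proof. by rewrite /crs cnormZ -[leRHS]mulr1 ler_wpM2l // cnorm1_le1. Qed.

Lemma scaleii a : 'i *: ('i *: a) = - a.
Proof.
rewrite scalerA -[RHS]scaleN1r; congr (_ *: _).
by apply/eqP; rewrite eq_complex /=; apply/andP; split; apply/eqP; ring.
Qed.

Lemma cartesian_star k w : csa k -> csa w -> (k + 'i *: w)^# = k - 'i *: w.
Proof. by move=> hk hw; rewrite cstarD cstarZi hk hw. Qed.

Lemma cartesian_starM k w : csa k -> csa w -> GRing.comm k w ->
  (k + 'i *: w)^# * (k + 'i *: w) = k * k + w * w.
Proof.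
move=> hk hw kw; rewrite cartesian_star // mulrBl !mulrDr.
rewrite -!cscaleAl -!cscaleAr scaleii kw; abel.
Qed.

(** With [w] a square root of [1 - k^2] commuting with [k], the element [u = k + i w] is an
    isometry, as [u^# u = 1]. Then [1 - k^2 = w^2] is a quarter of [2 - u^2 - (u^#)^2], whose norm
    is at most 4. *)
Lemma csqr_le1 k : csa k -> N k <= 1 -> N (1 - k * k) <= 1.
Proof.
move=> hk k1.
have z1 : N (k * k) <= 1.
  by rewrite csa_sqr // expr_le1 ?cnorm_ge0.
have [y [ysa y1 yc yz]] := csqrt1B z1 (csaM hk hk (erefl _)).
have kw : GRing.comm k (1 - y).
  by apply: commrB; [exact: commr1 | apply: yc; rewrite mulrA].
set w := 1 - y in yz kw; have wsa : csa w by apply: csaB => //; exact: csa1.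
pose u := k + 'i *: w.
have uu : u^# * u = 1 by rewrite cartesian_starM // yz; abel.
have u1 : N u <= 1.
  have := cnorm_starM u; rewrite uu => E.
  by rewrite -(expr_le1 (n := 2)) ?cnorm_ge0 // -E cnorm1_le1.
have us1 : N u^# <= 1 by rewrite cnorm_star.
have E : 1 - k * k = 2^-1 *r (2^-1 *r ((1 + 1) - (u * u + u^# * u^#))).
  rewrite cartesian_star // /u !mulrDl !mulrBr !mulrDr -!cscaleAl -!cscaleAr.
  rewrite ?mulNr ?mulrN -?cscaleAl -?cscaleAr ?scalerN ?scaleii kw yz.
  rewrite -[LHS]half_double -[X in _ *: X]half_double; congr (_ *: (_ *: _)).
  abel.
rewrite E !cnorm_half.
have := cnormB (1 + 1) (u * u + u^# * u^#).
have := cnormD 1 (1 : A); have := cnorm1_le1 D; have := cnormD (u * u) (u^# * u^#).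
have := cnormM u u; have := cnormM u^# u^#.
have := cnorm_ge0 u; have := cnorm_ge0 u^#.
move=> g1 g2; have := ler_pM g1 g1 us1 us1; have := ler_pM g2 g2 u1 u1.
lra.
Qed.

Lemma csqr_dist k t : csa k -> N k ^+ 2 <= t -> N (crs t - k * k) <= t.
Proof.
move=> hk kt.
have t0 : 0 <= t by apply: le_trans kt; rewrite sqr_ge0.
have [t00|tn0] := eqVneq t 0.
  have k0 : k = 0.
    apply: cnorm_eq0; apply/eqP; rewrite -sqrf_eq0 eq_le sqr_ge0 andbT.
    by rewrite -t00.
  by rewrite k0 mul0r subr0 (le_trans (cnorm_crs _)) ?ger0_norm.
have tp : 0 < t by rewrite lt_def tn0.
pose s := Num.sqrt t; have sp : 0 < s by rewrite sqrtr_gt0.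
have ss : s ^+ 2 = t by rewrite sqr_sqrtr.
have h1 : csa (s^-1 *r k) by exact: csaZ.
have h2 : N (s^-1 *r k) <= 1.
  rewrite cnormZ ger0_norm ?invr_ge0 ?(ltW sp) // mulrC ler_pdivrMr // mul1r.
  by rewrite -(ler_pXn2r (n := 2)) ?nnegrE ?cnorm_ge0 ?(ltW sp) // ss.
have := csqr_le1 h1 h2.
have -> : 1 - s^-1 *r k * (s^-1 *r k) = t^-1 *r (crs t - k * k).
  rewrite scalerBr -cscaleAl -cscaleAr scalerA -rmorphM -expr2 exprVn ss.
  by rewrite /crs scalerA -rmorphM mulVf // scale1r.
rewrite cnormZ ger0_norm ?invr_ge0 ?(ltW tp) // mulrC ler_pdivrMr //.
by rewrite mul1r.
Qed.

(* Positivity without spectra: [|t - h| <= t] for all [t >= |h|]. *)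
Definition cpos h := csa h /\ forall t, N h <= t -> N (crs t - h) <= t.

Lemma cpos_sa h : cpos h -> csa h. Proof. by case. Qed.

Lemma cpos_sqr k : csa k -> cpos (k * k).
Proof.
move=> hk; split; first exact: csaM.
by move=> t; rewrite csa_sqr //; exact: csqr_dist.
Qed.

(** [h / t = 1 - z] with [N z <= 1], and the iteration gives a root of [1 - z]. The last clause is
    what makes the root positive in its turn. *)
Lemma csqrt_ex h t : csa h -> 0 < t -> N (crs t - h) <= t -> exists k,
  [/\ csa k, forall w, w * h = h * w -> w * k = k * w, k * k = h &
      N (crs (Num.sqrt t) - k) <= Num.sqrt t].
Proof.
move=> hsa tp ht; pose s := Num.sqrt t; have sp : 0 < s by rewrite sqrtr_gt0.
have ss : s ^+ 2 = t by rewrite sqr_sqrtr // ltW.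
pose z := 1 - t^-1 *r h.
have z1 : N z <= 1.
  have -> : z = t^-1 *r (crs t - h).
    by rewrite scalerBr /crs scalerA -rmorphM mulVf ?scale1r // gt_eqF.
  rewrite cnormZ ger0_norm ?invr_ge0 ?(ltW tp) // mulrC ler_pdivrMr //.
  by rewrite mul1r.
have [y [ysa y1 yc yz]] := csqrt1B z1 (csaB (csa1 D) (csaZ _ hsa)).
exists (s *r (1 - y)); split.
- exact/csaZ/csaB/ysa/csa1.
- move=> w wh; rewrite -cscaleAr -cscaleAl; congr (_ *: _).
  rewrite mulrBr mulrBl mulr1 mul1r yc //.
  by rewrite /z mulrBr mulrBl mulr1 mul1r -cscaleAr -cscaleAl wh.
- rewrite -cscaleAl -cscaleAr scalerA -rmorphM -expr2 ss yz /z.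
  by rewrite opprB addrC subrK scalerA -rmorphM mulfV ?scale1r // gt_eqF.
- rewrite -/s; have -> : crs s - s *r (1 - y) = s *r y.
    by rewrite /crs -scalerBr opprB addrC subrK.
  by rewrite cnormZ (gtr0_norm sp) -[leRHS]mulr1 ler_pM2l.
Qed.

Lemma cpos0 : cpos 0.
Proof. by rewrite -(mul0r 0); exact/cpos_sqr/csa0. Qed.

(** One radius suffices: it already makes [h] a square, and squares satisfy the condition for every
    radius. *)
Lemma cpos_intro h t : csa h -> 0 <= t -> N (crs t - h) <= t -> cpos h.
Proof.
move=> hsa; rewrite le_eqVlt => /orP[/eqP <-|tp] ht.
  suff -> : h = 0 by exact: cpos0.
  apply: cnorm_eq0; apply/eqP; rewrite eq_le cnorm_ge0 andbT.
  by move: ht; rewrite crs0 sub0r cnormN.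
by have [k [ksa _ <- _]] := csqrt_ex hsa tp ht; exact: cpos_sqr.
Qed.

Lemma cpos_sqrt h : cpos h -> exists k,
  [/\ cpos k, forall w, w * h = h * w -> w * k = k * w & k * k = h].
Proof.
move=> [hsa hp]; have [h0|hn0] := eqVneq (N h) 0.
  exists 0; split; first exact: cpos0.
    by move=> w _; rewrite mulr0 mul0r.
  by rewrite mul0r (cnorm_eq0 h0).
have hh : 0 < N h by rewrite lt_def hn0 cnorm_ge0.
have [k [h1 h2 h3 h4]] := csqrt_ex hsa hh (hp _ (lexx _)).
exists k; split => //; apply: cpos_intro h4 => //; exact: sqrtr_ge0.
Qed.

Lemma cposD h k : cpos h -> cpos k -> cpos (h + k).
Proof.
move=> [hsa hp] [ksa kp]; apply: (@cpos_intro _ (N h + N k)).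
- exact: csaD.
- by rewrite addr_ge0 ?cnorm_ge0.
- have -> : crs (N h + N k) - (h + k) = (crs (N h) - h) + (crs (N k) - k).
    by rewrite crsD; abel.
  by rewrite (le_trans (cnormD _ _)) // lerD ?hp ?kp.
Qed.

Lemma cposZ r h : 0 <= r -> cpos h -> cpos (r *r h).
Proof.
move=> r0 [hsa hp]; apply: (@cpos_intro _ (r * N h)).
- exact: csaZ.
- by rewrite mulr_ge0 ?cnorm_ge0.
- have -> : crs (r * N h) - r *r h = r *r (crs (N h) - h).
    by rewrite scalerBr /crs rmorphM scalerA.
  by rewrite cnormZ ger0_norm // ler_wpM2l // hp.
Qed.

Lemma cpos1 : cpos 1.
Proof. by rewrite -(mulr1 1); exact/cpos_sqr/csa1. Qed.

Lemma cposM h k : cpos h -> cpos k -> GRing.comm h k -> cpos (h * k).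
Proof.
move=> hp kp hk.
have [x [xp xc xh]] := cpos_sqrt hp; have [y [yp yc yk]] := cpos_sqrt kp.
have xk : k * x = x * k by apply: xc; rewrite hk.
have xy : x * y = y * x by apply: yc.
have -> : h * k = (x * y) * (x * y).
  by rewrite -xh -yk !mulrA -(mulrA x y x) -xy !mulrA.
by apply/cpos_sqr/csaM => //; exact: cpos_sa.
Qed.

Lemma cposX h n : cpos h -> cpos (h ^+ n).
Proof.
move=> hp; elim: n => [|n IH]; first exact: cpos1.
by rewrite exprS; apply: cposM => //; exact: commrX.
Qed.

Lemma cpos_lim h : (forall e, 0 < e -> exists2 k, cpos k & N (h - k) <= e) -> cpos h.
Proof.
move=> H; split.
  by apply: csa_lim => e /H[k [ksa _] hk]; exists k.
move=> t ht; apply/ler_addgt0Pl => e e0.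
have [|k [ksa kp] hk] := H (e / 3); first by lra.
have kt : N k <= t + e / 3.
  have := cnormB h (h - k); rewrite opprB addrC subrK; lra.
have := kp _ kt.
have -> : crs t - h = (crs (t + e / 3) - k) - crs (e / 3) - (h - k).
  by rewrite crsD; abel.
have := cnormB (crs (t + e / 3) - k - crs (e / 3)) (h - k).
have := cnormB (crs (t + e / 3) - k) (crs (e / 3)).
have := cnorm_crs (e / 3); rewrite ger0_norm; last by lra.
lra.
Qed.

Lemma cpos_crsB k t : csa k -> N k <= t -> cpos (crs t - k).
Proof.
move=> ksa kt; apply: (@cpos_intro _ t).
- by apply: csaB => //; exact: csa_crs.
- by apply: le_trans kt; exact: cnorm_ge0.
- by rewrite opprB addrC subrK.
Qed.

(** Let [w] be the root of [h (t - h)] and [x = h - t/2]. Then [x^2 + w^2 = (t/2)^2], so [x + i w]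
    has norm at most [t/2], and so has its real part [x]. *)
Lemma cpos_le h t : 0 <= t -> cpos h -> cpos (crs t - h) -> N h <= t.
Proof.
move=> t0 hp thp; have hsa := cpos_sa hp.
have hc : GRing.comm h (crs t - h) by apply: commrB; [exact: crs_comm | ].
have [w [wp wc ww]] := cpos_sqrt (cposM hp thp hc).
have wsa := cpos_sa wp.
pose x := h - crs (t / 2).
have xsa : csa x by apply: csaB => //; exact: csa_crs.
have hw : h * w = w * h.
  by apply: wc; rewrite -mulrA -hc mulrA.
have xw : GRing.comm x w.
  by rewrite /GRing.comm /x mulrBl mulrBr hw crs_comm.
have xw2 : x * x + w * w = crs ((t / 2) ^+ 2).
  rewrite ww /x mulrBr !mulrBl mulrBr -(crs_comm _ h) expr2 [RHS]crsM.
  have -> : h * crs t = h * crs (t / 2) + h * crs (t / 2).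
    by rewrite -mulrDr -crsD; congr (_ * crs _); field.
  abel.
pose u := x + 'i *: w.
have ut : N u <= t / 2.
  have := cnorm_starM u; rewrite cartesian_starM // xw2 => E.
  rewrite -(ler_pXn2r (n := 2)) ?nnegrE ?cnorm_ge0 //; last by lra.
  by rewrite -E (le_trans (cnorm_crs _)) // ger0_norm // sqr_ge0.
have xt : N x <= t / 2.
  have -> : x = 2^-1 *r (u + u^#).
    rewrite cartesian_star // /u; rewrite -[LHS]half_double; congr (_ *: _); abel.
  by rewrite cnorm_half; have := cnormD u u^#; rewrite cnorm_star; lra.
have := cnormD x (crs (t / 2)); rewrite subrK.
have := cnorm_crs (t / 2); rewrite ger0_norm; last by lra.
lra.
Qed.

Lemma cpos_mono h k : cpos h -> cpos (k - h) -> N h <= N k.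
Proof.
move=> hp khp; apply: cpos_le => //; first exact: cnorm_ge0.
have -> : crs (N k) - h = (crs (N k) - k) + (k - h) by abel.
apply: cposD => //; apply: cpos_crsB => //.
have -> : k = h + (k - h) by abel.
by apply: csaD; exact: cpos_sa.
Qed.

(* With [t = 1 - s], this is Bernoulli's [(n.+1) s t^n <= s (1 + t + ... + t^n)],
   whose right-hand side is [1 - t^n.+1]. *)
Lemma cpos_mul_pow s n : cpos s -> cpos (1 - s) ->
  cpos (1 - (n.+1)%:R *r (s * (1 - s) ^+ n)).
Proof.
move=> sp tp; set t := 1 - s in tp *.
have ts : s = 1 - t by rewrite /t; abel.
have cst : GRing.comm s t by apply: commrB; [exact: commr1|].
suff H : cpos (1 - t ^+ n.+1 - (n.+1)%:R *r (s * t ^+ n)).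
  have -> : 1 - (n.+1)%:R *r (s * t ^+ n) =
     (1 - t ^+ n.+1 - (n.+1)%:R *r (s * t ^+ n)) + t ^+ n.+1 by abel.
  by apply: cposD => //; exact: cposX.
elim: n => [|n IH].
  by rewrite expr1 expr0 mulr1 scale1r -ts subrr; exact: cpos0.
have -> : 1 - t ^+ n.+2 - (n.+2)%:R *r (s * t ^+ n.+1) =
   (1 - t ^+ n.+1 - (n.+1)%:R *r (s * t ^+ n)) +
   (n.+1)%:R *r (s * s * t ^+ n).
  have E1 : s * t ^+ n.+1 = t ^+ n.+1 - t ^+ n.+2.
    by rewrite {1}ts mulrBl mul1r -exprS.
  have E0 : s * t ^+ n = t ^+ n - t ^+ n.+1.
    by rewrite {1}ts mulrBl mul1r -exprS.
  rewrite -mulrA E0 mulrBr E0 E1 -[(n.+2)%:R]natr1 rmorphD scalerDl scale1r.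
  rewrite !scalerBr; abel.
apply: cposD => //; apply: cposZ; first exact: ler0n.
apply: cposM; [exact: cpos_sqr (cpos_sa sp) | exact: cposX|].
by apply: commrX; apply: commr_sym; apply: commrM; apply: commr_sym.
Qed.

(** This rate is what makes both the absolute value and the approximate units converge. *)
Lemma cnorm_mul_pow s n : cpos s -> cpos (1 - s) ->
  N (s * (1 - s) ^+ n) <= (n.+1)%:R^-1.
Proof.
move=> sp tp; have H := cpos_mul_pow n sp tp.
have p0 : 0 < (n.+1)%:R :> R by rewrite ltr0n.
rewrite -(ler_pM2l p0) mulfV ?gt_eqF // -{1}(ger0_norm (ltW p0)) -cnormZ.
apply: cpos_le; [exact: ler01| |by rewrite crs1].
apply: cposZ; first exact: ltW.
apply: cposM => //; first exact: cposX.
by apply: commrX; apply: commrB; [exact: commr1|].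
Qed.

End CstarPositive.

(** * Absolute values and the positivity of [a^# * a] *)

Section CstarOrder.
Variables (R : realType) (V : lmodType R[i]) (D : cstarAlg V).
Local Notation A := (calg D).
Implicit Types (a b h k u v w : A) (r t e : R).
Local Notation N := (@cnorm R V D).
Local Notation "a ^#" := (cstar a).
Local Notation "r *r a" := (r%:C *: a) (at level 40).

Lemma cnorm_sqr_le0 a : csa a -> a * a = 0 -> a = 0.
Proof.
move=> asa aa; apply: cnorm_eq0; apply/eqP; rewrite -sqrf_eq0 -csa_sqr // aa.
by rewrite cnorm0.
Qed.

Lemma exists_inv_le (K e : R) : 0 < e -> exists n : nat, K / n.+1%:R <= e.
Proof.
move=> e0; exists (archimedean.Num.truncn (K / e)).
rewrite ler_pdivrMr ?ltr0n // mulrC -ler_pdivrMr // ltW //.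
by rewrite -archimedean.Num.Theory.truncn_le_nat.
Qed.

Lemma half_add a : 2^-1 *r a + 2^-1 *r a = a.
Proof. by rewrite -scalerDr half_double. Qed.

Lemma scale2r a : 2 *r a = a + a.
Proof. by rewrite (_ : 2 = 1 + 1 :> R) // rmorphD scalerDl scale1r. Qed.

(** Only [0 <= s - h] needs work. From [s^2 = h^2], [y = s - h] satisfies [y^2 = 2 s y], so [y s] is
    positive. With [s' = s / M] and [t = 1 - s'], [y - y t^n] is the sum of the positive [y s' t^j],
    and [y t^n -> 0] since its square is [2 M y s' t^(2n)]. *)
Lemma cabs_ex h : csa h -> exists s, [/\ cpos s, s * s = h * h, s * h = h * s &
  cpos (s - h)].
Proof.
move=> hsa; have [s [sp sc ss]] := cpos_sqrt (cpos_sqr hsa).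
have sh : s * h = h * s by symmetry; apply: sc; rewrite mulrA.
exists s; split => //.
set y := s - h; have ssa := cpos_sa sp.
have ysa : csa y by exact: csaB.
have sy : GRing.comm s y by apply: commrB.
have yy : y * y = 2 *r (s * y).
  rewrite scale2r /y !mulrBr !mulrBl -ss sh; abel.
pose M := N s + 1; have M0 : 0 < M by have := cnorm_ge0 s; rewrite /M; lra.
have MV : 0 <= M^-1 by rewrite invr_ge0 ltW.
pose s' := M^-1 *r s; pose t := 1 - s'.
have s'p : cpos s' by exact: cposZ.
have sM : s = M *r s' by rewrite /s' scalerA -rmorphM mulfV ?scale1r // gt_eqF.
have tp : cpos t.
  rewrite /t -(crs1 D); apply: cpos_crsB; first exact: cpos_sa.
  by rewrite cnormZ ger0_norm // mulrC ler_pdivrMr // mul1r /M; lra.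
have s'y : GRing.comm y s'.
  by rewrite /GRing.comm /s' -cscaleAl -cscaleAr sy.
have ct : GRing.comm y t by apply: commrB; [exact: commr1 | exact: s'y].
have ys'p : cpos (y * s').
  have -> : y * s' = (2^-1 * M^-1) *r (y * y).
    rewrite yy scalerA -rmorphM -cscaleAr -sy; congr (_%:C *: _).
    by rewrite mulrAC mulVf ?mul1r.
  by apply: cposZ; [rewrite mulr_ge0 // invr_ge0 | exact: cpos_sqr].
have pn n : cpos (y - y * t ^+ n).
  elim: n => [|n IH]; first by rewrite expr0 mulr1 subrr; exact: cpos0.
  have -> : y - y * t ^+ n.+1 = (y - y * t ^+ n) + y * s' * t ^+ n.
    have s't : s' = 1 - t by rewrite /t; abel.
    by rewrite exprS s't mulrBr mulr1 (mulrBl (t ^+ n) y) !mulrA; abel.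
  apply: cposD => //; apply: cposM => //; first exact: cposX.
  apply: commrX; apply: commr_sym; apply: commrM; apply: commr_sym => //.
  by apply: commrB; [exact: commr1|].
apply: cpos_lim => e e0.
have [|n hn] := @exists_inv_le (2 * M * N y) (e ^+ 2); first by rewrite exprn_gt0.
exists (y - y * t ^+ n) => //.
have -> : y - (y - y * t ^+ n) = y * t ^+ n by abel.
rewrite -(ler_pXn2r (n := 2)) ?nnegrE ?cnorm_ge0 ?(ltW e0) //.
have ysat : csa (y * t ^+ n).
  by apply: csaM => //; [exact/csaX/cpos_sa | exact: commrX].
rewrite -csa_sqr //; apply: le_trans hn.
have -> : y * t ^+ n * (y * t ^+ n) = (2 * M) *r (y * (s' * t ^+ (n + n))).
  rewrite -mulrA (mulrA _ y) -(commrX n ct) -!mulrA -exprD mulrA yy.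
  rewrite -cscaleAl rmorphM -scalerA; congr (_ *: _).
  by rewrite {1}sM -2!cscaleAl mulrA s'y.
rewrite cnormZ ger0_norm; last by rewrite mulr_ge0 ?(ltW M0).
rewrite -!mulrA; do 2! (rewrite ler_wpM2l ?(ltW M0) //).
apply: le_trans (cnormM _ _) _; rewrite ler_wpM2l ?cnorm_ge0 //.
apply: le_trans (cnorm_mul_pow _ s'p tp) _.
by rewrite lef_pV2 ?posrE ?ltr0n // ler_nat ltnS leq_addr.
Qed.

(** With [s] the absolute value of [h] and [y = s - h], twice the negative part of [h], the element
    [c = a y] satisfies [c^# c = - s y^2 <= 0]. The aim is to show that this forces [s y^2 = 0],
    hence [y = 0]. *)
Lemma cpos_starM a : cpos (a^# * a).
Proof.
set h := a^# * a; have hsa : csa h by exact: csa_starM.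
have [s [sp ss sh yp]] := cabs_ex hsa; set y := s - h in yp.
have ysa := cpos_sa yp; have ssa := cpos_sa sp.
have sy : GRing.comm s y by apply: commrB.
have hy : h * y = - (s * y).
  by rewrite /y !mulrBr -sh ss; abel.
have yy : y * y = s * y + s * y.
  rewrite /y !mulrBr !mulrBl ss sh; abel.
have [c cE] : exists c, c = a * y by eexists.
have [p pE] : exists p, p = s * (y * y) by eexists.
pose q := c * c^#.
have pp : cpos p.
  by rewrite pE; apply: cposM => //; [exact: cpos_sqr | exact: commrM].
have ccp : c^# * c = - p.
  by rewrite cE pE cstarM ysa -!mulrA (mulrA a^#) -/h hy mulrN (mulrA y) -sy -mulrA.
have qp : cpos q.
  (* For the real part [k] and, up to sign, the imaginary part [w] of [c],
     [c c^# + c^# c = 2 k^2 + 2 w^2]; as [c^# c = - p], this makes [c c^#] positive. *)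
  pose k := 2^-1 *r (c + c^#); pose w' := 2^-1 *r (c^# - c).
  pose w := 'i *: w'.
  have ksa : csa k by apply: csaZ; rewrite /csa cstarD cstarK addrC.
  have wsa : csa w.
    by rewrite /csa cstarZi /w' cstarZr cstarB cstarK -scalerN -scalerN opprB.
  have -> : q = (k * k + k * k) + (w * w + w * w) + p.
    have -> : w * w = - (w' * w') by rewrite -cscaleAl -cscaleAr scaleii.
    rewrite -[p]opprK -ccp /q /k /w' -!cscaleAl -!cscaleAr !half_add -opprD half_add.
    rewrite -scalerBr -[c * c^#]half_double -[c^# * c]half_double -scalerBr.
    congr (_ *: _).
    by rewrite !mulrDl !mulrDr ?mulNr ?mulrN; abel.
  apply: cposD => //; apply: cposD; apply: cposD; exact: cpos_sqr.
set n := N p.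
have Nc : N c ^+ 2 = n by rewrite -cnorm_starM ccp cnormN.
have Nq : N q = n by rewrite /q cnormMstar.
have psa := cpos_sa pp; have qsa := cpos_sa qp.
have n0 : 0 <= n := cnorm_ge0 _.
(* In place of comparing the spectra of [c c^#] and [c^# c], the norm of [(n - q) c = c (n + p)] is
   estimated from both sides, giving [2 n^3 <= n^3]. *)
pose v := (crs D n - q) * c.
have v1 : N v ^+ 2 <= n * n * n.
  rewrite -cnormMstar /v cstarM [X in _ * (_ * X)](csaB (csa_crs D n) qsa).
  rewrite !mulrA -(mulrA _ c) -/q.
  have nq : N (crs D n - q) <= n by case: qp => _; apply; rewrite Nq.
  apply: le_trans (cnormM _ _) _; apply: ler_pM; rewrite ?cnorm_ge0 //.
  by apply: le_trans (cnormM _ _) _; apply: ler_pM; rewrite ?cnorm_ge0 ?Nq.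
have v2 : v = c * (crs D n + p).
  by rewrite /v mulrBl mulrDr (crs_comm n c) /q -mulrA ccp mulrN opprK.
have v3 : 2 * n * (n * n) <= N v ^+ 2.
  rewrite -cnorm_starM v2 cstarM [X in N (X * _ * _)](csaD (csa_crs D n) psa).
  rewrite -(mulrA (crs D n + p)) (mulrA c^#) ccp mulNr mulrN cnormN (mulrA (crs D n + p)).
  have -> : 2 * n * (n * n) = N ((2 * n) *r (p * p)).
    by rewrite cnormZ csa_sqr // ger0_norm ?expr2 // mulr_ge0.
  apply: cpos_mono.
    by apply: cposZ; [rewrite mulr_ge0 | exact: cpos_sqr].
  have -> : (crs D n + p) * p * (crs D n + p) - (2 * n) *r (p * p) =
     n *r (n *r p) + p * p * p.
    rewrite rmorphM -scalerA scale2r !mulrDl !mulrDr !crs_mull !crs_mulr -!cscaleAl.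
    by abel.
  apply: cposD; first by do 2! apply: cposZ => //.
  by apply: cposM => //; [exact: cpos_sqr | exact: commr_sym (commrM _ _)].
have n00 : n = 0.
  apply/eqP; rewrite eq_le n0 andbT leNgt; apply/negP => np.
  have : n * n * n > 0 by rewrite !mulr_gt0.
  nra.
have p0 : p = 0 by exact: cnorm_eq0.
have y0 : y = 0.
  apply: cnorm_sqr_le0 => //; apply: cnorm_sqr_le0; first exact: csaM.
  rewrite mulrA {1}yy mulrDl.
  by rewrite -(mulrA s) -pE p0 addr0 mul0r.
by have -> : h = s by apply/eqP; rewrite eq_sym -subr_eq0 -/y y0.
Qed.

End CstarOrder.

(** * Cauchy-Schwarz and inverses *)

Section CstarInequalities.
Variables (R : realType) (V : lmodType R[i]) (D : cstarAlg V).
Local Notation A := (calg D).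
Implicit Types (a b h k u v w : A) (r t e : R).
Local Notation N := (@cnorm R V D).
Local Notation "a ^#" := (cstar a).
Local Notation "r *r a" := (r%:C *: a) (at level 40).

Lemma cpos_conj h a : cpos h -> cpos (a^# * h * a).
Proof.
move=> hp; have [k [kp _ <-]] := cpos_sqrt hp.
have -> : a^# * (k * k) * a = (k * a)^# * (k * a).
  by rewrite cstarM (cpos_sa kp) !mulrA.
exact: cpos_starM.
Qed.

(** [a], [b], [m] stand for the inner products of two vectors, and the hypothesis for the positivity
    of the square of [u c - v]. At [c = m / t] with [t > N a], bounding [a] by [t] leaves
    [m^# m / t <= b]; then [t] decreases to [N a]. *)
Lemma cauchy_schwarz a b m : cpos a -> cpos b ->
  (forall c, cpos (c^# * a * c - c^# * m - m^# * c + b)) -> N m ^+ 2 <= N a * N b.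
Proof.
move=> ap bp H.
suff K t : N a < t -> N m ^+ 2 <= t * N b.
  apply/ler_addgt0Pl => e e0.
  have b0 : 0 < N b + 1 by have := cnorm_ge0 b; lra.
  have := K (N a + e / (N b + 1)); rewrite ltrDl divr_gt0 // => /(_ isT).
  rewrite mulrDl (mulrAC e) => h; apply: le_trans h _.
  rewrite addrC lerD2r ler_pdivrMr // ler_wpM2l //; first exact: ltW.
  by rewrite lerDl.
move=> at_; have t0 : 0 < t by apply: le_lt_trans at_; exact: cnorm_ge0.
have tV : 0 <= t^-1 by rewrite invr_ge0 ltW.
suff : N (t^-1 *r (m^# * m)) <= N b.
  by rewrite cnormZ ger0_norm // cnorm_starM mulrC ler_pdivrMr // mulrC.
apply: cpos_mono; first by apply: cposZ => //; exact: cpos_starM.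
have tt : t^-1 * t^-1 * t = t^-1 by rewrite -mulrA mulVf ?mulr1 // gt_eqF.
have -> : b - t^-1 *r (m^# * m) =
   ((t^-1 *r m)^# * a * (t^-1 *r m) - (t^-1 *r m)^# * m - m^# * (t^-1 *r m) + b) +
   (t^-1 * t^-1) *r (m^# * (crs D t - a) * m).
  rewrite cstarZr -!cscaleAl -!cscaleAr mulrBr mulrBl crs_mulr -cscaleAl !scalerBr.
  rewrite -?cscaleAl !scalerA -!rmorphM tt; abel.
apply: cposD => //; apply: cposZ; first exact: mulr_ge0.
apply: cpos_conj; apply: cpos_crsB; [exact: cpos_sa | exact: ltW].
Qed.

(** Neumann series for [h = M (1 - z)], where [N z <= q = 1 - t / M]. Its sum is bounded by
    [1 / (1 - q) = M / t], so after division by [M] the bound is exactly [t^-1]. *)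
Lemma inverse_ex h t : csa h -> 0 < t -> cpos (h - crs D t) ->
  exists w, h * w = 1 /\ N w <= t^-1.
Proof.
move=> hsa t0 hp.
pose M := N h + t + 1; have M0 : 0 < M by rewrite /M; have := cnorm_ge0 h; lra.
pose z := 1 - M^-1 *r h; pose q := 1 - t / M.
have MV : 0 <= M^-1 by rewrite invr_ge0 ltW.
have tM : 0 < t / M by rewrite divr_gt0.
have tM1 : t / M < 1.
  by rewrite ltr_pdivrMr // mul1r /M; have := cnorm_ge0 h; lra.
have q0 : 0 <= q by rewrite /q; lra.
have q1 : 0 < 1 - q by rewrite /q; lra.
have zq : N z <= q.
  apply: cpos_le => //.
    rewrite /z -(crs1 D); apply: cpos_crsB; first exact: csaZ.
    rewrite cnormZ ger0_norm // mulrC ler_pdivrMr // mul1r /M; lra.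
  have -> : crs D q - z = M^-1 *r (h - crs D t).
    rewrite /q /z crsB crs1 mulrC crsM crs_mull scalerBr; abel.
  exact: cposZ.
pose S n : A := \sum_(j < n) z ^+ j.
have zX n : N (z ^+ n) <= q ^+ n.
  elim: n => [|n IH]; first by rewrite !expr0 cnorm1_le1.
  rewrite !exprS; apply: le_trans (cnormM _ _) _.
  by apply: ler_pM => //; exact: cnorm_ge0.
have Sd n (k : nat) : N (S (n + k)%N - S n) * (1 - q) <= q ^+ n - q ^+ (n + k).
  elim: k => [|k IH]; first by rewrite addn0 !subrr cnorm0 mul0r.
  rewrite addnS /S big_ord_recr /= -/(S _) addrAC.
  have := cnormD (S (n + k)%N - S n) (z ^+ (n + k)).
  rewrite exprS; have := zX (n + k)%N; nra.
have qX n : 0 <= q ^+ n by exact: exprn_ge0.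
have Sd' n m : (n <= m)%N -> N (S m - S n) * (1 - q) <= q ^+ n.
  move=> nm; have := Sd n (m - n)%N; rewrite subnKC //.
  by have := qX m; lra.
have q_small e : 0 < e -> exists n, q ^+ n <= e.
  move=> e0; have : `|q| < 1 by rewrite ger0_norm //; lra.
  move=> /cvg_expr /cvgr0_norm_le /(_ _ e0) [n _ /(_ n (leqnn n))] /=.
  by rewrite ger0_norm //; exists n.
have [|l hl] := @cnorm_complete_ _ _ D S.
  move=> e e0; have [|n hn] := q_small (e * (1 - q) / 2).
    by rewrite divr_gt0 // mulr_gt0.
  exists n => p r np nr; rewrite -/(N _).
  have -> : S p - S r = (S p - S n) - (S r - S n) by abel.
  have := cnormB (S p - S n) (S r - S n).
  rewrite -(ler_pM2r q1) => g; rewrite -(ler_pM2r q1); apply: le_trans g _.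
  by have := Sd' _ _ np; have := Sd' _ _ nr; nra.
pose w : A := M^-1 *r l.
have zl : (1 - z) * l = 1.
  apply/eqP; rewrite -subr_eq0; apply/eqP/cnorm_le0 => e e0.
  have [|n hn] := hl (e / 2 / (N (1 - z) + 1)).
    by rewrite !divr_gt0 //; have := cnorm_ge0 (1 - z); lra.
  have [|m hm] := q_small (e / 2); first by lra.
  pose p := maxn n m.
  have := hn p (leq_maxl _ _); rewrite -/(N _) ler_pdivlMr; last first.
    by have := cnorm_ge0 (1 - z); lra.
  have hS : (1 - z) * S p = 1 - z ^+ p.
    rewrite /S; elim: (p) => [|k IH]; first by rewrite big_ord0 mulr0 expr0 subrr.
    rewrite big_ord_recr /= mulrDr IH mulrBl mul1r -exprS; abel.
  have -> : (1 - z) * l - 1 = - (z ^+ p) - (1 - z) * (S p - l).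
    rewrite mulrBr hS; abel.
  have := cnormB (- z ^+ p) ((1 - z) * (S p - l)); rewrite cnormN.
  have := zX p; have := cnormM (1 - z) (S p - l).
  have : q ^+ p <= q ^+ m by rewrite ler_wiXn2l ?leq_maxr //; lra.
  have := cnorm_ge0 (S p - l); move: hm; nra.
exists w; split.
  rewrite -zl /w -cscaleAr cscaleAl; congr (_ * _).
  by rewrite /z; abel.
rewrite /w cnormZ ger0_norm //.
have -> : t^-1 = M^-1 * (M / t) by rewrite mulrA mulVf ?mul1r // gt_eqF.
rewrite ler_wpM2l // ler_pdivlMr //.
suff : N l * (1 - q) <= 1.
  by rewrite /q opprB addrC subrK mulrA ler_pdivrMr // mul1r.
apply/ler_addgt0Pl => e e0.
have [|n /(_ n (leqnn n))] := hl (e / (1 - q)); first by rewrite divr_gt0.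
rewrite -/(N _) ler_pdivlMr // => hn.
have := Sd' _ _ (leq0n n); rewrite expr0 /S big_ord0 subr0 -/(S n).
have := cnormB (S n) (S n - l); rewrite opprB addrC subrK.
move: hn; nra.
Qed.

End CstarInequalities.

(** * Groupoids and fibres *)

Section Groupoid.
Variable G : groupoidType.
Implicit Types a b c g u x : G.

Lemma src_inv g : src (ginv g) = rng g.
Proof. by rewrite /src /rng ginvK. Qed.
Lemma rng_inv g : rng (ginv g) = src g.
Proof. by rewrite /src /rng ginvK. Qed.

Lemma src_mul a b : composable a b -> src (gmul a b) = src b.
Proof.
move=> ab; have [|h _ _] := @gmulA G a b (ginv b) ab; first by rewrite ginvK.
by rewrite /src h ginvK.
Qed.

Lemma rng_mul a b : composable a b -> rng (gmul a b) = rng a.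
Proof.
move=> ab; have [||_ h _] := @gmulA G (ginv a) a b => //; first by rewrite ginvK.
by rewrite /rng -h ginvK.
Qed.

Lemma gmul_assoc a b c : composable a b -> composable b c ->
  gmul (gmul a b) c = gmul a (gmul b c).
Proof. by move=> ab bc; have [] := @gmulA G a b c ab bc. Qed.

Lemma gmulKl a b : composable a b -> gmul (ginv a) (gmul a b) = b.
Proof. by move=> ab; have [] := @gmulK G a b ab. Qed.
Lemma gmulKr a b : composable a b -> gmul (gmul a b) (ginv b) = a.
Proof. by move=> ab; have [] := @gmulK G a b ab. Qed.

Lemma composableV g : composable g (ginv g).
Proof. by rewrite /composable rng_inv. Qed.
Lemma composableVl g : composable (ginv g) g.
Proof. by rewrite /composable src_inv. Qed.

Lemma rng_gmul g : gmul (rng g) g = g.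
Proof. by have := gmulKr (composableV g); rewrite ginvK. Qed.
Lemma gmul_src g : gmul g (src g) = g.
Proof. by have := gmulKl (composableVl g); rewrite ginvK. Qed.

Lemma src_src g : src (src g) = src g.
Proof. by rewrite {2}/src src_mul //; exact: composableVl. Qed.
Lemma rng_src g : rng (src g) = src g.
Proof. by rewrite {1}/src rng_mul ?rng_inv //; exact: composableVl. Qed.

Lemma gunits_src g : gunits (src g).
Proof.
split=> a; rewrite /composable.
  by rewrite src_src => ->; exact: rng_gmul.
by rewrite rng_src => <-; exact: gmul_src.
Qed.

Lemma gunits_rng g : gunits (rng g).
Proof. by rewrite -src_inv; exact: gunits_src. Qed.

Lemma src_unit u : gunits u -> src u = u.
Proof.
move=> [hl hr]; rewrite -[RHS]gmul_src hl //.
by rewrite /composable rng_src.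
Qed.

Lemma ginv_unit u : gunits u -> ginv u = u.
Proof.
move=> hu; have [_ hr] := hu.
by rewrite -[RHS]src_unit // /src hr //; exact: composableVl.
Qed.

Lemma rng_unit u : gunits u -> rng u = u.
Proof. by move=> hu; rewrite -src_inv ginv_unit // src_unit. Qed.

Lemma gmul_unit u : gunits u -> gmul u u = u.
Proof. by move=> hu; rewrite -{2}(src_unit hu) gmul_src. Qed.

Lemma rng_src_unit g : gunits g -> rng g = src g.
Proof. by move=> gu; rewrite src_unit // rng_unit. Qed.

Lemma ginv_mul a b : composable a b -> ginv (gmul a b) = gmul (ginv b) (ginv a).
Proof.
move=> ab; have ba : composable (ginv b) (ginv a).
  by rewrite /composable src_inv rng_inv.
have cx : composable (gmul a b) (gmul (ginv b) (ginv a)).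
  by rewrite /composable src_mul // rng_mul // rng_inv.
have c1 : composable (gmul a b) (ginv b) by rewrite /composable src_mul // rng_inv.
rewrite -(gmulKl cx) -(gmul_assoc c1 ba) gmulKr // -/(rng a) -(rng_mul ab).
by rewrite -src_inv gmul_src.
Qed.

(* Meaningful only when [src g = src h]. *)
Definition gdiv g h : G := gmul g (ginv h).

Lemma gdiv_comp g h : src g = src h -> composable g (ginv h).
Proof. by rewrite /composable rng_inv. Qed.
Lemma src_div g h : src g = src h -> src (gdiv g h) = rng h.
Proof. by move=> gh; rewrite src_mul ?src_inv //; exact: gdiv_comp. Qed.
Lemma rng_div g h : src g = src h -> rng (gdiv g h) = rng g.
Proof. by move=> gh; rewrite rng_mul //; exact: gdiv_comp. Qed.
Lemma gdivK g h : src g = src h -> gmul (gdiv g h) h = g.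
Proof. by move=> gh; rewrite /gdiv -{2}(ginvK h) gmulKr //; exact: gdiv_comp. Qed.
Lemma gdivV g h : src g = src h -> ginv (gdiv g h) = gdiv h g.
Proof. by move=> gh; rewrite ginv_mul ?ginvK //; exact: gdiv_comp. Qed.
Lemma gdiv_compl g h : src g = src h -> composable (gdiv g h) h.
Proof. by move=> gh; rewrite /composable src_div. Qed.
Lemma gdiv_mul g h l : src g = src h -> src h = src l ->
  gmul (gdiv g h) (gdiv h l) = gdiv g l.
Proof.
move=> gh hl; rewrite /gdiv -gmul_assoc.
- by rewrite (gdivK gh).
- exact: gdiv_compl.
- exact: gdiv_comp.
Qed.
Lemma gdiv_gmul a b : composable a b -> gdiv (gmul a b) b = a.
Proof. exact: gmulKr. Qed.
Lemma gdiv_src g : gdiv g (src g) = g.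
Proof. by rewrite /gdiv ginv_unit ?gmul_src //; exact: gunits_src. Qed.
Lemma gdiv_unit g h : src g = src h -> gunits (gdiv g h) -> g = h.
Proof.
move=> gh hu; rewrite -[LHS](gdivK gh) -{1}(src_unit hu) src_div //.
exact: rng_gmul.
Qed.
Lemma gdivv g : gdiv g g = rng g. Proof. by []. Qed.

End Groupoid.

(** * Real-valued norms on the complex fibres *)

Section FibreNorm.
Variables (R : realType) (E : completeNormedModType R[i]).
Implicit Types u v : E.

Lemma vnormE v : `|v| = (vnorm v)%:C.
Proof.
have := normr_ge0 v; rewrite /vnorm; case: `|v| => a b.
by rewrite lecE /= => /andP[/eqP -> _].
Qed.

Lemma vnorm_ge0 v : 0 <= vnorm v.
Proof. by have := normr_ge0 v; rewrite vnormE ler0c. Qed.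

Lemma vnorm_le_norm v (r : R) : (`|v| <= r%:C) = (vnorm v <= r).
Proof. by rewrite vnormE lecR. Qed.

Lemma vnormD u v : vnorm (u + v) <= vnorm u + vnorm v.
Proof.
rewrite -vnorm_le_norm; apply: le_trans (ler_normD _ _) _.
by rewrite !vnormE -(rmorphD (real_complex R)).
Qed.

Lemma vnormZ (c : R[i]) v : (vnorm (c *: v))%:C = `|c| * (vnorm v)%:C.
Proof. by rewrite -!vnormE normrZ. Qed.

Lemma vnormZr (r : R) v : vnorm (r%:C *: v) = `|r| * vnorm v.
Proof.
apply: (@complexI R); rewrite vnormZ rmorphM; congr (_ * _).
by rewrite normc_def /= expr0n /= addr0 sqrtr_sqr.
Qed.

Lemma vnorm0 : vnorm (0 : E) = 0.
Proof. by rewrite /vnorm normr0. Qed.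

Lemma vnorm_eq0 v : vnorm v = 0 -> v = 0.
Proof. by move=> v0; apply/normr0_eq0; rewrite vnormE v0. Qed.

Lemma vnormN v : vnorm (- v) = vnorm v.
Proof. by rewrite /vnorm normrN. Qed.

Lemma vnormB u v : vnorm (u - v) <= vnorm u + vnorm v.
Proof. by rewrite -(vnormN v) vnormD. Qed.

Lemma vnorm_le0 v : (forall e : R, 0 < e -> vnorm v <= e) -> v = 0.
Proof.
move=> H; apply: vnorm_eq0; apply/eqP; rewrite eq_le vnorm_ge0 andbT.
by apply/ler_addgt0Pl => e e0; rewrite addr0; exact: H.
Qed.

Lemma vnorm_cvg (I : Type) (H : set_system I) (FH : ProperFilter H) (u : I -> E) l :
  (forall e : R, 0 < e -> \forall i \near H, vnorm (u i - l) <= e) -> u @ H --> l.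
Proof.
move=> h; apply/cvgrPdist_le => e e0.
(* In the order of [R[i]] every positive element is real. *)
have eE : e = (complex.Re e)%:C.
  by case: e e0 => a b; rewrite ltcE /= => /andP[/eqP -> _].
have e1 : 0 < complex.Re e by move: e0; rewrite eE -[0]/(0%:C) ltcR.
apply: filterS (h _ e1) => i; rewrite -vnorm_le_norm -eE.
by rewrite distrC.
Qed.

Lemma vnorm_cvgP (I : Type) (H : set_system I) (FH : ProperFilter H) (u : I -> E) l :
  u @ H --> l -> forall e : R, 0 < e -> \forall i \near H, vnorm (u i - l) <= e.
Proof.
move=> /cvgr_dist_le h e e0.
have e1 : 0 < e%:C by rewrite -[0]/(0%:C) ltcR.
by apply: filterS (h _ e1) => i; rewrite distrC vnorm_le_norm.
Qed.

Lemma vnorm_cauchy_cvg (I : Type) (H : set_system I) (FH : ProperFilter H) (u : I -> E) :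
  (forall e : R, 0 < e -> exists2 A, H A & forall i j, A i -> A j ->
     vnorm (u i - u j) <= e) -> cvg (u @ H).
Proof.
move=> h; apply/cauchy_cvgP/cauchy_exP => e e0.
have eE : e = (complex.Re e)%:C.
  by case: e e0 => a b; rewrite ltcE /= => /andP[/eqP -> _].
have e1 : 0 < complex.Re e by move: e0; rewrite eE -[0]/(0%:C) ltcR.
have [|A HA hA] := h (complex.Re e / 2); first by lra.
have [i Ai] := filter_ex HA.
exists (u i); apply: (@filterS _ H _ _ (u @^-1` ball (u i) e) _ HA) => j Aj.
rewrite /= -ball_normE /= vnormE eE ltcR.
by apply: le_lt_trans (hA _ _ Ai Aj) _; lra.
Qed.

Lemma vnorm_complete (u : nat -> E) :
    (forall e : R, 0 < e -> exists n, forall p q, (n <= p)%N -> (n <= q)%N ->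
       vnorm (u p - u q) <= e) ->
    exists l, forall e : R, 0 < e -> exists n, forall p, (n <= p)%N ->
       vnorm (u p - l) <= e.
Proof.
move=> h; have : cvg (u @ \oo).
  apply: vnorm_cauchy_cvg => e /h[n hn].
  exists [set p | (n <= p)%N]; first by exists n.
  by move=> i j; exact: hn.
move=> ul; exists (lim (u @ \oo)) => e e0.
have [n _ hn] := vnorm_cvgP _ ul e0.
by exists n => p /hn.
Qed.

End FibreNorm.

(** * Product and involution between fibres *)

Section FibreOps.
Variables (R : realType) (G : etaleGroupoidType) (F : fellBundle R G).
Implicit Types (g h k l x : G) (c : R[i]).

Lemma at_fibE x (v : fib F x) : at_fib x (inj_tot v) = v.
Proof.
rewrite /at_fib; case: pselect => //= e.
by rewrite (Prop_irrelevance e erefl).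
Qed.

Lemma inj_at_fib x (b : tspace F) : bproj b = x -> inj_tot (at_fib x b) = b.
Proof. by case: b => y v /= E; subst x; rewrite at_fibE. Qed.

Lemma at_fib_linear x y (c : R[i]) (u v : fib F y) :
  at_fib x (inj_tot (c *: u + v)) = c *: at_fib x (inj_tot u) + at_fib x (inj_tot v).
Proof.
rewrite /at_fib; case: pselect => /= [e|ne].
  by subst x.
by rewrite scaler0 addr0.
Qed.

Lemma vnorm_at_fib x (b : tspace F) : vnorm (at_fib x b) <= tnorm b.
Proof.
rewrite /at_fib; case: pselect => /= [e|ne].
  by subst x.
by rewrite vnorm0 vnorm_ge0.
Qed.

Lemma tnorm_inj x (b : tspace F) : bproj b = x -> vnorm (at_fib x b) = tnorm b.
Proof. by case: b => y v /= E; subst x; rewrite at_fibE. Qed.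

(* The product read in the fibre at [k], with junk value [0] unless [k = gmul g h]. *)
Definition fmulat k g h (u : fib F g) (v : fib F h) : fib F k :=
  at_fib k (inj_tot (fmul u v)).

Definition fstarat k g (u : fib F g) : fib F k := at_fib k (inj_tot (fstar u)).

Lemma inj_fmulat k g h (u : fib F g) (v : fib F h) : gmul g h = k ->
  inj_tot (fmulat k u v) = tmul (inj_tot u) (inj_tot v).
Proof. by move=> E; rewrite /fmulat (inj_at_fib (x := k)). Qed.

Lemma inj_fstarat k g (u : fib F g) : ginv g = k ->
  inj_tot (fstarat k u) = tstar (inj_tot u).
Proof. by move=> E; rewrite /fstarat (inj_at_fib (x := k)). Qed.

Lemma fmulat_linearl k g h c (u u' : fib F g) (v : fib F h) : composable g h ->
  fmulat k (c *: u + u') v = c *: fmulat k u v + fmulat k u' v.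
Proof. by move=> gh; rewrite /fmulat fmul_linearl // at_fib_linear. Qed.

Lemma fmulat_linearr k g h c (u : fib F g) (v v' : fib F h) : composable g h ->
  fmulat k u (c *: v + v') = c *: fmulat k u v + fmulat k u v'.
Proof. by move=> gh; rewrite /fmulat fmul_linearr // at_fib_linear. Qed.

Lemma fmulatDl k g h (u u' : fib F g) (v : fib F h) : composable g h ->
  fmulat k (u + u') v = fmulat k u v + fmulat k u' v.
Proof. by move=> gh; have := fmulat_linearl k 1 u u' v gh; rewrite !scale1r. Qed.
Lemma fmulatDr k g h (u : fib F g) (v v' : fib F h) : composable g h ->
  fmulat k u (v + v') = fmulat k u v + fmulat k u v'.
Proof. by move=> gh; have := fmulat_linearr k 1 u v v' gh; rewrite !scale1r. Qed.
Lemma fmulat0l k g h (v : fib F h) : composable g h ->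
  fmulat k (0 : fib F g) v = 0.
Proof.
move=> gh; apply: (@addrI _ (fmulat k (0 : fib F g) v)).
by rewrite -fmulatDl // !addr0.
Qed.
Lemma fmulat0r k g h (u : fib F g) : composable g h ->
  fmulat k u (0 : fib F h) = 0.
Proof.
move=> gh; apply: (@addrI _ (fmulat k u (0 : fib F h))).
by rewrite -fmulatDr // !addr0.
Qed.
Lemma fmulatZl k g h c (u : fib F g) (v : fib F h) : composable g h ->
  fmulat k (c *: u) v = c *: fmulat k u v.
Proof.
by move=> gh; have := fmulat_linearl k c u 0 v gh; rewrite !addr0 fmulat0l // addr0.
Qed.
Lemma fmulatZr k g h c (u : fib F g) (v : fib F h) : composable g h ->
  fmulat k u (c *: v) = c *: fmulat k u v.
Proof.
by move=> gh; have := fmulat_linearr k c u v 0 gh; rewrite !addr0 fmulat0r // addr0.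
Qed.
Lemma fmulatNl k g h (u : fib F g) (v : fib F h) : composable g h ->
  fmulat k (- u) v = - fmulat k u v.
Proof. by move=> gh; rewrite -scaleN1r fmulatZl // scaleN1r. Qed.
Lemma fmulatNr k g h (u : fib F g) (v : fib F h) : composable g h ->
  fmulat k u (- v) = - fmulat k u v.
Proof. by move=> gh; rewrite -scaleN1r fmulatZr // scaleN1r. Qed.
Lemma fmulatBl k g h (u u' : fib F g) (v : fib F h) : composable g h ->
  fmulat k (u - u') v = fmulat k u v - fmulat k u' v.
Proof. by move=> gh; rewrite fmulatDl // fmulatNl. Qed.
Lemma fmulatBr k g h (u : fib F g) (v v' : fib F h) : composable g h ->
  fmulat k u (v - v') = fmulat k u v - fmulat k u v'.
Proof. by move=> gh; rewrite fmulatDr // fmulatNr. Qed.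
Lemma fmulat_suml k g h (I : Type) (r : seq I) (u : I -> fib F g) (v : fib F h) :
  composable g h ->
  fmulat k (\sum_(i <- r) u i) v = \sum_(i <- r) fmulat k (u i) v.
Proof.
move=> gh; elim: r => [|i r IH]; first by rewrite !big_nil fmulat0l.
by rewrite !big_cons fmulatDl // IH.
Qed.
Lemma fmulat_sumr k g h (I : Type) (r : seq I) (u : fib F g) (v : I -> fib F h) :
  composable g h ->
  fmulat k u (\sum_(i <- r) v i) = \sum_(i <- r) fmulat k u (v i).
Proof.
move=> gh; elim: r => [|i r IH]; first by rewrite !big_nil fmulat0r.
by rewrite !big_cons fmulatDr // IH.
Qed.

Lemma vnorm_fmulat k g h (u : fib F g) (v : fib F h) : composable g h ->
  vnorm (fmulat k u v) <= vnorm u * vnorm v.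
Proof.
move=> gh; apply: le_trans (vnorm_at_fib _ _) _.
exact: (@tnormM _ _ F (inj_tot u) (inj_tot v)).
Qed.

(** The base points [p] and [q] of the inner products are free and tied by equations, so that no
    transport between fibres occurs. *)
Lemma fmulatA p q k g h l (u : fib F g) (v : fib F h) (w : fib F l) :
  composable g h -> composable h l -> gmul g h = p -> gmul h l = q ->
  fmulat k (fmulat p u v) w = fmulat k u (fmulat q v w).
Proof.
move=> gh hl <- <-; rewrite /fmulat !at_fibE; congr at_fib.
exact: (@tmulA _ _ F (inj_tot u) (inj_tot v) (inj_tot w)).
Qed.

Lemma fstarat_antilinear k g c (u v : fib F g) :
  fstarat k (c *: u + v) = c^* *: fstarat k u + fstarat k v.
Proof. by rewrite /fstarat fstar_antilinear at_fib_linear. Qed.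

Lemma fstaratD k g (u v : fib F g) : fstarat k (u + v) = fstarat k u + fstarat k v.
Proof.
have := fstarat_antilinear k 1 u v; rewrite !scale1r => ->; congr (_ + _).
by rewrite rmorph1 scale1r.
Qed.
Lemma fstarat0 k g : fstarat k (0 : fib F g) = 0.
Proof.
by apply: (@addrI _ (fstarat k (0 : fib F g))); rewrite -fstaratD !addr0.
Qed.
Lemma fstaratZ k g c (u : fib F g) : fstarat k (c *: u) = c^* *: fstarat k u.
Proof. by have := fstarat_antilinear k c u 0; rewrite !addr0 fstarat0 addr0. Qed.
Lemma fstarat_sum k g (I : Type) (r : seq I) (u : I -> fib F g) :
  fstarat k (\sum_(i <- r) u i) = \sum_(i <- r) fstarat k (u i).
Proof.
elim: r => [|i r IH]; first by rewrite !big_nil fstarat0.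
by rewrite !big_cons fstaratD IH.
Qed.
Lemma fstaratB k g (u v : fib F g) : fstarat k (u - v) = fstarat k u - fstarat k v.
Proof.
by apply/eqP; rewrite eq_sym subr_eq -fstaratD subrK.
Qed.

Lemma fstaratK g h (u : fib F g) : ginv g = h -> fstarat g (fstarat h u) = u.
Proof.
move=> <-; rewrite /fstarat at_fibE -[RHS]at_fibE; congr at_fib.
exact: (@tstarK _ _ F (inj_tot u)).
Qed.

Lemma fstaratM p q r k g h (u : fib F g) (v : fib F h) : composable g h ->
  gmul g h = p -> ginv h = q -> ginv g = r ->
  fstarat k (fmulat p u v) = fmulat k (fstarat q v) (fstarat r u).
Proof.
move=> gh <- <- <-; rewrite /fstarat /fmulat !at_fibE; congr at_fib.
exact: (@tstarM _ _ F (inj_tot u) (inj_tot v)).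
Qed.

Lemma tnorm_star_le (b : tspace F) : tnorm b <= tnorm (tstar b).
Proof.
have cb : composable (bproj (tstar b)) (bproj b) by exact: composableVl.
have := tnormM cb; rewrite tnorm_starM expr2.
have [->|b0] := eqVneq (tnorm b) 0; first by rewrite vnorm_ge0.
by rewrite ler_pM2r // lt_def b0 vnorm_ge0.
Qed.

Lemma tnorm_star (b : tspace F) : tnorm (tstar b) = tnorm b.
Proof.
apply/eqP; rewrite eq_le tnorm_star_le andbT.
by have := tnorm_star_le (tstar b); rewrite tstarK.
Qed.

Lemma vnorm_fstarat g h (u : fib F g) : ginv g = h -> vnorm (fstarat h u) = vnorm u.
Proof.
move=> E; rewrite tnorm_inj //; exact: (tnorm_star (inj_tot u)).
Qed.

(** The inner product [u^* v]. The target [x], meant to be [src g], is a separate argument so that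
    values for different [g] over [x] can be added. *)
Definition fip x g (u v : fib F g) : fib F x := fmulat x (fstarat (ginv g) u) v.

Lemma fipE x g (u v : fib F g) : src g = x ->
  inj_tot (fip x u v) = tmul (tstar (inj_tot u)) (inj_tot v).
Proof.
move=> E; rewrite inj_fmulat //; congr (tmul _ _); exact: inj_fstarat.
Qed.

Lemma vnorm_fip x g (u : fib F g) : src g = x -> vnorm (fip x u u) = vnorm u ^+ 2.
Proof.
move=> E; have := tnorm_starM (inj_tot u); rewrite -(fipE u u E) /tnorm /=.
by [].
Qed.

Lemma fstarat_fip x g (u v : fib F g) : gunits x -> src g = x ->
  fstarat x (fip x u v) = fip x v u.
Proof.
move=> xu E; rewrite /fip (@fstaratM x (ginv g) g x) ?fstaratK ?ginvK //.
exact: composableVl.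
Qed.

End FibreOps.

(** * Unit fibres as C*-algebras *)

Section FibreAlgebra.
Variables (R : realType) (G : etaleGroupoidType) (F : fellBundle R G).
Implicit Types (g h k l x : G) (c : R[i]).

Lemma unit_comp x : gunits x -> composable x x.
Proof. by move=> hx; rewrite /composable rng_src_unit. Qed.

Definition fibre_unit x (e : fib F x) : Prop := tunits (inj_tot e).

Lemma fibre_unitl x (e : fib F x) g (u : fib F g) : gunits x -> fibre_unit e ->
  rng g = x -> fmulat g e u = u.
Proof.
move=> hx [he _] E; rewrite -[RHS]at_fibE -(he (inj_tot u)) //.
by rewrite /tcomposable /composable /= E src_unit.
Qed.

Lemma fibre_unitr x (e : fib F x) g (u : fib F g) : gunits x -> fibre_unit e ->
  src g = x -> fmulat g u e = u.
Proof.
move=> hx [_ he] E; rewrite -[RHS]at_fibE -(he (inj_tot u)) //.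
by rewrite /tcomposable /composable /= E rng_unit.
Qed.

Variables (x : G) (hx : gunits x) (e : fib F x) (he : fibre_unit e).

Let vxx := ginv_unit hx.
Let xx := unit_comp hx.
Let mxx := gmul_unit hx.

(** Kept transparent, so that the algebra operations convert to the fibre operations. *)
Definition fib_cstarAlg : cstarAlg (fib F x).
Proof.
refine (@CstarAlg R (fib F x) (@fmulat R G F x x x) e (@vnorm R (fib F x))
  (@fstarat R G F x x) _ _ _ _ _ _ _ _ _ _ _ _ _ _ _ _ _).
- by move=> a b c; rewrite (@fmulatA _ _ _ x x).
- by move=> a; apply: fibre_unitl => //; exact: rng_unit.
- by move=> a; apply: fibre_unitr => //; exact: src_unit.
- by move=> a b c; exact: fmulatDl.
- by move=> a b c; exact: fmulatDr.
- by move=> c a b; rewrite fmulatZl.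
- by move=> c a b; rewrite fmulatZr.
- exact: vnormD.
- exact: vnormZr.
- exact: vnorm_eq0.
- by move=> a b; exact: vnorm_fmulat.
- move=> a; rewrite -(@vnorm_fip _ _ _ x) ?src_unit //.
  by rewrite /fip vxx.
- by move=> a; exact: fstaratK.
- by move=> a b; exact: fstaratM.
- exact: fstaratD.
- exact: fstaratZ.
- exact: vnorm_complete.
Defined.

End FibreAlgebra.

(** * Positivity in the unit fibres *)

Section FibrePositive.
Variables (R : realType) (G : etaleGroupoidType) (F : fellBundle R G).
Hypothesis hu : forall x : G, gunits x -> exists e : fib F x, fibre_unit e.
Implicit Types (g h k l x y : G) (c : R[i]) (r t : R).

Definition fone x (hx : gunits x) : fib F x := projT1 (cid (hu hx)).

Lemma foneP x (hx : gunits x) : fibre_unit (fone hx).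
Proof. exact: (projT2 (cid (hu hx))). Qed.

Definition fibA x (hx : gunits x) : cstarAlg (fib F x) := fib_cstarAlg hx (foneP hx).

(** The C*-algebra depends on a proof that [x] is a unit; hiding that proof, which is irrelevant,
    gives a predicate on all fibres. *)
Definition fpos x (v : fib F x) : Prop := exists hx : gunits x, @cpos R _ (fibA hx) v.

Lemma fposP x (hx : gunits x) (v : fib F x) : fpos v -> @cpos R _ (fibA hx) v.
Proof. by move=> [hx' hv]; rewrite (Prop_irrelevance hx hx'). Qed.

Lemma fpos0 x : gunits x -> fpos (0 : fib F x).
Proof. by move=> hx; exists hx; exact: cpos0. Qed.

Lemma fposD x (u v : fib F x) : fpos u -> fpos v -> fpos (u + v).
Proof. by move=> [hx pu] /(fposP hx) pv; exists hx; exact: (cposD pu pv). Qed.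

Lemma fposZ x r (u : fib F x) : 0 <= r -> fpos u -> fpos (r%:C *: u).
Proof. by move=> r0 [hx pu]; exists hx; exact: (cposZ r0 pu). Qed.

Lemma fpos_sum x (I : eqType) (s : seq I) (u : I -> fib F x) : gunits x ->
  {in s, forall i, fpos (u i)} -> fpos (\sum_(i <- s) u i).
Proof.
move=> hx; elim: s => [|i s IH] H; first by rewrite big_nil; exact: fpos0.
rewrite big_cons; apply: fposD; first by apply: H; rewrite mem_head.
by apply: IH => j js; apply: H; rewrite inE js orbT.
Qed.

Lemma fpos_mono x (u v : fib F x) : fpos u -> fpos (v - u) -> vnorm u <= vnorm v.
Proof. by move=> [hx pu] /(fposP hx) pv; exact: (cpos_mono pu pv). Qed.

Section FibreConj.
Variables (x g : G).
Hypotheses (hx : gunits x) (gx : src g = x).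

Lemma fip_mulr (u v : fib F g) (c : fib F x) :
  fip x u (fmulat g v c) = fmulat x (fip x u v) c.
Proof.
have gc : composable g x by rewrite /composable gx rng_unit.
rewrite /fip (@fmulatA _ _ _ x g) //.
- exact: composableVl.
- by rewrite -{1}gx gmul_src.
Qed.

Lemma fip_mull (u v : fib F g) (c : fib F x) :
  fip x (fmulat g u c) v = fmulat x (fstarat x c) (fip x u v).
Proof.
have gc : composable g x by rewrite /composable gx rng_unit.
rewrite -(fstarat_fip _ _ hx gx) fip_mulr (@fstaratM _ _ _ x x x) ?ginv_unit ?gmul_unit //.
  by rewrite fstarat_fip.
exact: unit_comp.
Qed.

Lemma fip_mul y a (h : fib F a) (u : fib F y) (v : fib F g) : composable a y ->
  gmul a y = g ->
  fip x (fmulat g h u) v = fip x u (fmulat y (fstarat (ginv a) h) v).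
Proof.
move=> ay ag; rewrite /fip.
have sy : src y = x by rewrite -gx -ag src_mul.
have rg : rng g = rng a by rewrite -ag rng_mul.
rewrite (@fstaratM _ _ _ g (ginv y) (ginv a)) // (@fmulatA _ _ _ _ y) //.
- by rewrite /composable src_inv rng_inv ay.
- by rewrite /composable src_inv rg.
- by rewrite -ag ginv_mul.
- by rewrite -ag gmulKl.
Qed.

End FibreConj.

(** Off the units [u] lies in no C*-algebra; the positivity axiom of Fell bundles replaces it by
    some [a] in the unit fibre with [a^* a = u^* u]. *)
Lemma fpos_fip x g (u : fib F g) : gunits x -> src g = x -> fpos (fip x u u).
Proof.
move=> hx gx; have [[y a] [/= ya E]] := tpositive (inj_tot u).
rewrite -/(src g) gx in ya; subst y.
exists hx.
have -> : fip x u u = (cstar (a : calg (fibA hx))) * a :> calg (fibA hx).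
  rewrite /GRing.mul /cstar /= -[LHS]at_fibE fipE // -E.
  rewrite -[RHS]at_fibE inj_fmulat ?gmul_unit // inj_fstarat //.
  exact: ginv_unit.
exact: cpos_starM.
Qed.

Lemma fpos_conj x y g (h : fib F y) (u : fib F g) : src g = x -> rng g = y ->
  fpos h -> fpos (fip x u (fmulat g h u)).
Proof.
move=> gx gy hp.
have hx : gunits x by rewrite -gx; exact: gunits_src.
have hy : gunits y by rewrite -gy; exact: gunits_rng.
have [k [kp _ kh]] := cpos_sqrt (fposP hy hp).
have yg : composable y g by rewrite /composable src_unit.
have yyg : gmul y g = g by rewrite -gy rng_gmul.
have -> : fip x u (fmulat g h u) = fip x (fmulat g k u) (fmulat g k u).
  rewrite (@fip_mul _ _ gx) // -kh.
  have aux z (E : z = y) (w : fib F g) : fmulat g (fstarat z k) w = fmulat g k w.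
    by subst z; congr fmulat; exact: (cpos_sa kp).
  rewrite aux ?ginv_unit // -(@fmulatA _ _ _ y) ?gmul_unit //.
  exact: unit_comp.
exact: fpos_fip.
Qed.

(** The difference is [u^* h u] with [h = C^2 - v^* v], which is positive in the unit fibre at the
    range of [g]. *)
Lemma fip_contract x k a g (v : fib F a) (u : fib F g) (C : R) : gunits x ->
  src g = x -> composable a g -> gmul a g = k -> vnorm v <= C ->
  fpos ((C ^+ 2)%:C *: fip x u u - fip x (fmulat k v u) (fmulat k v u)).
Proof.
move=> hx gx ag agk vC; pose y := rng g.
have hy : gunits y by exact: gunits_rng.
have C0 : 0 <= C by apply: le_trans vC; exact: vnorm_ge0.
have kx : src k = x by rewrite -agk src_mul.
rewrite (@fip_mul x k kx g a) //.
have yg : composable y g by rewrite /composable src_unit.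
have yyg : gmul y g = g by rewrite rng_gmul.
have -> : fmulat g (fstarat (ginv a) v) (fmulat k v u) = fmulat g (fip y v v) u.
  by rewrite /fip (@fmulatA _ _ _ y k) //; exact: composableVl.
pose h : fib F y := (C ^+ 2)%:C *: fone hy - fip y v v.
have hp : fpos h.
  exists hy; have vp := fposP hy (fpos_fip v hy ag).
  apply: (cpos_crsB (cpos_sa vp)); rewrite -[X in X <= _]/(vnorm _) vnorm_fip //.
  by rewrite ler_pXn2r ?nnegrE ?vnorm_ge0.
have := fpos_conj u gx (erefl y) hp.
rewrite /h fmulatBl // fmulatZl // fibre_unitl //; last exact: foneP.
rewrite {1}/fip fmulatBr ?fmulatZr //; exact: composableVl.
Qed.

End FibrePositive.

(** * Sections as operators on finitely supported columns *)

Section ComplexModulus.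
Variable R : realType.

Definition cmod (c : R[i]) : R := complex.Re `|c|.

Lemma cmodE c : `|c| = (cmod c)%:C.
Proof.
have := normr_ge0 c; rewrite /cmod; case: `|c| => a b.
by rewrite lecE /= => /andP[/eqP -> _].
Qed.

Lemma cmod_ge0 c : 0 <= cmod c.
Proof. by have := normr_ge0 c; rewrite cmodE ler0c. Qed.

Lemma cmodN1 : cmod (-1) = 1.
Proof. by rewrite /cmod normrN1. Qed.
End ComplexModulus.

(** * Hilbert modules of columns over a source fibre *)

Section Vectors.
Variables (R : realType) (G : etaleGroupoidType) (F : fellBundle R G).
Implicit Types (g h k l x y : G) (r t : R) (a b f : sect F) (E H K : {fset G}).

Definition over x E : Prop := forall g, g \in E -> src g = x.

Lemma over_sub x E H : (E `<=` H)%fset -> over x H -> over x E.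
Proof. by move=> /fsubsetP EH oH g /EH /oH. Qed.

Lemma overU x E H : over x E -> over x H -> over x (E `|` H)%fset.
Proof. by move=> oE oH g; rewrite inE => /orP[/oE|/oH]. Qed.

Lemma over1 g : over (src g) [fset g]%fset.
Proof. by move=> h; rewrite inE => /eqP ->. Qed.

Lemma over0 x : over x fset0. Proof. by move=> g; rewrite inE. Qed.

Lemma overD x E H : over x E -> over x (E `\` H)%fset.
Proof. by apply: over_sub; exact: fsubsetDl. Qed.

Definition vip x E a b : fib F x := \sum_(g <- E) fip x (a g) (b g).

Definition nn x E a : R := Num.sqrt (vnorm (vip x E a a)).

Lemma nn_ge0 x E a : 0 <= nn x E a. Proof. exact: sqrtr_ge0. Qed.

Lemma nn_sqr x E a : nn x E a ^+ 2 = vnorm (vip x E a a).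
Proof. by rewrite sqr_sqrtr // vnorm_ge0. Qed.

Lemma eq_vip x E a a' b b' : {in E, forall g, a g = a' g} -> {in E, forall g, b g = b' g} ->
  vip x E a b = vip x E a' b'.
Proof.
move=> aa bb; rewrite /vip !big_seq; apply: eq_bigr => g gE.
by rewrite aa // bb.
Qed.

Lemma eq_nn x E a a' : {in E, forall g, a g = a' g} -> nn x E a = nn x E a'.
Proof. by move=> aa; rewrite /nn (eq_vip _ aa aa). Qed.

Lemma vipDl x E a a' b : over x E -> vip x E (a + a') b = vip x E a b + vip x E a' b.
Proof.
move=> oE; rewrite /vip -big_split; rewrite !big_seq; apply: eq_bigr => g gE.
by rewrite /fip /= fstaratD fmulatDl //; exact: composableVl.
Qed.

Lemma vipDr x E a b b' : over x E -> vip x E a (b + b') = vip x E a b + vip x E a b'.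
Proof.
move=> oE; rewrite /vip -big_split; rewrite !big_seq; apply: eq_bigr => g gE.
by rewrite /fip /= fmulatDr //; exact: composableVl.
Qed.

Lemma vip_star x E a b : gunits x -> over x E -> fstarat x (vip x E a b) = vip x E b a.
Proof.
move=> hx oE; rewrite /vip fstarat_sum !big_seq; apply: eq_bigr => g gE.
by rewrite fstarat_fip // oE.
Qed.

Lemma nnZ x E a (c : R[i]) : over x E -> nn x E (c *: a) = cmod c * nn x E a.
Proof.
move=> oE; suff -> : nn x E (c *: a) = Num.sqrt (cmod c ^+ 2 * nn x E a ^+ 2).
  by rewrite -exprMn sqrtr_sqr ger0_norm // mulr_ge0 ?nn_ge0 ?cmod_ge0.
rewrite nn_sqr {1}/nn; congr Num.sqrt.
have -> : vip x E (c *: a) (c *: a) = (c^* * c) *: vip x E a a.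
  rewrite /vip scaler_sumr !big_seq; apply: eq_bigr => g gE.
  rewrite /fip /= fstaratZ fmulatZl ?fmulatZr ?scalerA //; exact: composableVl.
apply: (@complexI R); rewrite vnormZ normrM norm_conjC -expr2 cmodE rmorphM rmorphXn.
by [].
Qed.

Lemma nn0 x E : nn x E 0 = 0.
Proof.
rewrite /nn (_ : vip _ _ _ _ = 0) ?vnorm0 ?sqrtr0 // /vip big1 // => g _.
by rewrite /fip fmulat0r //; exact: composableVl.
Qed.

Lemma nn1 g a : nn (src g) [fset g]%fset a = vnorm (a g).
Proof.
by rewrite /nn /vip big_seq_fset1 vnorm_fip // sqrtr_sqr ger0_norm // vnorm_ge0.
Qed.

Definition srestr E a : sect F := fun g => if g \in E then a g else 0.

Lemma srestrE E a : {in E, forall g, srestr E a g = a g}.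
Proof. by move=> g gE; rewrite /srestr gE. Qed.

Section Unital.
Hypothesis hu : forall x : G, gunits x -> exists e : fib F x, fibre_unit e.

Lemma vip_pos x E a : gunits x -> over x E -> fpos hu (vip x E a a).
Proof.
by move=> hx oE; apply: fpos_sum => // g gE; apply: fpos_fip => //; exact: oE.
Qed.

Lemma nn_sub x E H a : gunits x -> over x H -> (E `<=` H)%fset -> nn x E a <= nn x H a.
Proof.
move=> hx oH EH; rewrite ler_sqrt ?vnorm_ge0 //.
apply: (@fpos_mono _ _ _ hu); first by apply: vip_pos => //; exact: over_sub oH.
have -> : vip x H a a - vip x E a a = vip x (H `\` E)%fset a a.
  rewrite /vip (big_fsetID _ (mem E) H) /= addrAC.
  have -> : [fset g in H | g \in E]%fset = E.
    by apply/fsetP => g; rewrite !inE /= andbC; case: (boolP (g \in E)) => // /(fsubsetP EH) ->.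
  rewrite subrr add0r; apply: eq_fbigl => g.
  by rewrite !inE /= andbC.
by apply: vip_pos => //; exact: overD.
Qed.

(** The hypothesis of the abstract inequality is the expansion of the positive inner square of
    [a c - b], with [c] acting on the right of each entry. *)
Lemma vip_CS x E a b : gunits x -> over x E ->
  vnorm (vip x E a b) <= nn x E a * nn x E b.
Proof.
move=> hx oE; rewrite -(ler_pXn2r (n := 2)) ?nnegrE ?vnorm_ge0 ?mulr_ge0 ?nn_ge0 //.
rewrite exprMn !nn_sqr.
apply: (@cauchy_schwarz _ _ (fibA hu hx) (vip x E a a) (vip x E b b) (vip x E a b)).
- exact/fposP/vip_pos.
- exact/fposP/vip_pos.
move=> c; apply: fposP.
pose ac : sect F := fun g => fmulat g (a g) (c : fib F x).
suff E1 : vip x E (ac - b) (ac - b) =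
    fmulat x (fmulat x (fstarat x c) (vip x E a a)) c
     - fmulat x (fstarat x c) (vip x E a b)
     - fmulat x (fstarat x (vip x E a b)) c + vip x E b b :> fib F x.
  by have := vip_pos (ac - b) hx oE; rewrite E1.
have xx := unit_comp hx; have mx := gmul_unit hx.
rewrite (vip_star _ _ hx oE) {2 3 4}/vip !fmulat_sumr // !fmulat_suml //.
rewrite /vip -!sumrB -big_split !big_seq; apply: eq_bigr => g gE /=.
have gx := oE _ gE.
rewrite /ac {1}/fip fstaratB fmulatBl ?fmulatBr //; try exact: composableVl.
rewrite -!/(fip _ _ _) fip_mulr // !fip_mull // fip_mulr // opprB addrA.
by rewrite addrAC.
Qed.

Lemma nnD x E a b : gunits x -> over x E -> nn x E (a + b) <= nn x E a + nn x E b.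
Proof.
move=> hx oE.
rewrite -(ler_pXn2r (n := 2)) ?nnegrE ?addr_ge0 ?nn_ge0 //.
rewrite {1}nn_sqr vipDl // !vipDr //.
have := vnormD (vip x E a a + vip x E a b) (vip x E b a + vip x E b b).
have := vnormD (vip x E a a) (vip x E a b).
have := vnormD (vip x E b a) (vip x E b b).
have := vip_CS a b hx oE; have := vip_CS b a hx oE.
rewrite -!nn_sqr; lra.
Qed.

Lemma nnN x E a : over x E -> nn x E (- a) = nn x E a.
Proof.
by move=> oE; rewrite -scaleN1r nnZ // cmodN1 mul1r.
Qed.

Lemma nnB x E a b : gunits x -> over x E -> nn x E (a - b) <= nn x E a + nn x E b.
Proof. by move=> hx oE; rewrite -(nnN b oE); exact: nnD. Qed.

Lemma vnorm_le_nn x E a g : gunits x -> over x E -> g \in E -> vnorm (a g) <= nn x E a.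
Proof.
move=> hx oE gE; rewrite -nn1 (oE _ gE); apply: nn_sub => //.
by apply/fsubsetP => h; rewrite inE => /eqP ->.
Qed.

Lemma nn_le_sum x E a : gunits x -> over x E -> nn x E a <= \sum_(g <- E) vnorm (a g).
Proof.
move=> hx oE.
have s0 : 0 <= \sum_(g <- E) vnorm (a g) by apply: sumr_ge0 => g _; exact: vnorm_ge0.
rewrite -(ler_pXn2r (n := 2)) ?nnegrE ?nn_ge0 // nn_sqr /vip.
apply: (@le_trans _ _ (\sum_(g <- E) vnorm (a g) ^+ 2)).
  rewrite !big_seq; elim/big_rec2: _ => [|g v u gE IH]; first by rewrite vnorm0.
  apply: le_trans (vnormD _ _) _; rewrite lerD //.
  by rewrite vnorm_fip // oE.
elim: (enum_fset E) => [|g s IH]; first by rewrite !big_nil expr0n.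
rewrite !big_cons.
have : 0 <= \sum_(j <- s) vnorm (a j) by apply: sumr_ge0 => j _; exact: vnorm_ge0.
have := vnorm_ge0 (a g); move: IH; nra.
Qed.

Lemma nn_srestr x E H a : gunits x -> over x E -> over x H ->
  nn x H (srestr E a) <= nn x E a.
Proof.
move=> hx oE oH.
have -> : nn x H (srestr E a) = nn x (H `&` E)%fset a.
  rewrite /nn; congr (Num.sqrt (vnorm _)); rewrite /vip.
  rewrite (big_fsetID _ (mem E) H) /= [X in _ + X]big_seq [X in _ + X]big1 ?addr0.
    rewrite (_ : [fset g in H | g \in E]%fset = (H `&` E)%fset); last first.
      by apply/fsetP => g; rewrite !inE.
    rewrite !big_seq; apply: eq_bigr => g; rewrite inE => /andP[_ gE].
    by rewrite /srestr gE.
  move=> g; rewrite !inE => /andP[_ /negPf gE].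
  by rewrite /srestr gE /fip fmulat0r //; exact: composableVl.
apply: nn_sub => //; exact: fsubsetIr.
Qed.

End Unital.
End Vectors.

(** * Sections as operators: adjoints and bounds *)

Section Action.
Variables (R : realType) (G : etaleGroupoidType) (F : fellBundle R G).
Implicit Types (g h k l x y : G) (r t C : R) (a b f : sect F) (E H K : {fset G}).

(* The value at [g] of the convolution of [a] with the restriction of [f] to
   a finite subset [E] of the source fibre of [g]. *)
Definition apply_at a E f : sect F :=
  fun g => \sum_(h <- E) fmulat g (a (gdiv g h)) (f h).

Lemma sect_starV a g : sect_star a (ginv g) = fstarat (ginv g) (a g).
Proof. by rewrite /sect_star /fstarat ginvK. Qed.

Lemma sect_starE a g : sect_star a g = fstarat g (a (ginv g)).
Proof. by []. Qed.

Lemma sect_starK a : sect_star (sect_star a) = a.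
Proof.
apply: functional_extensionality_dep => g.
by rewrite sect_starE sect_starV fstaratK.
Qed.

Lemma sect_starD a b : sect_star (a + b) = sect_star a + sect_star b.
Proof. by apply: functional_extensionality_dep => g; exact: fstaratD. Qed.

Lemma sect_starZ (c : R[i]) a : sect_star (c *: a) = c^* *: sect_star a.
Proof. by apply: functional_extensionality_dep => g; exact: fstaratZ. Qed.

Lemma sect_starB a b : sect_star (a - b) = sect_star a - sect_star b.
Proof. by apply: functional_extensionality_dep => g; exact: fstaratB. Qed.

Lemma sect_star0 : sect_star (0 : sect F) = 0.
Proof. by apply: functional_extensionality_dep => g; exact: fstarat0. Qed.

Section Fixed.
Variables (x : G) (E : {fset G}).
Hypothesis oE : over x E.

Lemma eq_apply_at a f f' g : {in E, forall h, f h = f' h} ->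
  apply_at a E f g = apply_at a E f' g.
Proof.
by move=> ff; rewrite /apply_at !big_seq; apply: eq_bigr => h hE; rewrite ff.
Qed.

Lemma apply_atDl a a' f g : src g = x ->
  apply_at (a + a') E f g = apply_at a E f g + apply_at a' E f g.
Proof.
move=> gx; rewrite /apply_at -big_split !big_seq; apply: eq_bigr => h hE /=.
by rewrite fmulatDl //; apply: gdiv_compl; rewrite gx oE.
Qed.

Lemma apply_atDr a f f' g : src g = x ->
  apply_at a E (f + f') g = apply_at a E f g + apply_at a E f' g.
Proof.
move=> gx; rewrite /apply_at -big_split !big_seq; apply: eq_bigr => h hE /=.
by rewrite fmulatDr //; apply: gdiv_compl; rewrite gx oE.
Qed.

Lemma apply_atZl (c : R[i]) a f g : src g = x ->
  apply_at (c *: a) E f g = c *: apply_at a E f g.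
Proof.
move=> gx; rewrite /apply_at scaler_sumr !big_seq; apply: eq_bigr => h hE /=.
by rewrite fmulatZl //; apply: gdiv_compl; rewrite gx oE.
Qed.

Lemma apply_atZr (c : R[i]) a f g : src g = x ->
  apply_at a E (c *: f) g = c *: apply_at a E f g.
Proof.
move=> gx; rewrite /apply_at scaler_sumr !big_seq; apply: eq_bigr => h hE /=.
by rewrite fmulatZr //; apply: gdiv_compl; rewrite gx oE.
Qed.

Lemma apply_atBr a f f' g : src g = x ->
  apply_at a E (f - f') g = apply_at a E f g - apply_at a E f' g.
Proof. by move=> gx; rewrite apply_atDr // -scaleN1r apply_atZr // scaleN1r. Qed.

End Fixed.

Lemma apply_at_subset x E H a f g : over x H -> src g = x -> (E `<=` H)%fset ->
  apply_at a H (srestr E f) g = apply_at a E f g.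
Proof.
move=> oH gx EH; rewrite /apply_at (big_fsetID _ (mem E) H) /=.
rewrite [X in _ + X]big_seq [X in _ + X]big1 ?addr0; last first.
  move=> h; rewrite !inE => /andP[hH /negPf hE].
  by rewrite /srestr hE fmulat0r //; apply: gdiv_compl; rewrite gx oH.
have -> : [fset g in H | g \in E]%fset = E.
  by apply/fsetP => h; rewrite !inE /= andbC; case: (boolP (h \in E)) => // /(fsubsetP EH) ->.
rewrite !big_seq; apply: eq_bigr => h hE; by rewrite srestrE.
Qed.

(** The matrix entry of [a] at [(g, h)] is its value at [g h^-1], whose inverse is [h g^-1]; so
    [sect_star] yields the adjoint matrix. *)
Lemma apply_at_adjoint x E H a f f' : gunits x -> over x E -> over x H ->
  vip x E (apply_at a H f) f' = vip x H f (apply_at (sect_star a) E f').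
Proof.
move=> hx oE oH; rewrite /vip.
transitivity (\sum_(g <- E) \sum_(h <- H)
   fip x (f h) (fmulat h (sect_star a (gdiv h g)) (f' g))).
  rewrite !big_seq; apply: eq_bigr => g gE; have gx := oE _ gE.
  rewrite /fip /apply_at fstarat_sum fmulat_suml; last exact: composableVl.
  rewrite !big_seq; apply: eq_bigr => h hH; have hx' := oH _ hH.
  have gh : src g = src h by rewrite gx.
  rewrite -!/(fip _ _ _) (fip_mul gx) ?gdivK //; last exact: gdiv_compl.
  by rewrite -sect_starV gdivV.
rewrite exchange_big /= !big_seq; apply: eq_bigr => h hH.
have hx' := oH _ hH.
rewrite {2}/fip /apply_at fmulat_sumr //; exact: composableVl.
Qed.

(** The bound of [bnorm a] by [C] in terms of finite blocks: real-valued and free of infinite sums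
    and quotients. *)
Definition bbd a C : Prop := 0 <= C /\ forall x E H f, gunits x -> over x E -> over x H ->
  nn x E (apply_at a H f) <= C * nn x H f.

Lemma bbd_ge0 a C : bbd a C -> 0 <= C. Proof. by case. Qed.

Lemma bbd_le a C C' : C <= C' -> bbd a C -> bbd a C'.
Proof.
move=> CC [C0 aC]; split; first exact: le_trans CC.
move=> x E H f hx oE oH; apply: le_trans (aC _ _ _ f hx oE oH) _.
by rewrite ler_wpM2r // nn_ge0.
Qed.

Lemma bbd0 : bbd 0 0.
Proof.
split=> // x E H f hx oE oH; rewrite mul0r.
have -> : nn x E (apply_at 0 H f) = nn x E (0 : sect F).
  apply: eq_nn => g gE; rewrite /apply_at big_seq big1 // => h hH.
  by rewrite fmulat0l //; apply: gdiv_compl; rewrite (oE _ gE) (oH _ hH).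
by rewrite nn0.
Qed.

Lemma bbdZ (c : R[i]) a C : bbd a C -> bbd (c *: a) (cmod c * C).
Proof.
move=> [C0 aC]; split; first by rewrite mulr_ge0 ?cmod_ge0.
move=> x E H f hx oE oH.
have -> : nn x E (apply_at (c *: a) H f) = nn x E (c *: apply_at a H f).
  by apply: eq_nn => g gE; rewrite (apply_atZl oH) // oE.
by rewrite nnZ // -mulrA ler_wpM2l ?cmod_ge0 // aC.
Qed.

Lemma bbdN a C : bbd a C -> bbd (- a) C.
Proof. by move=> /(bbdZ (-1)); rewrite scaleN1r cmodN1 mul1r. Qed.

Section Unital.
Hypothesis hu : forall x : G, gunits x -> exists e : fib F x, fibre_unit e.

Lemma bbdD a b C D : bbd a C -> bbd b D -> bbd (a + b) (C + D).
Proof.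
move=> [C0 aC] [D0 bD]; split; first exact: addr_ge0.
move=> x E H f hx oE oH.
have -> : nn x E (apply_at (a + b) H f) = nn x E (apply_at a H f + apply_at b H f).
  by apply: eq_nn => g gE; rewrite (apply_atDl oH) // oE.
rewrite mulrDl; apply: le_trans (nnD hu _ _ hx oE) _.
exact: lerD (aC x E H f hx oE oH) (bD x E H f hx oE oH).
Qed.

Lemma bbdB a b C D : bbd a C -> bbd b D -> bbd (a - b) (C + D).
Proof. by move=> aC /bbdN; exact: bbdD. Qed.

(** For [h = a^* f] the square of its norm on [E] is the norm of the inner product of [a h] with
    [f], at most [C] times both norms; one factor cancels. *)
Lemma bbd_star a C : bbd a C -> bbd (sect_star a) C.
Proof.
move=> [C0 aC]; split => // x E H f hx oE oH.
set h := apply_at (sect_star a) H f.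
have : nn x E h ^+ 2 <= C * nn x E h * nn x H f.
  rewrite nn_sqr {2}/h -apply_at_adjoint //.
  apply: le_trans (vip_CS hu _ _ hx oH) _.
  by rewrite ler_wpM2r ?nn_ge0 // aC.
have [->|nz] := eqVneq (nn x E h) 0.
  by move=> _; rewrite mulr_ge0 // nn_ge0.
by rewrite expr2 mulrAC ler_pM2r // lt_def nz nn_ge0.
Qed.

Definition spoint x (v : fib F x) : sect F := fun g => at_fib g (inj_tot v).

(** On the source fibre of [x], [a] is its own image of the point mass at [x] with value the
    unit. *)
Lemma bbd_nn a C x E : bbd a C -> gunits x -> over x E -> nn x E a <= C.
Proof.
move=> [C0 aC] hx oE; pose f := spoint (fone hu hx).
have o1 : over x [fset x]%fset by move=> h; rewrite inE => /eqP ->; exact: src_unit.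
have fx : f x = fone hu hx by rewrite /f /spoint at_fibE.
have -> : nn x E a = nn x E (apply_at a [fset x]%fset f).
  apply: eq_nn => g gE; have gx := oE _ gE.
  have gg : gdiv g x = g by rewrite -gx gdiv_src.
  by rewrite /apply_at big_seq_fset1 fx gg fibre_unitr //; exact: foneP.
apply: le_trans (aC _ _ _ f hx oE o1) _.
have -> : nn x [fset x]%fset f = vnorm (f x).
  by rewrite -{1}(src_unit hx) nn1.
rewrite fx -[leRHS]mulr1 ler_wpM2l //.
exact: (cnorm1_le1 (fibA hu hx)).
Qed.

Lemma bbd_vnorm a C g : bbd a C -> vnorm (a g) <= C.
Proof.
move=> aC; rewrite -nn1; apply: bbd_nn => //; first exact: gunits_src.
exact: over1.
Qed.

End Unital.
End Action.

(** * Convolution as a limit over finite sets *)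

Section Convolution.
Variables (R : realType) (G : etaleGroupoidType) (F : fellBundle R G).
Implicit Types (g h k l x y : G) (r t C : R) (a b f : sect F) (E H K : {fset G}).

(** A factorisation of [g] is determined by its right factor, so the net of partial sums is indexed
    by finite subsets of the source fibre of [g]. *)
Definition is_conv a b g (v : fib F g) : Prop := forall e : R, 0 < e ->
  exists2 K, over (src g) K & forall H, over (src g) H -> (K `<=` H)%fset ->
    vnorm (apply_at a H b g - v) <= e.

Section Link.
Variable g : G.

Lemma fact_snd (p : factorizations g) : src (val p).2 = src g.
Proof. by have [cp E] := set_valP p; have := src_mul cp; rewrite E. Qed.

Lemma fact_fst (p : factorizations g) : gdiv g (val p).2 = (val p).1.
Proof. by have [cp E] := set_valP p; have := gdiv_gmul cp; rewrite E. Qed.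

Lemma fact_of_subproof h : exists p : factorizations g, src h = src g -> (val p).2 = h.
Proof.
have [E|nE] := pselect (src h = src g); last first.
  (* A default factorisation for [h] off the source fibre of [g]. *)
  have : factorizations g (g, src g).
    by split=> /=; rewrite ?gmul_src // /composable rng_src.
  by move=> fp; exists (SigSub (mem_set fp)).
have fp : factorizations g (gdiv g h, h).
  by split=> /=; [exact: gdiv_compl | rewrite gdivK].
by exists (SigSub (mem_set fp)).
Qed.

Definition fact_of h : factorizations g := projT1 (cid (fact_of_subproof h)).

Lemma fact_ofK h : src h = src g -> (val (fact_of h)).2 = h.
Proof. exact: (projT2 (cid (fact_of_subproof h))). Qed.

Lemma fact_snd_inj (p q : factorizations g) : (val p).2 = (val q).2 -> p = q.
Proof.
move=> E; apply: val_inj; have := fact_fst p; rewrite E fact_fst.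
by move: E; case: (val p) => ? ?; case: (val q) => ? ? /= -> ->.
Qed.

Definition fact_img (A : {fset factorizations g}) : {fset G} :=
  [fset (val p).2 | p in A]%fset.

Lemma fact_img_over A : over (src g) (fact_img A).
Proof. by move=> h /imfsetP[p _ ->]; exact: fact_snd. Qed.

Lemma partial_sumE a b A :
  partial_sum (@convol_term R G F a b g) A = apply_at a (fact_img A) b g.
Proof.
rewrite /partial_sum /apply_at /fact_img big_imfset /=; last first.
  by move=> p q _ _; exact: fact_snd_inj.
rewrite big_seq_fsetE /=.
by apply: eq_bigr => p _; rewrite fact_fst.
Qed.

Lemma is_convP a b v :
  partial_sum (@convol_term R G F a b g) @ totally --> v <-> is_conv a b v.
Proof.
split=> [cv e e0|cv].
  have [A _ hA] := vnorm_cvgP totally_filter cv e0.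
  exists (fact_img A); first exact: fact_img_over.
  move=> H oH AH; pose B := [fset fact_of h | h in H]%fset.
  have BH : fact_img B = H.
    apply/fsetP => h; apply/imfsetP/idP => [[p /imfsetP[k /= kH ->] ->]|hH].
      by rewrite fact_ofK // oH.
    exists (fact_of h); last by rewrite fact_ofK // oH.
    by apply/imfsetP; exists h.
  rewrite -BH -partial_sumE; apply: hA => /=.
  apply/fsubsetP => p pA; apply/imfsetP; exists (val p).2 => /=.
    by apply: (fsubsetP AH); apply/imfsetP; exists p.
  by apply: fact_snd_inj; rewrite fact_ofK // fact_snd.
apply: (vnorm_cvg totally_filter) => e e0; have [K oK hK] := cv _ e0.
exists [fset fact_of h | h in K]%fset => // A /= KA.
rewrite partial_sumE; apply: hK; first exact: fact_img_over.
apply/fsubsetP => h hK'; apply/imfsetP; exists (fact_of h) => /=.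
  by apply: (fsubsetP KA); apply/imfsetP; exists h.
by rewrite fact_ofK // oK.
Qed.

Lemma convolE a b v : is_conv a b v -> convol a b g = v.
Proof.
by move=> /is_convP cv; apply: cvg_lim => //; exact: totally_filter.
Qed.

End Link.

Lemma convol_definedP a b : convol_defined a b <->
  forall g, is_conv a b (convol a b g).
Proof.
split=> [cd g|h g]; first by apply/is_convP; exact: cd.
by apply/cvg_ex; exists (convol a b g); apply/is_convP.
Qed.

Lemma convol_definedI a b (c : sect F) : (forall g, is_conv a b (c g)) ->
  convol_defined a b /\ convol a b = c.
Proof.
move=> h; have E : convol a b = c.
  by apply: functional_extensionality_dep => g; exact: convolE.
by split=> //; apply/convol_definedP; rewrite E.
Qed.

Lemma is_conv_unique a b g (v w : fib F g) : is_conv a b v -> is_conv a b w -> v = w.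
Proof. by move=> /convolE <- /convolE. Qed.

Lemma eq_is_conv a a' b b' g (v : fib F g) :
  (forall h, rng h = rng g -> a h = a' h) -> (forall h, src h = src g -> b h = b' h) ->
  is_conv a b v -> is_conv a' b' v.
Proof.
move=> aa bb cv e /cv[K oK hK]; exists K => // H oH KH.
have <- : apply_at a H b g = apply_at a' H b' g; last exact: hK.
rewrite /apply_at !big_seq; apply: eq_bigr => h hH; have hx := oH _ hH.
by rewrite aa ?bb // rng_div.
Qed.

Lemma is_convDl a a' b g (v v' : fib F g) :
  is_conv a b v -> is_conv a' b v' -> is_conv (a + a') b (v + v').
Proof.
move=> c1 c2 e e0; have [|K oK hK] := c1 (e / 2); first by lra.
have [|K' oK' hK'] := c2 (e / 2); first by lra.
exists (K `|` K')%fset; first exact: overU.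
move=> H oH; rewrite fsubUset => /andP[KH K'H].
rewrite (apply_atDl oH) // opprD addrACA.
have := vnormD (apply_at a H b g - v) (apply_at a' H b g - v').
have := hK _ oH KH; have := hK' _ oH K'H; lra.
Qed.

Lemma is_convDr a b b' g (v v' : fib F g) :
  is_conv a b v -> is_conv a b' v' -> is_conv a (b + b') (v + v').
Proof.
move=> c1 c2 e e0; have [|K oK hK] := c1 (e / 2); first by lra.
have [|K' oK' hK'] := c2 (e / 2); first by lra.
exists (K `|` K')%fset; first exact: overU.
move=> H oH; rewrite fsubUset => /andP[KH K'H].
rewrite (apply_atDr oH) // opprD addrACA.
have := vnormD (apply_at a H b g - v) (apply_at a H b' g - v').
have := hK _ oH KH; have := hK' _ oH K'H; lra.
Qed.

Lemma vnormZ_small (E : completeNormedModType R[i]) (c : R[i]) (v : E) (e : R) :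
  vnorm v <= e / (cmod c + 1) -> vnorm (c *: v) <= e.
Proof.
move=> h; have -> : vnorm (c *: v) = cmod c * vnorm v.
  by apply: (@complexI R); rewrite vnormZ cmodE rmorphM.
have := cmod_ge0 c; have := vnorm_ge0 v.
move: h; rewrite ler_pdivlMr; last by have := cmod_ge0 c; lra.
nra.
Qed.

Lemma is_convZl (c : R[i]) a b g (v : fib F g) : is_conv a b v -> is_conv (c *: a) b (c *: v).
Proof.
move=> cv e e0; have [|K oK hK] := cv (e / (cmod c + 1)).
  by rewrite divr_gt0 //; have := cmod_ge0 c; lra.
exists K => // H oH KH; rewrite (apply_atZl oH) // -scalerBr.
exact/vnormZ_small/hK.
Qed.

Lemma is_convZr (c : R[i]) a b g (v : fib F g) : is_conv a b v -> is_conv a (c *: b) (c *: v).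
Proof.
move=> cv e e0; have [|K oK hK] := cv (e / (cmod c + 1)).
  by rewrite divr_gt0 //; have := cmod_ge0 c; lra.
exists K => // H oH KH; rewrite (apply_atZr oH) // -scalerBr.
exact/vnormZ_small/hK.
Qed.

Lemma is_conv_fin a E b g : over (src g) E -> is_conv a (srestr E b) (apply_at a E b g).
Proof.
move=> oE e e0; exists E => // H oH EH.
by rewrite (apply_at_subset _ _ oH) // subrr vnorm0 ltW.
Qed.

(* Only the factorisation [g = g s(g)] contributes. *)
Lemma is_conv_diagr a (z : sect F) g : sect_supp z `<=` @gunits G ->
  is_conv a z (fmulat g (a g) (z (src g))).
Proof.
move=> zu e e0.
have o1 : over (src g) [fset src g]%fset.
  by move=> h; rewrite inE => /eqP ->; rewrite src_src.
exists [fset src g]%fset => // H oH EH.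
have -> : apply_at a H z g = apply_at a [fset src g]%fset z g.
  rewrite -(@apply_at_subset _ _ _ (src g) [fset src g]%fset H a z g oH) //.
  apply: eq_apply_at => h hH; rewrite /srestr inE.
  case: eqP => // hs; apply: contrapT => zh; apply: hs.
  by rewrite -(oH _ hH) src_unit //; exact: zu.
by rewrite /apply_at big_seq_fset1 gdiv_src subrr vnorm0 ltW.
Qed.

Lemma is_conv_diagl a (z : sect F) g : sect_supp z `<=` @gunits G ->
  is_conv z a (fmulat g (z (rng g)) (a g)).
Proof.
move=> zu e e0; exists [fset g]%fset; first exact: over1.
move=> H oH EH.
have -> : apply_at z H a g = apply_at z [fset g]%fset a g.
  rewrite -(@apply_at_subset _ _ _ (src g) [fset g]%fset H z a g oH) //.
  rewrite /apply_at !big_seq; apply: eq_bigr => h hH; rewrite /srestr inE.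
  case: eqP => // hs; have hx := oH _ hH.
  have [z0|z0] := pselect (z (gdiv g h) = 0).
    by rewrite z0 !fmulat0l //; exact: gdiv_compl.
  by case: hs; symmetry; apply: gdiv_unit => //; exact: zu.
by rewrite /apply_at big_seq_fset1 gdivv subrr vnorm0 ltW.
Qed.

Definition fset_div g H : {fset G} := [fset gdiv h g | h in H]%fset.

Lemma fset_div_over g H : over (src g) H -> over (rng g) (fset_div g H).
Proof. by move=> oH _ /imfsetP[h /= /oH hg ->]; rewrite src_div. Qed.

Lemma big_fset_div (V : zmodType) g H (u : G -> V) : over (src g) H ->
  \sum_(k <- fset_div g H) u k = \sum_(h <- H) u (gdiv h g).
Proof.
move=> oH; rewrite big_imfset //= => h k hH kH E.
by rewrite -(gdivK (oH _ hH)) -(gdivK (oH _ kH)) E.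
Qed.

Definition fset_mul g K : {fset G} := [fset gmul k g | k in K]%fset.

Lemma fset_mul_over g K : over (rng g) K -> over (src g) (fset_mul g K).
Proof. by move=> oK _ /imfsetP[k /= /oK kg ->]; rewrite src_mul. Qed.

Lemma fset_mul_sub g K H : over (rng g) K -> (fset_mul g K `<=` H)%fset ->
  (K `<=` fset_div g H)%fset.
Proof.
move=> oK KH; apply/fsubsetP => k kK; apply/imfsetP; exists (gmul k g) => /=.
  by apply: (fsubsetP KH); apply/imfsetP; exists k.
by rewrite gdiv_gmul //; exact: oK.
Qed.

(** A factorisation [g = (g h^-1) h] gives [g^-1 = h^-1 (h g^-1)], so right translation by [g^-1]
    matches the two nets of finite sets. *)
Lemma is_conv_star a b g (v : fib F (ginv g)) : is_conv a b v ->
  is_conv (sect_star b) (sect_star a) (fstarat g v).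
Proof.
move=> cv e /cv[K oK hK]; rewrite src_inv in oK.
exists (fset_mul g K); first exact: fset_mul_over.
move=> H oH /(fset_mul_sub oK) KH.
have oH' := fset_div_over oH.
have := hK _ _ KH; rewrite src_inv => /(_ oH').
congr (_ <= _); rewrite -(@vnorm_fstarat _ _ _ (ginv g) g) ?ginvK // fstaratB.
congr (vnorm (_ - _)); rewrite /apply_at fstarat_sum big_fset_div //.
rewrite !big_seq; apply: eq_bigr => h hH; have hg := oH _ hH.
have E : gdiv (ginv g) (gdiv h g) = ginv h.
  by rewrite {1}/gdiv gdivV // /gdiv gmulKl //; exact: gdiv_comp.
rewrite E (@fstaratM _ _ _ _ (gdiv g h) h) ?ginvK //.
- by rewrite [in RHS]sect_starE gdivV.
- by rewrite /composable src_inv rng_div.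
- by rewrite -E gdivK // src_inv src_div.
- exact: gdivV.
Qed.

End Convolution.

(** * Existence and associativity of convolutions *)

Section Composition.
Variables (R : realType) (G : etaleGroupoidType) (F : fellBundle R G).
Implicit Types (g h k l x y : G) (r t C D M : R) (a b c f : sect F) (E H K : {fset G}).

Lemma is_conv0r a g : is_conv a 0 (0 : fib F g).
Proof.
move=> e e0; exists fset0; first exact: over0.
move=> H oH _; rewrite /apply_at big_seq big1 ?subr0 ?vnorm0 ?ltW // => h hH.
by rewrite fmulat0r //; apply: gdiv_compl; rewrite oH.
Qed.

Lemma is_conv_sumr a g (I : eqType) (s : seq I) (b : I -> sect F) (v : I -> fib F g) :
  {in s, forall i, is_conv a (b i) (v i)} ->
  is_conv a (\sum_(i <- s) b i) (\sum_(i <- s) v i).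
Proof.
elim: s => [|i s IH] h; first by rewrite !big_nil; exact: is_conv0r.
rewrite !big_cons; apply: is_convDr; first by apply: h; rewrite mem_head.
by apply: IH => j js; apply: h; rewrite inE js orbT.
Qed.

Lemma is_convBr a b b' g (v v' : fib F g) :
  is_conv a b v -> is_conv a b' v' -> is_conv a (b - b') (v - v').
Proof.
by move=> h h'; rewrite -scaleN1r -[- v']scaleN1r; apply: is_convDr => //; exact: is_convZr.
Qed.

Lemma apply_at_shift a b g h H (w : fib F h) : over (src g) H -> src h = src g ->
  apply_at a H (fun k => fmulat k (b (gdiv k h)) w) g =
  fmulat g (apply_at a (fset_div h H) b (gdiv g h)) w.
Proof.
move=> oH hg.
have gh : src g = src h by [].
rewrite /apply_at fmulat_suml; last exact: gdiv_compl.
rewrite big_fset_div ?hg // !big_seq; apply: eq_bigr => k kH; have kg := oH _ kH.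
have E : gdiv (gdiv g h) (gdiv k h) = gdiv g k.
  by rewrite {1}/gdiv gdivV ?gdiv_mul // ?kg.
rewrite E (@fmulatA _ _ _ (gdiv g h) k) ?gdivK ?gdiv_mul ?kg //.
- by rewrite /composable src_div ?rng_div ?kg.
- by apply: gdiv_compl; rewrite kg.
Qed.

Lemma is_conv_mulr a b g h (v : fib F (gdiv g h)) (w : fib F h) : src h = src g ->
  is_conv a b v -> is_conv a (fun k => fmulat k (b (gdiv k h)) w) (fmulat g v w).
Proof.
move=> hg cv e e0; have w0 := vnorm_ge0 w.
have [|K oK hK] := cv (e / (vnorm w + 1)); first by rewrite divr_gt0 //; lra.
rewrite src_div // in oK.
have oK' : over (src g) (fset_mul h K) by rewrite -hg; exact: fset_mul_over.
exists (fset_mul h K) => // H oH KH.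
have gh : composable (gdiv g h) h by exact: gdiv_compl.
rewrite apply_at_shift // -fmulatBl //; apply: le_trans (vnorm_fmulat _ _ _ gh) _.
have oH' : over (src h) H by rewrite hg.
have := hK (fset_div h H); rewrite src_div // => /(_ (fset_div_over oH')).
move=> /(_ (fset_mul_sub oK KH)); rewrite ler_pdivlMr; last by lra.
set n := vnorm _; have : 0 <= n by exact: vnorm_ge0.
nra.
Qed.

Lemma apply_atE b E f : apply_at b E f =
  \sum_(h <- E) ((fun k => fmulat k (b (gdiv k h)) (f h)) : sect F).
Proof.
apply: functional_extensionality_dep => k; rewrite /apply_at.
by elim: (enum_fset E) => [|h s IH]; rewrite ?big_nil // !big_cons IH.
Qed.

Lemma is_conv_assoc_fin a b (c : sect F) E f g : (forall k, is_conv a b (c k)) ->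
  over (src g) E -> is_conv a (apply_at b E f) (apply_at c E f g).
Proof.
move=> cv oE; rewrite apply_atE; apply: is_conv_sumr => h hE.
by apply: is_conv_mulr => //; exact: oE.
Qed.

Lemma is_conv_uniform x E a b c e : over x E -> 0 < e ->
  {in E, forall g, is_conv a b (c g)} ->
  exists2 K, over x K & forall H, over x H -> (K `<=` H)%fset ->
    {in E, forall g, vnorm (apply_at a H b g - c g) <= e}.
Proof.
move=> oE e0 cv.
suff [K oK hK] : exists2 K, over x K & forall H, over x H -> (K `<=` H)%fset ->
    {in enum_fset E, forall g, vnorm (apply_at a H b g - c g) <= e} by exists K.
have : {subset enum_fset E <= E} by [].
elim: (enum_fset E) => [|g s IH] sE; first by exists fset0 => //; exact: over0.
have [|K oK hK] := IH; first by move=> h hs; apply: sE; rewrite inE hs orbT.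
have gE : g \in E by apply: sE; rewrite mem_head.
have [L oL hL] := cv g gE e e0; rewrite (oE _ gE) in oL hL.
exists (K `|` L)%fset; first exact: overU.
move=> H oH; rewrite fsubUset => /andP[KH LH] h; rewrite inE => /orP[/eqP ->|hs].
  exact: hL.
exact: hK.
Qed.

(* [b^* b] is defined. *)
Definition ccau b : Prop := forall x, gunits x -> forall e : R, 0 < e ->
  exists2 K, over x K & forall E, over x E -> nn x E (b - srestr K b) <= e.

Lemma bbd_apply a C g H f : bbd a C -> over (src g) H ->
  vnorm (apply_at a H f g) <= C * nn (src g) H f.
Proof.
move=> [_ aC] oH; rewrite -nn1; apply: aC => //; first exact: gunits_src.
exact: over1.
Qed.

Section Unital.
Hypothesis hu : forall x : G, gunits x -> exists e : fib F x, fibre_unit e.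

Lemma is_conv_bound x E a b c C M : gunits x -> over x E -> bbd a C ->
  (forall K, over x K -> nn x K b <= M) ->
  {in E, forall g, is_conv a b (c g)} -> nn x E c <= C * M.
Proof.
move=> hx oE aC bM cv; apply/ler_addgt0Pl => e e0.
(* The column norm is at most the sum of the entry norms, so this accuracy per entry costs at most
   [e] in total; the [+ 1] covers empty [E]. *)
have [|K oK hK] := is_conv_uniform oE (e := e / (#|` E|%:R + 1)) _ cv.
  by rewrite divr_gt0 // ltr_pwDr.
have := hK K oK (fsubset_refl _) => {}hK.
have := nnB hu (apply_at a K b) (apply_at a K b - c) hx oE.
have -> : apply_at a K b - (apply_at a K b - c) = c by rewrite opprB addrC subrK.
have : nn x E (apply_at a K b) <= C * M.
  case: (aC) => C0 aC'; apply: le_trans (aC' _ _ _ b hx oE oK) _.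
  by rewrite ler_wpM2l // bM.
suff : nn x E (apply_at a K b - c) <= e by lra.
apply: le_trans (nn_le_sum _ hx oE) _.
apply: (@le_trans _ _ (\sum_(g <- E) (e / (#|` E|%:R + 1)))).
  by rewrite !big_seq; apply: ler_sum => g gE; exact: hK.
rewrite big_const_seq count_predT iter_addr_0 -[_ *+ size _]mulr_natr mulrAC.
rewrite ler_pdivrMr ?ltr_pwDr //; apply: ler_wpM2l; first exact: ltW.
by rewrite lerDl.
Qed.

Lemma is_conv_vnorm a b g (v : fib F g) C M : bbd a C ->
  (forall K, over (src g) K -> nn (src g) K b <= M) ->
  is_conv a b v -> vnorm v <= C * M.
Proof.
move=> aC bM cv; pose c := spoint v.
have cg : c g = v by rewrite /c /spoint at_fibE.
rewrite -cg -nn1; apply: (is_conv_bound (a := a) (b := b)) => //.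
- exact: gunits_src.
- exact: over1.
- by move=> h; rewrite inE => /eqP ->; rewrite cg.
Qed.

Lemma bbd_convol a b c C D : bbd a C -> bbd b D -> (forall g, is_conv a b (c g)) ->
  bbd c (C * D).
Proof.
move=> aC bD cv; split; first by apply: mulr_ge0; [case: aC | case: bD].
move=> x E H f hx oE oH; rewrite -mulrA.
apply: (is_conv_bound (b := apply_at b H f) hx oE aC).
  by move=> K oK; case: bD => _; apply.
by move=> g gE; apply: is_conv_assoc_fin => //; rewrite oE.
Qed.

(** Partial sums past [K] differ from the one at [K] by [a] applied to a tail of [b], and [ccau]
    makes the tails of [b] uniformly small. *)
Lemma is_conv_ex a b C g : bbd a C -> ccau b -> exists v : fib F g, is_conv a b v.
Proof.
move=> aC cb; have C0 := bbd_ge0 aC.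
suff cv : cvg (partial_sum (@convol_term R G F a b g) @ totally).
  by exists (convol a b g); apply/is_convP.
apply: (vnorm_cauchy_cvg totally_filter) => e e0.
have [|K oK hK] := cb (src g) (gunits_src g) (e / (2 * (C + 1))).
  by rewrite divr_gt0 //; lra.
exists [set A | ([fset @fact_of G g h | h in K] `<=` A)%fset].
  by exists [fset @fact_of G g h | h in K]%fset.
suff dist (A : {fset factorizations g}) : ([fset @fact_of G g h | h in K] `<=` A)%fset ->
    vnorm (apply_at a (fact_img A) b g - apply_at a K b g) <= e / 2.
  move=> A B /= /dist hA /dist hB; rewrite !partial_sumE.
  have := vnormB (apply_at a (fact_img A) b g - apply_at a K b g)
                 (apply_at a (fact_img B) b g - apply_at a K b g).
  rewrite opprB addrA subrK; lra.
move=> KA; have oA := @fact_img_over _ _ A.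
have KA' : (K `<=` fact_img A)%fset.
  apply/fsubsetP => h hK'; apply/imfsetP; exists (fact_of g h) => /=.
    by apply: (fsubsetP KA); apply/imfsetP; exists h.
  by rewrite fact_ofK // oK.
rewrite -(@apply_at_subset _ _ _ (src g) K _ a b g oA) // -(apply_atBr oA) //.
apply: le_trans (bbd_apply _ aC oA) _.
have := hK _ oA; rewrite ler_pdivlMr; last by lra.
have := nn_ge0 (src g) (fact_img A) (b - srestr K b).
set n := nn _ _ _; nra.
Qed.

Lemma ccauZ (c : R[i]) b : ccau b -> ccau (c *: b).
Proof.
move=> cb x hx e e0; have [|K oK hK] := cb x hx (e / (cmod c + 1)).
  by rewrite divr_gt0 //; have := cmod_ge0 c; lra.
exists K => // E oE.
have -> : nn x E (c *: b - srestr K (c *: b)) = nn x E (c *: (b - srestr K b)).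
  apply: eq_nn => g gE; rewrite scalerBr; congr (_ - _); rewrite /srestr.
  by case: ifP => // gK; rewrite /GRing.scale /= /sect_scale gK // scaler0.
rewrite nnZ //; have := hK _ oE; have := cmod_ge0 c.
rewrite ler_pdivlMr; last by have := cmod_ge0 c; lra.
have := nn_ge0 x E (b - srestr K b); nra.
Qed.

Lemma ccau_sub b K L x E : gunits x -> (K `<=` L)%fset -> over x E ->
  nn x E (b - srestr L b) <= nn x E (b - srestr K b).
Proof.
move=> hx KL oE.
have -> : nn x E (b - srestr L b) = nn x E (srestr (E `\` L)%fset (b - srestr K b)).
  apply: eq_nn => g gE; rewrite /srestr inE gE andbT.
  rewrite /GRing.add /GRing.opp /=; case: (boolP (g \in L)) => /= gL.
    by rewrite subrr.
  by rewrite ifN //; apply: contra gL; exact: (fsubsetP KL).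
apply: le_trans (nn_srestr hu _ hx _ oE) _; first exact: overD.
by apply: nn_sub => //; exact: fsubsetDl.
Qed.

Lemma srestrD K a b : srestr K (a + b) = srestr K a + srestr K b.
Proof.
apply: functional_extensionality_dep => g; rewrite /srestr.
by rewrite [in RHS]/GRing.add /=; case: ifP; rewrite ?addr0.
Qed.

Lemma ccauD a b : ccau a -> ccau b -> ccau (a + b).
Proof.
move=> ca cb x hx e e0.
have [|K oK hK] := ca x hx (e / 2); first by lra.
have [|L oL hL] := cb x hx (e / 2); first by lra.
exists (K `|` L)%fset; first exact: overU.
move=> E oE; rewrite srestrD opprD addrACA.
apply: le_trans (nnD hu _ _ hx oE) _.
have := hK _ oE; have := hL _ oE.
have := ccau_sub a hx (fsubsetUl K L) oE; have := ccau_sub b hx (fsubsetUr K L) oE.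
lra.
Qed.

Lemma ccau_lim b : (forall e : R, 0 < e -> exists2 c, ccau c & bbd (b - c) e) -> ccau b.
Proof.
move=> h x hx e e0; have [|c cc bc] := h (e / 2); first by lra.
have [|K oK hK] := cc x hx (e / 2); first by lra.
exists K => // E oE.
have -> : b - srestr K b = (c - srestr K c) + ((b - c) - srestr K (b - c)).
  have E1 : srestr K b = srestr K (b - c) + srestr K c by rewrite -srestrD subrK.
  by rewrite E1; abel.
apply: le_trans (nnD hu _ _ hx oE) _.
have := hK _ oE.
have := ccau_sub (b - c) hx (fsub0set K) oE.
have -> : b - c - srestr fset0 (b - c) = b - c.
  by apply: functional_extensionality_dep => g; rewrite /GRing.add /GRing.opp /= /srestr inE subr0.
have := bbd_nn hu bc hx oE; lra.
Qed.

(** For multipliers [m], which agree over [x] with [m z] as soon as [z(x)] is the unit. *)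
Lemma ccau_local b : (forall x, gunits x -> exists2 c, ccau c &
  forall g, src g = x -> b g = c g) -> ccau b.
Proof.
move=> h x hx e e0; have [c cc bc] := h x hx.
have [K oK hK] := cc x hx e e0; exists K => // E oE.
have -> : nn x E (b - srestr K b) = nn x E (c - srestr K c); last exact: hK.
apply: eq_nn => g gE; rewrite /GRing.add /GRing.opp /= /srestr bc //; exact: oE.
Qed.

(** Associativity is clear when the right factor is finite. Replacing [c] by its restriction to [K]
    costs [C * D * e'] on either side, at most [e / 3], and the finite case supplies the last
    third. *)
Lemma is_conv_assoc a b c (ab bc : sect F) C D g (v : fib F g) :
  bbd a C -> bbd b D -> ccau c -> (forall k, is_conv a b (ab k)) ->
  (forall k, is_conv b c (bc k)) -> is_conv ab c v -> is_conv a bc v.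
Proof.
move=> aC bD cc cab cbc cv e e0; have hx := gunits_src g.
have C0 := bbd_ge0 aC; have D0 := bbd_ge0 bD.
have CD0 : 0 <= C * D by exact: mulr_ge0.
pose e' := e / (3 * (C * D + 1)).
have e'0 : 0 < e' by rewrite divr_gt0 //; lra.
have [K oK hK] := cc (src g) hx e' e'0.
have h3 : vnorm (v - apply_at ab K c g) <= C * D * e'.
  apply: (is_conv_vnorm (b := c - srestr K c) (bbd_convol aC bD cab)) => //.
  by apply: is_convBr => //; exact: is_conv_fin.
have [|L oL hL] := @is_conv_assoc_fin a b ab K c g cab oK (e / 3); first by lra.
exists L => // H oH LH.
have h1 : nn (src g) H (bc - apply_at b K c) <= D * e'.
  apply: (is_conv_bound (a := b) (b := c - srestr K c)) => //.
  move=> k kH; apply: is_convBr => //; apply: is_conv_fin; by rewrite oH.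
have h1' : vnorm (apply_at a H (bc - apply_at b K c) g) <= C * (D * e').
  by apply: le_trans (bbd_apply _ aC oH) _; rewrite ler_wpM2l.
have h2 := hL _ oH LH.
have -> : apply_at a H bc g - v =
  apply_at a H (bc - apply_at b K c) g
  + (apply_at a H (apply_at b K c) g - apply_at ab K c g) - (v - apply_at ab K c g).
  rewrite (apply_atBr oH) //; abel.
have e'E : e' * (3 * (C * D + 1)) = e by rewrite /e' divfK // gt_eqF //; lra.
have := vnormB (apply_at a H (bc - apply_at b K c) g
  + (apply_at a H (apply_at b K c) g - apply_at ab K c g)) (v - apply_at ab K c g).
have := vnormD (apply_at a H (bc - apply_at b K c) g)
  (apply_at a H (apply_at b K c) g - apply_at ab K c g).
nra.
Qed.

End Unital.
End Composition.

(** * Comparison with the norm of the big algebra *)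

Section BoundedNorm.
Variables (R : realType) (G : etaleGroupoidType) (F : fellBundle R G).
Implicit Types (g h k l x y : G) (r t C D M : R) (a b c f : sect F) (E H K : {fset G}).

Lemma sumr_fsubset E H (u : G -> R) : (E `<=` H)%fset -> (forall g, 0 <= u g) ->
  \sum_(g <- E) u g <= \sum_(g <- H) u g.
Proof.
move=> EH u0; rewrite (big_fsetID _ (mem E) H) /=.
have -> : [fset g in H | g \in E]%fset = E.
  by apply/fsetP => g; rewrite !inE /= andbC; case: (boolP (g \in E)) => // /(fsubsetP EH) ->.
by rewrite lerDl; apply: sumr_ge0 => g _; exact: u0.
Qed.

Lemma norm2_ge0 a : (0 <= norm2 a)%E.
Proof. by apply: ereal_sup_ubound; left. Qed.

Lemma nn_le_norm2 x E a : gunits x -> over x E -> ((nn x E a)%:E <= norm2 a)%E.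
Proof.
move=> hx oE; apply: ereal_sup_ubound; right; exists x, [set` E]; split => //.
by rewrite fsbig_finite // set_fsetK; congr (_%:E); congr (Num.sqrt (vnorm _));
  rewrite /vip; apply: eq_bigr => g _; rewrite /fip /fmulat /fstarat at_fibE.
Qed.

Lemma norm2_le a M : 0 <= M -> (forall x E, gunits x -> over x E -> nn x E a <= M) ->
  (norm2 a <= M%:E)%E.
Proof.
move=> M0 h; apply: ge_ereal_sup => _ [->|[x [A [hx fA Ax ->]]]]; first by rewrite lee_fin.
rewrite lee_fin fsbig_finite //.
have oE : over x (fset_set A).
  by move=> g; rewrite in_fset_set // inE => /Ax.
apply: le_trans (h x _ hx oE); rewrite le_eqVlt; apply/orP; left; apply/eqP.
congr (Num.sqrt (vnorm _)); rewrite /vip; apply: eq_bigr => g _.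
by rewrite /fip /fmulat /fstarat at_fibE.
Qed.

Definition fsupp f x : {fset G} := fset_set (sect_supp f `&` [set g | src g = x]).

Lemma in_fsupp f x g : finsupp_sect F f -> (g \in fsupp f x) = `[< f g <> 0 /\ src g = x >].
Proof.
move=> ff; rewrite in_fset_set; last exact: finite_setIl.
by apply/idP/asboolP; rewrite inE.
Qed.

Lemma fsupp_over f x : finsupp_sect F f -> over x (fsupp f x).
Proof. by move=> ff g; rewrite in_fsupp // => /asboolP[]. Qed.

Lemma is_conv_finsupp a f g : finsupp_sect F f ->
  is_conv a f (apply_at a (fsupp f (src g)) f g).
Proof.
move=> ff; have oE := fsupp_over (x := src g) ff.
apply: eq_is_conv (is_conv_fin _ _ oE) => // h hg.
rewrite /srestr in_fsupp //; case: asboolP => // nh.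
by apply: contrapT => fh; apply: nh; split => // f0; apply: fh.
Qed.

Lemma finsupp_srestr E f : finsupp_sect F (srestr E f).
Proof.
apply: (sub_finite_set _ (finite_fset E)) => g /=.
by rewrite /sect_supp /srestr /=; case: ifP.
Qed.

Section Unital.
Hypothesis hu : forall x : G, gunits x -> exists e : fib F x, fibre_unit e.

Lemma nn_fsupp x E f : finsupp_sect F f -> gunits x -> over x E ->
  nn x E f <= nn x (fsupp f x) f.
Proof.
move=> ff hx oE.
have -> : nn x E f = nn x E (srestr (fsupp f x) f).
  apply: eq_nn => g gE; rewrite /srestr in_fsupp //; case: asboolP => // nh.
  by apply: contrapT => fh; apply: nh; split => //; exact: oE.
by apply: nn_srestr => //; exact: fsupp_over.
Qed.

Lemma norm2_srestr x H f : gunits x -> over x H -> norm2 (srestr H f) = (nn x H f)%:E.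
Proof.
move=> hx oH; apply/eqP; rewrite eq_le; apply/andP; split; last first.
  have -> : nn x H f = nn x H (srestr H f) by apply: eq_nn => g gH; rewrite srestrE.
  exact: nn_le_norm2.
apply: norm2_le => [|y E hy oE]; first exact: nn_ge0.
have [yx|xy] := eqVneq y x; first by subst y; exact: nn_srestr.
rewrite (_ : nn y E _ = 0) ?nn_ge0 //.
transitivity (nn y E (0 : sect F)); last exact: nn0.
apply: eq_nn => g gE; rewrite /srestr; case: ifP => // gH.
by move: xy; rewrite -(oE _ gE) (oH _ gH) eqxx.
Qed.

Lemma bbd_bnorm a C : bbd a C -> (bnorm a <= C%:E)%E.
Proof.
move=> [C0 aC]; apply: ge_ereal_sup => _ [f ff <-].
(* A crude bound, needed only to make [norm2 f] a real number. *)
pose S : R := \sum_(g <- fset_set (sect_supp f)) vnorm (f g).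
have fS : (norm2 f <= S%:E)%E.
  apply: norm2_le => [|x E hx oE]; first by apply: sumr_ge0 => g _; exact: vnorm_ge0.
  apply: le_trans (nn_fsupp ff hx oE) _.
  apply: le_trans (nn_le_sum _ hx _) _; first exact: fsupp_over.
  apply: sumr_fsubset => [|g]; last exact: vnorm_ge0.
  apply/fsubsetP => g; rewrite in_fsupp // => /asboolP[fg _].
  by rewrite in_fset_set // inE.
have : norm2 f \is a fin_num.
  by rewrite ge0_fin_numE ?norm2_ge0 // (le_lt_trans fS) // ltry.
have := norm2_ge0 f; case nE : (norm2 f) => [n| |] // n0 _; rewrite lee_fin in n0.
have afn : (norm2 (convol a f) <= (C * n)%:E)%E.
  apply: norm2_le => [|x E hx oE]; first exact: mulr_ge0.
  have -> : nn x E (convol a f) = nn x E (apply_at a (fsupp f x) f).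
    by apply: eq_nn => g gE; rewrite -(oE _ gE); apply/convolE/is_conv_finsupp.
  apply: le_trans (aC _ _ _ f hx oE (fsupp_over ff)) _.
  rewrite ler_wpM2l // -lee_fin -nE; apply: nn_le_norm2 => //; exact: fsupp_over.
have [n00|nn0] := eqVneq n 0.
  rewrite n00 mulr0 in afn.
  have -> : norm2 (convol a f) = 0%E by apply/eqP; rewrite eq_le afn norm2_ge0.
  by rewrite mul0e lee_fin.
by rewrite inver (negPf nn0) lee_pdivrMr // lt_def nn0.
Qed.

Lemma bnorm_bbd a C : 0 <= C -> (bnorm a <= C%:E)%E -> bbd a C.
Proof.
move=> C0 aC; split=> // x E H f hx oE oH.
have ff := finsupp_srestr H f.
(* A vanishing denominator carries no information through the quotient, but it forces [f = 0] on
   [H]. *)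
have [nz|nnz] := eqVneq (nn x H f) 0.
  rewrite nz mulr0 (_ : nn x E _ = 0) //.
  transitivity (nn x E (0 : sect F)); last exact: nn0.
  apply: eq_nn => g gE; rewrite /apply_at big_seq big1 // => h hH.
  have -> : f h = 0.
    apply: vnorm_eq0; apply/eqP; rewrite eq_le vnorm_ge0 andbT -nz.
    exact: vnorm_le_nn.
  by rewrite fmulat0r //; apply: gdiv_compl; rewrite (oE _ gE) (oH _ hH).
have nH : 0 < nn x H f by rewrite lt_def nnz nn_ge0.
have : (norm2 (convol a (srestr H f)) / norm2 (srestr H f) <= C%:E)%E.
  by apply: le_trans aC; apply: ereal_sup_ubound; exists (srestr H f).
rewrite (norm2_srestr _ hx oH) inver (negPf nnz) lee_pdivrMr // -EFinM -lee_fin.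
apply: le_trans.
have -> : nn x E (apply_at a H f) = nn x E (convol a (srestr H f)).
  apply: eq_nn => g gE; symmetry; apply/convolE/is_conv_fin; by rewrite oE.
exact: nn_le_norm2.
Qed.

Lemma bnorm_ge0 a : (0 <= bnorm a)%E.
Proof.
apply: ereal_sup_ubound; exists 0 => //.
  by apply: (sub_finite_set _ (finite_set0 G)) => g /=.
rewrite (_ : norm2 (convol a 0) = 0%E) ?mul0e //.
have -> : convol a 0 = 0 by apply: functional_extensionality_dep => g; apply/convolE/is_conv0r.
apply/eqP; rewrite eq_le norm2_ge0 andbT; apply: norm2_le => // x E _ _.
by rewrite nn0.
Qed.

Lemma bnormP a C : 0 <= C -> (bnorm a <= C%:E)%E <-> bbd a C.
Proof. by move=> C0; split; [exact: bnorm_bbd | exact: bbd_bnorm]. Qed.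

Lemma bnorm_fin a C : bbd a C -> exists r, [/\ bnorm a = r%:E, 0 <= r & bbd a r].
Proof.
move=> aC; have := bbd_bnorm aC; have := bnorm_ge0 a.
case E : (bnorm a) => [r| |] //; rewrite !lee_fin => r0 rC; exists r; split => //.
by apply/bnormP => //; rewrite E.
Qed.

Lemma at_most_one (I : eqType) (s : seq I) (V : zmodType) (u : I -> V) : uniq s ->
  {in s &, forall i j, u i <> 0 -> u j <> 0 -> i = j} ->
  {in s, forall i, u i = 0} \/
  exists2 i, i \in s & {in s, forall j, j != i -> u j = 0}.
Proof.
move=> us h; have [[i is_ ui]|no] := pselect (exists2 i, i \in s & u i <> 0).
  right; exists i => // j js ji; apply: contrapT => uj.
  by case/eqP: ji; apply: h.
by left => i is_; apply: contrapT => ui; apply: no; exists i.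
Qed.

Lemma big_only (I : eqType) (s : seq I) (V : zmodType) (u : I -> V) i : uniq s ->
  i \in s -> {in s, forall j, j != i -> u j = 0} -> \sum_(j <- s) u j = u i.
Proof.
move=> us is_ h; rewrite (bigD1_seq i) //= big_seq_cond big1 ?addr0 // => j.
by move=> /andP[js ji]; exact: h.
Qed.

(* A section supported on a slice acts as a weighted partial isometry. *)
Lemma slice_bbd (K : set G) a C : slice K -> sect_supp a `<=` K -> 0 <= C ->
  (forall g, vnorm (a g) <= C) -> bbd a C.
Proof.
move=> [Ks Kr] aK C0 aC; split => // x E H f hx oE oH.
pose t g h : fib F g := fmulat g (a (gdiv g h)) (f h).
have tK g h : g \in E -> h \in H -> t g h <> 0 -> K (gdiv g h).
  move=> gE hH tn; apply: aK => /= a0; apply: tn.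
  by rewrite /t a0 fmulat0l //; apply: gdiv_compl; rewrite (oE _ gE) (oH _ hH).
have gh g h : g \in E -> h \in H -> src g = src h by move=> /oE -> /oH ->.
(* Injectivity of the range on [K] leaves at most one term per row, so there are no cross terms;
   injectivity of the source later leaves at most one per column. *)
have row g : g \in E -> fip x (apply_at a H f g) (apply_at a H f g) =
    \sum_(h <- H) fip x (t g h) (t g h).
  move=> gE; have [|t0|[h hH t0]] := @at_most_one _ H _ (t g) (fset_uniq H).
  - move=> h k hH kH /(tK _ _ gE hH) Kh /(tK _ _ gE kH) Kk.
    have sh := gh g h gE hH; have sk := gh g k gE kH.
    have E1 : gdiv g h = gdiv g k.
      by apply: Kr; [exact: mem_set | exact: mem_set | rewrite !rng_div].
    have : ginv (gdiv g h) = ginv (gdiv g k) by rewrite E1.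
    rewrite !gdivV // => E2.
    by rewrite -[h](@gdivK _ _ g) // E2 gdivK.
  - rewrite /apply_at big_seq big1 // big_seq big1.
      by rewrite /fip fmulat0r //; exact: composableVl.
    by move=> h hH; rewrite t0 // /fip fmulat0r //; exact: composableVl.
  rewrite (@big_only _ _ _ (fun h => fip x (t g h) (t g h)) h) ?fset_uniq //; last first.
    by move=> k kH kh; rewrite t0 // /fip fmulat0r //; exact: composableVl.
  by rewrite /apply_at (@big_only _ _ _ (t g) h) ?fset_uniq.
have vE : vip x E (apply_at a H f) (apply_at a H f) =
   \sum_(h <- H) \sum_(g <- E) fip x (t g h) (t g h).
  by rewrite /vip exchange_big /= !big_seq; apply: eq_bigr => g; exact: row.
rewrite -(ler_pXn2r (n := 2)) ?nnegrE ?mulr_ge0 ?nn_ge0 // exprMn !nn_sqr vE.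
have -> : C ^+ 2 * vnorm (vip x H f f) = vnorm ((C ^+ 2)%:C *: vip x H f f).
  by rewrite vnormZr ger0_norm // sqr_ge0.
apply: (@fpos_mono _ _ _ hu).
  apply: fpos_sum => // h hH; apply: fpos_sum => // g gE.
  by apply: fpos_fip => //; exact: oE.
rewrite /vip scaler_sumr -sumrB; apply: fpos_sum => // h hH.
have [|t0|[g gE t0]] := @at_most_one _ E _ (fun g => fip x (t g h) (t g h)) (fset_uniq E).
- have tn g : fip x (t g h) (t g h) <> 0 -> t g h <> 0.
    by move=> + t0; apply; rewrite t0 /fip fmulat0r //; exact: composableVl.
  move=> g k gE kE /tn/(tK _ _ gE hH) Kg /tn/(tK _ _ kE hH) Kk.
  have E1 : gdiv g h = gdiv k h.
    by apply: Ks; [exact: mem_set | exact: mem_set | rewrite !src_div ?(gh _ h)].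
  by rewrite -(gdivK (gh g h gE hH)) E1 gdivK // (gh k h kE hH).
- rewrite [X in _ - X]big_seq [X in _ - X]big1 // subr0.
  by apply: fposZ; [exact: sqr_ge0 | apply: fpos_fip => //; exact: oH].
rewrite (@big_only _ _ _ (fun g => fip x (t g h) (t g h)) g) ?fset_uniq //.
apply: (fip_contract hu) => //.
- exact: oH.
- by apply: gdiv_compl; exact: gh.
- by apply: gdivK; exact: gh.
Qed.

Lemma slice_units : slice (@gunits G).
Proof.
split=> g h; rewrite !inE => gu hu'.
  by rewrite !src_unit.
by rewrite !rng_unit.
Qed.

End Unital.
End BoundedNorm.

(** * Continuous sections on slices *)

Lemma within_cvg_comp (S T U : topologicalType) (A : set T) (f : T -> U) (h : S -> T) s :
  {within A, continuous f} -> A (h s) -> {for s, continuous h} ->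
  (\forall s' \near s, A (h s')) -> {for s, continuous (f \o h)}.
Proof.
move=> /subspace_continuousP fA As hs nA;
apply: (@cvg_comp _ _ _ h f (nbhs s) (within A (nbhs (h s)))); last exact: fA.
move=> B hB; have := hs _ hB; apply: filterS2 nA => t At; exact.
Qed.

(** * Local inverses of the source map and products of bicompact sets *)

Section EtaleTopology.
Variable G : etaleGroupoidType.
Implicit Types (g h : G) (O U K L : set G).

Lemma gmul_continuous_at (S : topologicalType) (f h : S -> G) s :
  {for s, continuous f} -> {for s, continuous h} ->
  (\forall t \near s, composable (f t) (h t)) ->
  {for s, continuous (fun t => gmul (f t) (h t))}.
Proof.
move=> fs hs c; have cs := nbhs_singleton c.
apply: (@within_cvg_comp _ _ _ _ (fun p : G * G => gmul p.1 p.2) (fun t => (f t, h t)) s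
  (@gmul_continuous G)) => //.
exact: cvg_pair.
Qed.

Lemma src_continuous : continuous (@src G).
Proof.
move=> g; apply: gmul_continuous_at.
- exact: ginv_continuous.
- exact: cvg_id.
- by apply: nearW => h; exact: composableVl.
Qed.

Lemma rng_continuous : continuous (@rng G).
Proof.
move=> g; apply: gmul_continuous_at.
- exact: cvg_id.
- exact: ginv_continuous.
- by apply: nearW => h; exact: composableV.
Qed.

Lemma image_ginv K : @ginv G @` K = @ginv G @^-1` K.
Proof.
apply/seteqP; split=> [_ [g Kg <-]|g Kg]; first by rewrite /= ginvK.
by exists (ginv g) => //; rewrite ginvK.
Qed.

Lemma image_ginvK K : @ginv G @` (@ginv G @` K) = K.
Proof. by rewrite !image_ginv; apply/seteqP; split=> g /=; rewrite ginvK. Qed.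

Lemma open_ginv U : open U -> open (@ginv G @` U).
Proof.
rewrite image_ginv => oU; apply: open_comp => // g _; exact: ginv_continuous.
Qed.

Lemma src_image_ginv K : @src G @` (@ginv G @` K) = @rng G @` K.
Proof.
apply/seteqP; split=> [_ [_ [g Kg <-] <-]|_ [g Kg <-]].
  by exists g; rewrite ?src_inv.
by exists (ginv g); [exists g | rewrite src_inv].
Qed.

Lemma rng_image_ginv K : @rng G @` (@ginv G @` K) = @src G @` K.
Proof. by rewrite -src_image_ginv image_ginvK. Qed.

Lemma slice_ginv K : slice K -> slice (@ginv G @` K).
Proof.
move=> [Ks Kr]; split=> _ _ /set_mem [g Kg <-] /set_mem [h Kh <-].
  by rewrite !src_inv => E; congr ginv; apply: Kr => //; exact: mem_set.
by rewrite !rng_inv => E; congr ginv; apply: Ks => //; exact: mem_set.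
Qed.

Lemma bicompact_ginv K : bicompact K -> bicompact (@ginv G @` K).
Proof.
move=> [ [Ks Kr] Kc [ O [oO sO KO]]]; split.
- by split; rewrite ?src_image_ginv ?rng_image_ginv.
- apply: continuous_compact => //; apply: continuous_subspaceT.
  exact: ginv_continuous.
- exists (@ginv G @` O); split; [exact: open_ginv | exact: slice_ginv|].
  exact: image_subset.
Qed.

(* The inverse of [src] on a slice [O], with junk value [y] off [src @` O]. *)
Definition sec O (y : G) : G :=
  match pselect (exists2 g, O g & src g = y) with
  | left h => projT1 (cid2 h)
  | right _ => y
  end.

Lemma secP O y : (@src G @` O) y -> O (sec O y) /\ src (sec O y) = y.
Proof.
rewrite /sec => -[g Og gy]; case: pselect => [h|nh]; last by case: nh; exists g.
by case: (cid2 h).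
Qed.

Lemma sec_src O g : slice O -> O g -> sec O (src g) = g.
Proof.
move=> [Os _] Og; have [Og' E] : O (sec O (src g)) /\ src (sec O (src g)) = src g.
  by apply: secP; exists g.
by apply: Os => //; exact: mem_set.
Qed.

Lemma near_src_image O y : open O -> (@src G @` O) y ->
  \forall z \near y, (@src G @` O) z.
Proof. by move=> oO Oy; apply: open_nbhs_nbhs; split => //; exact: src_open. Qed.

(** The source map is open: the image of a small open part of [O] is a neighbourhood, and [sec O]
    maps it back. *)
Lemma sec_continuous O g : open O -> slice O -> O g ->
  {for src g, continuous (sec O)}.
Proof.
move=> oO sO Og B; rewrite sec_src // nbhsE => -[V [oV Vg] VB].
have oVO : open (V `&` O) by exact: openI.
apply: filterS (near_src_image oVO _); last by exists g.
by move=> _ [h [Vh Oh] <-]; apply: VB; rewrite /= sec_src.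
Qed.

Definition gprod O U : set G :=
  [set k | exists g h, [/\ O g, U h, composable g h & gmul g h = k]].

Lemma gprod_ginv K L : @ginv G @` (gprod K L) = gprod (@ginv G @` L) (@ginv G @` K).
Proof.
apply/seteqP; split=> [_ [_ [g [h [Kg Lh gh <-]] <-]]|k].
  exists (ginv h), (ginv g); split; [by exists h | by exists g | |].
    by rewrite /composable src_inv rng_inv.
  by rewrite ginv_mul.
move=> [_ [_ [[h Lh <-] [g Kg <-] hg <-]]].
have gh : composable g h by move: hg; rewrite /composable src_inv rng_inv.
by exists (gmul g h); [exists g, h | rewrite ginv_mul].
Qed.

Lemma gprod_slice O U : slice O -> slice U -> slice (gprod O U).
Proof.
move=> [Os Or] [Us Ur].
split=> _ _ /set_mem [g [h [Og Uh gh <-]]] /set_mem [g' [h' [Og' Uh' gh' <-]]].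
  rewrite !src_mul // => E; have Eh : h = h' by apply: Us => //; exact: mem_set.
  have Eg : g = g' by apply: Os; rewrite ?mem_set // gh gh' Eh.
  by rewrite Eh Eg.
rewrite !rng_mul // => E; have Eg : g = g' by apply: Or => //; exact: mem_set.
have Eh : h = h' by apply: Ur; rewrite ?mem_set // -gh -gh' Eg.
by rewrite Eh Eg.
Qed.

(* A product [k = g h] in [O U] is factored by [h = sec U (src k)]. *)
Section Factor.
Variables (O U : set G) (oO : open O) (sO : slice O) (oU : open U) (sU : slice U).

Lemma gprodE g h : O g -> U h -> composable g h ->
  sec U (src (gmul g h)) = h /\ gdiv (gmul g h) (sec U (src (gmul g h))) = g.
Proof.
move=> Og Uh gh; rewrite src_mul // sec_src //; split => //.
exact: gdiv_gmul.
Qed.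

Lemma gprod_factor k : gprod O U k ->
  [/\ U (sec U (src k)), O (gdiv k (sec U (src k))) & src (sec U (src k)) = src k].
Proof.
move=> [g [h [Og Uh gh <-]]]; have [-> _] := gprodE Og Uh gh.
by rewrite gdiv_gmul // src_mul.
Qed.

Lemma factor_right_continuous k : gprod O U k ->
  {for k, continuous (fun k' => sec U (src k'))}.
Proof.
move=> /gprod_factor[Uh Og E]; apply: continuous_comp; first exact: src_continuous.
by rewrite -E; exact: sec_continuous.
Qed.

Lemma near_src_comp k : gprod O U k ->
  \forall k' \near k, (@src G @` U) (src k').
Proof.
move=> /gprod_factor[Uh Og E].
apply: (@src_continuous k); apply: near_src_image => //.
by exists (sec U (src k)).
Qed.

Lemma factor_left_continuous k : gprod O U k ->
  {for k, continuous (fun k' => gdiv k' (sec U (src k')))}.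
Proof.
move=> kOU; apply: gmul_continuous_at; first exact: cvg_id.
  apply: continuous_comp; first exact: factor_right_continuous.
  exact: ginv_continuous.
apply: filterS (near_src_comp kOU) => k' /secP[_ E].
exact: gdiv_comp.
Qed.

Lemma gprod_open : open (gprod O U).
Proof.
rewrite openE => k kOU; rewrite /interior.
have [Uh Og E] := gprod_factor kOU.
have nO : \forall k' \near k, O (gdiv k' (sec U (src k'))).
  by apply: (factor_left_continuous kOU); apply: open_nbhs_nbhs.
apply: filterS2 nO (near_src_comp kOU) => k' Ok' /secP[Uk' E'].
exists (gdiv k' (sec U (src k'))), (sec U (src k')); split => //.
  exact: gdiv_compl.
exact: gdivK.
Qed.

End Factor.

Lemma closed_unitsP (C : set G) : C `<=` @gunits G ->
  closed (C : set (subspace (@gunits G))) <-> exists2 V, closed V & V `&` @gunits G = C.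
Proof.
move=> Cu; have E : C `&` @gunits G = C by apply/setIidPl.
by rewrite closed_subspaceP E.
Qed.

Lemma src_image_units K : @src G @` K `<=` @gunits G.
Proof. by move=> _ [g _ <-]; exact: gunits_src. Qed.

(** The sources of [K L] are the sources of [L] without those of elements of [U] whose range avoids
    the sources of [K]. The removed set is open, and injectivity of the source on [U] ensures that
    nothing else is removed. *)
Lemma gprod_src_closed K L U : open U -> slice U -> L `<=` U ->
  closed (@src G @` K : set (subspace (@gunits G))) ->
  closed (@src G @` L : set (subspace (@gunits G))) ->
  closed (@src G @` (gprod K L) : set (subspace (@gunits G))).
Proof.
move=> oU sU LU /(closed_unitsP (@src_image_units _))[VK cVK EK].
move=> /(closed_unitsP (@src_image_units _))[VL cVL EL].
apply/(closed_unitsP (@src_image_units _)).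
pose W := U `&` @rng G @^-1` (~` VK).
have oW : open W.
  apply: openI => //; apply: open_comp; last by rewrite openC.
  by move=> g _; exact: rng_continuous.
exists (VL `&` ~` (@src G @` W)).
  by apply: closedI => //; apply: open_closedC; exact: src_open.
apply/seteqP; split=> [y [[VLy nW] yu]|_ [_ [g [h [Kg Lh gh <-]]] <-]].
  have : (@src G @` L) y by rewrite -EL.
  move=> [h Lh hy]; have rh : VK (rng h).
    apply: contrapT => nV; apply: nW; exists h => //; split => //; exact: LU.
  have : (@src G @` K) (rng h) by rewrite -EK; split => //; exact: gunits_rng.
  move=> [g Kg gh]; exists (gmul g h); first by exists g, h.
  by rewrite src_mul.
split; last exact: gunits_src.
rewrite src_mul //; have : (@src G @` L) (src h) by exists h.
rewrite -EL => -[VLh _]; split => // -[h' [Uh' nV] E].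
have hh : h' = h by case: sU => Us _; apply: Us => //; apply: mem_set => //; exact: LU.
apply: nV; rewrite hh -gh.
have : (@src G @` K) (src g) by exists g.
by rewrite -EK => -[].
Qed.

(** Without separation the composable pairs need not be closed in the product of [K] and [L].
    Instead [K L] is the image of a relatively closed part of [L] under [h |-> k h], where [k]
    depends continuously on the range of [h]. *)
Lemma bicompact_gprod K L : bicompact K -> bicompact L -> bicompact (gprod K L).
Proof.
move=> bK bL; have [ [Ks Kr] Kc [ O [oO sO KO]]] := bK.
have [ [Ls Lr] Lc [U [oU sU LU]]] := bL.
split.
- split; first exact: (gprod_src_closed oU sU LU Ks Ls).
  rewrite -src_image_ginv gprod_ginv.
  apply: (@gprod_src_closed _ _ (@ginv G @` O)); rewrite ?src_image_ginv //.
  + exact: open_ginv.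
  + exact: slice_ginv.
  + exact: image_subset.
- have [VK cVK EK] := (closed_unitsP (@src_image_units K)).1 Ks.
  pose L' := L `&` @rng G @^-1` VK.
  have Lc' : compact L'.
    apply: compact_closedI => //; apply: preimage_closed => // g _.
    exact: rng_continuous.
  have L'K h : L' h -> (@src G @` K) (rng h).
    by move=> [_ Vh]; rewrite -EK; split => //; exact: gunits_rng.
  have -> : gprod K L = (fun h => gmul (sec O (rng h)) h) @` L'.
    apply/seteqP; split=> [_ [g [h [Kg Lh gh <-]]]|_ [h L'h <-]].
      exists h; last by rewrite -gh sec_src //; exact: KO.
      split => //=; have : (@src G @` K) (rng h) by exists g.
      by rewrite -EK => -[].
    have [g Kg gh] := L'K _ L'h; exists g, h; split => //; first by case: L'h.
    by rewrite -gh sec_src //; exact: KO.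
  apply: continuous_compact Lc'; apply: continuous_in_subspaceT => h /set_mem L'h.
  have [g Kg gh] := L'K _ L'h; have Og := KO _ Kg.
  apply: (@gmul_continuous_at _ (fun h => sec O (rng h)) (fun h => h)); last 1 first.
  + have : \forall h' \near h, (@src G @` O) (rng h').
      by apply: (@rng_continuous h); apply: near_src_image => //; exists g.
    by apply: filterS => h' /secP[].
  + apply: continuous_comp; first exact: rng_continuous.
    by rewrite -gh; exact: sec_continuous.
  + exact: cvg_id.
- exists (gprod O U); split; [exact: gprod_open | exact: gprod_slice|].
  by move=> _ [g [h [Kg Lh gh <-]]]; exists g, h; split => //; [exact: KO | exact: LU].
Qed.

End EtaleTopology.

(** * Continuous sections on bicompact sets *)

Section CompactSections.
Variables (R : realType) (G : etaleGroupoidType) (F : fellBundle R G).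
Implicit Types (g h k x : G) (C : R) (a b : sect F) (O U K L : set G).

Lemma slice_sub K L : K `<=` L -> slice L -> slice K.
Proof.
move=> KL [Ls Lr]; split=> g h /set_mem Kg /set_mem Kh.
  by apply: Ls; apply: mem_set; exact: KL.
by apply: Lr; apply: mem_set; exact: KL.
Qed.

Lemma bicompact_slice K : bicompact K -> slice K.
Proof. by move=> [_ _ [ O [_ sO KO]]]; exact: slice_sub sO. Qed.

(** Upper semicontinuity suffices: the sets of points of [K] with norm at least [n] would have a
    cluster point in [K], near which the norm stays below a fixed integer. *)
Lemma compact_bounded K a : compact K -> Csect F K a ->
  exists2 C, 0 <= C & forall g, vnorm (a g) <= C.
Proof.
move=> cK [aK ca]; suff [n hn] : exists n : nat, forall g, K g -> vnorm (a g) < n%:R.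
  exists n%:R => // g; have [Kg|nKg] := pselect (K g); first exact/ltW/hn.
  have -> : a g = 0 by apply: contrapT => ag; apply: nKg; exact: aK.
  by rewrite vnorm0.
apply: contrapT => no.
pose A n := [set g | K g /\ n%:R <= vnorm (a g)].
pose H := filter_from [set: nat] A.
have AS n m : (n <= m)%N -> A m `<=` A n.
  by move=> nm g [Kg hg]; split => //; apply: le_trans hg; rewrite ler_nat.
have FH : ProperFilter H.
  apply: filter_from_proper.
    apply: filter_fromT_filter; first by exists 0%N.
    move=> n m; exists (maxn n m) => g Ag.
    by split; apply: AS Ag; rewrite ?leq_maxl ?leq_maxr.
  move=> n _; apply: contrapT => An; apply: no; exists n => g Kg.
  by rewrite ltNge; apply/negP => hg; apply: An; exists g.
have HK : H K by exists 0%N => // g [].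
have [p [Kp cp]] := cK H FH HK.
pose N := (archimedean.Num.truncn (vnorm (a p))).+1.
have pN : vnorm (a p) < N%:R by rewrite -archimedean.Num.Theory.truncn_le_nat.
have oN : open [set b : tspace F | tnorm b < N%:R] := tnorm_usc (fbundle_banach F) _.
have nN : nbhs p [set g | vnorm (a g) < N%:R].
  have nb : nbhs (tot_sect a p) [set b : tspace F | tnorm b < N%:R].
    by apply: open_nbhs_nbhs; split.
  exact: (ca p Kp _ nb).
have HN : H (A N) by exists N.
have [g [[_ g1] g2]] := cp _ _ HN nN.
by move: g1; rewrite leNgt g2.
Qed.

Lemma tot_sect_star a g : tot_sect (sect_star a) g = tstar (tot_sect a (ginv g)).
Proof. by rewrite /tot_sect /sect_star inj_at_fib //= ginvK. Qed.

Lemma Csect_star K a : Csect F K a -> Csect F (@ginv G @` K) (sect_star a).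
Proof.
move=> [aK ca]; split=> [g ag|_ [g Kg <-]].
  rewrite image_ginv; apply: aK => a0; apply: ag.
  by rewrite sect_starE a0 fstarat0.
have -> : tot_sect (sect_star a) = (@tstar R G F) \o (tot_sect a \o @ginv G).
  by apply/funext => h; rewrite tot_sect_star.
have gc : {for ginv g, continuous (tot_sect a \o @ginv G)}.
  apply: continuous_comp; first exact: ginv_continuous.
  by rewrite ginvK; exact: ca.
apply: continuous_comp gc _; exact: tstar_continuous.
Qed.

Lemma slice_ccau K a : slice K -> sect_supp a `<=` K -> ccau a.
Proof.
move=> [Ks _] aK x hx e e0.
have nn0' (E H : {fset G}) : over x E -> (forall g, src g = x -> g \notin H -> a g = 0) ->
    nn x E (a - srestr H a) <= e.
  move=> oE aH; have -> : nn x E (a - srestr H a) = nn x E (0 : sect F).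
    apply: eq_nn => g gE; rewrite /GRing.add /GRing.opp /= /srestr.
    by case: (boolP (g \in H)) => gH; rewrite ?subrr // subr0 aH // oE.
  by rewrite nn0 ltW.
have [[g Kg gx]|no] := pselect (exists2 g, K g & src g = x).
  exists [fset g]%fset; first by move=> h; rewrite inE => /eqP ->.
  move=> E oE; apply: nn0' => // h hx'; rewrite inE => /eqP hg.
  apply: contrapT => ah; apply: hg; apply: Ks; rewrite ?hx' ?gx //.
    by apply: mem_set; exact: aK.
  exact: mem_set.
exists fset0; first exact: over0.
move=> E oE; apply: nn0' => // h hx' _; apply: contrapT => ah.
by apply: no; exists h => //; exact: aK.
Qed.

Lemma slice_is_conv L a b g h : slice L -> sect_supp b `<=` L -> L h -> src h = src g ->
  is_conv a b (fmulat g (a (gdiv g h)) (b h)).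
Proof.
move=> [Ls _] bL Lh hg.
have oh : over (src g) [fset h]%fset by move=> k; rewrite inE => /eqP ->.
have := is_conv_fin a b oh; rewrite /apply_at big_seq_fset1.
apply: eq_is_conv => // k kg; rewrite /srestr inE; case: eqP => [->//|kh].
apply: contrapT => bk; apply: kh; apply: Ls; rewrite ?kg ?hg //; apply: mem_set => //.
by apply: bL => b0; apply: bk.
Qed.

Lemma slice_is_conv0 a b g : (forall h, src h = src g -> b h = 0) ->
  is_conv a b (0 : fib F g).
Proof.
by move=> b0; apply: eq_is_conv (is_conv0r a g) => // h hg; rewrite b0.
Qed.

Lemma Csect_convol K L a b : bicompact K -> bicompact L -> Csect F K a -> Csect F L b ->
  exists2 c : sect F, (forall g, is_conv a b (c g)) & Csect F (gprod K L) c.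
Proof.
move=> bK bL [aK ca] [bL' cb].
have [_ _ [ O [oO sO KO]]] := bK; have [_ _ [U [oU sU LU]]] := bL.
have bU : sect_supp b `<=` U by exact: subset_trans LU.
(* The open slice [U] is used in place of [L], so that one formula holds on a neighbourhood of every
   point of [K L], as continuity on all of [G] requires. *)
pose c : sect F := fun g => let h := sec U (src g) in
  if pselect ((@src G @` U) (src g)) then fmulat g (a (gdiv g h)) (b h) else 0.
have cE g h : U h -> src h = src g -> c g = fmulat g (a (gdiv g h)) (b h).
  move=> Uh hg; have sh : sec U (src g) = h by rewrite -hg sec_src.
  by rewrite /c sh; case: pselect => // -[]; exists h.
exists c => [g|].
  have [[h Uh hg]|no] := pselect ((@src G @` U) (src g)).
    by rewrite (cE g h) //; exact: (slice_is_conv a sU bU Uh hg).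
  have -> : c g = 0 by rewrite /c; case: pselect.
  apply: slice_is_conv0 => h hg; apply: contrapT => bh.
  by apply: no; exists h => //; exact: bU.
split=> [g cg|_ [g [h [Kg Lh gh <-]]]].
  have [[h Uh hg]|no] := pselect ((@src G @` U) (src g)); last first.
    by case: cg; rewrite /c; case: pselect.
  move: cg; rewrite /sect_supp /= (cE g h) // => cg.
  have gh : composable (gdiv g h) h by exact: gdiv_compl.
  exists (gdiv g h), h; split => //; last exact: gdivK.
    by apply: aK => a0; apply: cg; rewrite a0 fmulat0l.
  by apply: bL' => b0; apply: cg; rewrite b0 fmulat0r.
set k := gmul g h.
have kOU : gprod O U k by exists g, h; split => //; [exact: KO | exact: LU].
have [sk gk] := gprodE sU (KO _ Kg) (LU _ Lh) gh; rewrite -/k in sk gk; rewrite sk in gk.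
pose T k' := tmul (tot_sect a (gdiv k' (sec U (src k')))) (tot_sect b (sec U (src k'))).
have near_cT : \forall k' \near k, T k' = tot_sect c k'.
  apply: filterS (near_src_comp oU sU kOU) => k' /secP[Uk Ek].
  by rewrite /T /tot_sect (cE k' _ Uk Ek) inj_fmulat // gdivK.
have Tk : T k = tot_sect c k := nbhs_singleton near_cT.
have c1 : {for k, continuous (fun k' => tot_sect a (gdiv k' (sec U (src k'))))}.
  apply: (@continuous_comp _ _ _ (fun k' => gdiv k' (sec U (src k'))) (tot_sect a)).
    exact: (factor_left_continuous oU sU kOU).
  by rewrite sk gk; exact: ca.
have c2 : {for k, continuous (fun k' => tot_sect b (sec U (src k')))}.
  apply: (@continuous_comp _ _ _ (fun k' => sec U (src k')) (tot_sect b)).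
    exact: (factor_right_continuous oU sU kOU).
  by rewrite sk; exact: cb.
have cT : {for k, continuous T}.
  apply: (@within_cvg_comp _ _ _ _ (fun p => tmul p.1 p.2)
    (fun k' => (tot_sect a (gdiv k' (sec U (src k'))), tot_sect b (sec U (src k')))) k
    (@tmul_continuous R G F)).
  - by rewrite /= sk gk.
  - apply: (@cvg_pair _ _ _ (nbhs k) (nbhs (tot_sect a (gdiv k (sec U (src k)))))
      (nbhs (tot_sect b (sec U (src k)))) _ _ _ _ _ c1 c2).
  - apply: filterS (near_src_comp oU sU kOU) => k' /secP[Uk Ek] /=.
    exact: gdiv_compl.
have cT' : T @ k --> tot_sect c k by rewrite -Tk; exact: cT.
by apply: cvg_trans cT'; exact: near_eq_cvg.
Qed.

End CompactSections.

(** * The reduced algebra *)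

Section ReducedAlgebra.
Variables (R : realType) (G : etaleGroupoidType) (F : fellBundle R G).
Implicit Types (g h k x : G) (C D e : R) (a b c s : sect F) (K L : set G).

Lemma Csect_Cc K s : bicompact K -> Csect F K s -> Cc F s.
Proof.
move=> bK Ks; exists 1%N, (fun _ => 1), (fun _ => s); split; first by move=> _; exists K.
by rewrite big_ord1 scale1r.
Qed.

Lemma Cc0 : Cc F 0.
Proof.
exists 0%N, (fun _ => 0), (fun _ => 0); split; first by case.
by rewrite big_ord0.
Qed.

Lemma CcD a b : Cc F a -> Cc F b -> Cc F (a + b).
Proof.
move=> [n [c [s [hs ->]]]] [m [d [t [ht ->]]]].
exists (n + m)%N, (fun i => match fintype.split i with inl j => c j | inr j => d j end),
  (fun i => match fintype.split i with inl j => s j | inr j => t j end); split.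
  by move=> i; case: (fintype.split i).
rewrite big_split_ord /=; congr (_ + _); apply: eq_bigr => i _.
  by rewrite (unsplitK (inl i)).
by rewrite (unsplitK (inr i)).
Qed.

Lemma CcZ (l : R[i]) a : Cc F a -> Cc F (l *: a).
Proof.
move=> [n [c [s [hs ->]]]]; exists n, (fun i => l * c i), s; split => //.
by rewrite scaler_sumr; apply: eq_bigr => i _; rewrite scalerA.
Qed.

Lemma Cc_ind (P : sect F -> Prop) : P 0 -> (forall a b, P a -> P b -> P (a + b)) ->
  (forall (l : R[i]) a, P a -> P (l *: a)) ->
  (forall K s, bicompact K -> Csect F K s -> P s) -> forall a, Cc F a -> P a.
Proof.
move=> P0 PD PZ Ps a [n [c [s [hs ->]]]]; elim/big_ind: _ => // i _.
by apply: PZ; have [K bK sK] := hs i; exact: Ps sK.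
Qed.

Lemma Cc_star a : Cc F a -> Cc F (sect_star a).
Proof.
move: a; apply: (@Cc_ind (fun a => Cc F (sect_star a))).
- by rewrite sect_star0; exact: Cc0.
- by move=> b c hb hc; rewrite sect_starD; exact: CcD.
- by move=> l b hb; rewrite sect_starZ; exact: CcZ.
- by move=> K s bK Ks; apply: Csect_Cc (bicompact_ginv bK) (Csect_star Ks).
Qed.

Lemma Cc_convol a b : Cc F a -> Cc F b ->
  exists2 c : sect F, (forall g, is_conv a b (c g)) & Cc F c.
Proof.
move=> Ca; move: b; apply: (@Cc_ind (fun b =>
  exists2 c : sect F, (forall g, is_conv a b (c g)) & Cc F c)).
- by exists 0; [move=> g; exact: is_conv0r | exact: Cc0].
- move=> b b' [c hc Cc1] [c' hc' Cc1']; exists (c + c'); last exact: CcD.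
  by move=> g; apply: is_convDr.
- move=> l b [c hc Cc1]; exists (l *: c); last exact: CcZ.
  by move=> g; apply: is_convZr.
move=> L t bL Lt; move: a Ca; apply: (@Cc_ind (fun a =>
  exists2 c : sect F, (forall g, is_conv a t (c g)) & Cc F c)).
- exists 0; last exact: Cc0.
  move=> g e e0; exists fset0; first exact: over0.
  move=> H oH _; rewrite /apply_at big_seq big1 ?subr0 ?vnorm0 ?ltW // => h hH.
  by rewrite fmulat0l //; apply: gdiv_compl; rewrite oH.
- move=> b b' [c hc Cc1] [c' hc' Cc1']; exists (c + c'); last exact: CcD.
  by move=> g; apply: is_convDl.
- move=> l b [c hc Cc1]; exists (l *: c); last exact: CcZ.
  by move=> g; apply: is_convZl.
move=> K s bK Ks; have [c hc cKL] := Csect_convol bK bL Ks Lt.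
by exists c => //; apply: Csect_Cc cKL; exact: bicompact_gprod.
Qed.

Section Unital.
Hypothesis hu : forall x : G, gunits x -> exists e : fib F x, fibre_unit e.

(* The sections that can be multiplied. *)
Definition good a : Prop := (exists C, bbd a C) /\ ccau a.

Lemma Csect_bbd K s : bicompact K -> Csect F K s -> exists C, bbd s C.
Proof.
move=> bK Ks; have [_ cK _] := bK; have [C C0 hC] := compact_bounded cK Ks.
exists C; apply: (slice_bbd hu (bicompact_slice bK)) => //; by case: Ks.
Qed.

Lemma ccau0 : ccau (0 : sect F).
Proof.
by apply: (@slice_ccau _ _ _ set0) => [|g //]; split=> g h; rewrite inE.
Qed.

Lemma goodD a b : good a -> good b -> good (a + b).
Proof.
move=> [[C aC] ca] [[D bD] cb]; split; last exact: ccauD.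
by exists (C + D); exact: bbdD.
Qed.

Lemma goodZ (l : R[i]) a : good a -> good (l *: a).
Proof.
by move=> [[C aC] ca]; split; [exists (cmod l * C); exact: bbdZ | exact: ccauZ].
Qed.

Lemma goodB a b : good a -> good b -> good (a - b).
Proof. by move=> ga gb; have := goodD ga (goodZ (-1) gb); rewrite scaleN1r. Qed.

Lemma Cc_good a : Cc F a -> good a.
Proof.
move: a; apply: (@Cc_ind good).
- by split; [exists 0; exact: bbd0 | exact: ccau0].
- exact: goodD.
- exact: goodZ.
- move=> K s bK Ks; split; first exact: Csect_bbd Ks.
  by apply: slice_ccau (bicompact_slice bK) _; case: Ks.
Qed.

Lemma CrP a : Cr F a <-> forall e, 0 < e -> exists2 c, Cc F c & bbd (a - c) e.
Proof.
split=> [h e e0|h e e0].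
  have [c Cc1 hc] := h e e0; exists c => //; apply: bnorm_bbd => //; exact: ltW.
have [|c Cc1 hc] := h (e / 2); first by lra.
exists c => //; apply: le_lt_trans (bbd_bnorm hu hc) _; rewrite lte_fin; lra.
Qed.

Lemma Cc_Cr a : Cc F a -> Cr F a.
Proof.
move=> Ca; apply/CrP => e e0; exists a => //; rewrite subrr.
by apply: bbd_le (bbd0 _); exact: ltW.
Qed.

Lemma Cr_lim a : (forall e, 0 < e -> exists2 c, Cr F c & bbd (a - c) e) -> Cr F a.
Proof.
move=> h; apply/CrP => e e0.
have [|c /CrP Cr1 hc] := h (e / 2); first by lra.
have [|d Cc1 hd] := Cr1 (e / 2); first by lra.
exists d => //; have -> : a - d = (a - c) + (c - d) by abel.
by apply: bbd_le (bbdD hu hc hd); lra.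
Qed.

Lemma CrD a b : Cr F a -> Cr F b -> Cr F (a + b).
Proof.
move=> /CrP ha /CrP hb; apply/CrP => e e0.
have [|c Cc1 hc] := ha (e / 2); first by lra.
have [|d Cd hd] := hb (e / 2); first by lra.
exists (c + d); first exact: CcD.
have -> : a + b - (c + d) = (a - c) + (b - d) by abel.
by apply: bbd_le (bbdD hu hc hd); lra.
Qed.

Lemma CrZ (l : R[i]) a : Cr F a -> Cr F (l *: a).
Proof.
move=> /CrP ha; apply/CrP => e e0; have l0 := cmod_ge0 l.
have [|c Cc1 hc] := ha (e / (cmod l + 1)); first by rewrite divr_gt0 //; lra.
exists (l *: c); first exact: CcZ.
rewrite -scalerBr; apply: bbd_le (bbdZ l hc).
rewrite mulrA ler_pdivrMr; last by lra.
nra.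
Qed.

Lemma Cr0 : Cr F 0. Proof. exact/Cc_Cr/Cc0. Qed.

Lemma Cr_star a : Cr F a -> Cr F (sect_star a).
Proof.
move=> /CrP ha; apply/CrP => e /ha[c Cc1 hc]; exists (sect_star c); first exact: Cc_star.
by rewrite -sect_starB; exact: bbd_star.
Qed.

Lemma Cr_good a : Cr F a -> good a.
Proof.
move=> /CrP ha; split.
  have [|c /Cc_good[[C cC] _] hc] := ha 1; first exact: ltr01.
  by exists (1 + C); rewrite -[a](subrK c); exact: bbdD.
apply: (ccau_lim hu) => e /ha[c /Cc_good[_ cc] hc]; by exists c.
Qed.

Lemma convolP a b g : good a -> good b -> is_conv a b (convol a b g).
Proof.
move=> [[C aC] _] [_ cb]; have [v hv] := is_conv_ex g aC cb.
by rewrite (convolE hv).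
Qed.

Lemma good_defined a b : good a -> good b -> convol_defined a b.
Proof. by move=> ga gb; apply/convol_definedP => g; exact: convolP. Qed.

Lemma good_bbd_convol a b C D : bbd a C -> bbd b D -> good a -> good b ->
  bbd (convol a b) (C * D).
Proof. by move=> aC bD ga gb; apply: (bbd_convol hu aC bD) => g; exact: convolP. Qed.

Lemma convolDl a a' b : good a -> good a' -> good b ->
  convol (a + a') b = convol a b + convol a' b.
Proof.
move=> ga ga' gb; apply: functional_extensionality_dep => g.
by apply/convolE/is_convDl; exact: convolP.
Qed.

Lemma convolDr a b b' : good a -> good b -> good b' ->
  convol a (b + b') = convol a b + convol a b'.
Proof.
move=> ga ga' gb; apply: functional_extensionality_dep => g.
by apply/convolE/is_convDr; exact: convolP.
Qed.

Lemma convolZl (l : R[i]) a b : good a -> good b -> convol (l *: a) b = l *: convol a b.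
Proof.
move=> ga gb; apply: functional_extensionality_dep => g.
by apply/convolE/is_convZl; exact: convolP.
Qed.

Lemma convolZr (l : R[i]) a b : good a -> good b -> convol a (l *: b) = l *: convol a b.
Proof.
move=> ga gb; apply: functional_extensionality_dep => g.
by apply/convolE/is_convZr; exact: convolP.
Qed.

Lemma convolBl a a' b : good a -> good a' -> good b ->
  convol (a - a') b = convol a b - convol a' b.
Proof.
move=> ga ga' gb; have := convolDl ga (goodZ (-1) ga') gb.
by rewrite (convolZl (-1) ga' gb) !scaleN1r.
Qed.

Lemma convolBr a b b' : good a -> good b -> good b' ->
  convol a (b - b') = convol a b - convol a b'.
Proof.
move=> ga gb gb'; have := convolDr ga gb (goodZ (-1) gb').
by rewrite (convolZr (-1) ga gb') !scaleN1r.
Qed.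

Lemma convol_star a b : good a -> good b ->
  sect_star (convol a b) = convol (sect_star b) (sect_star a).
Proof.
move=> ga gb; apply: functional_extensionality_dep => g.
symmetry; apply: convolE; rewrite sect_starE; apply: is_conv_star.
exact: convolP.
Qed.

Lemma Cr_convol a b : Cr F a -> Cr F b -> Cr F (convol a b).
Proof.
move=> ha hb; have ga := Cr_good ha; have gb := Cr_good hb.
have [[C aC] _] := ga; have [[D bD] _] := gb.
have C0 := bbd_ge0 aC; have D0 := bbd_ge0 bD.
apply: Cr_lim => e e0.
(* With [t] this accuracy, [t <= e], and the error is at most
   [t D + (C + t) t <= t (C + D + e) <= e]. *)
have d0 : 0 < e / (C + D + e + 1) by rewrite divr_gt0 //; lra.
have [c Cc1 hc] := (CrP a).1 ha _ d0; have [d Cd hd] := (CrP b).1 hb _ d0.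
have gc := Cc_good Cc1; have gd := Cc_good Cd.
exists (convol c d).
  by have [f hf Cf] := Cc_convol Cc1 Cd; have [_ ->] := convol_definedI hf; exact: Cc_Cr.
have -> : convol a b - convol c d = convol (a - c) b + convol c (b - d).
  by rewrite convolBl // convolBr //; abel.
have cC : bbd c (C + e / (C + D + e + 1)).
  have E : a - (a - c) = c by abel.
  by have := bbdB hu aC hc; rewrite E.
apply: bbd_le (bbdD hu (good_bbd_convol hc bD (goodB ga gc) gb)
  (good_bbd_convol cC hd gc (goodB gb gd))).
set t := e / _ in d0 *.
have te : t * (C + D + e + 1) = e by rewrite /t divfK // gt_eqF //; lra.
have : t <= e by nra.
nra.
Qed.

End Unital.
End ReducedAlgebra.

(** * The reduced diagonal *)

Section Diagonal.
Variables (R : realType) (G : etaleGroupoidType) (F : fellBundle R G).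
Hypothesis hu : forall x : G, gunits x -> exists e : fib F x, fibre_unit e.
Implicit Types (g h k x y : G) (C D e t : R) (a b c s z : sect F) (K L : set G).

Lemma convolA a b c : good a -> good b -> good c ->
  convol (convol a b) c = convol a (convol b c).
Proof.
move=> ga gb gc; have [[C aC] ca] := ga; have [[D bD] cb] := gb.
apply: functional_extensionality_dep => g.
have abCD := good_bbd_convol hu aC bD ga gb.
have [v hv] := is_conv_ex g abCD gc.2.
rewrite (convolE hv); symmetry; apply: convolE.
by apply: (is_conv_assoc hu aC bD gc.2 _ _ hv) => k; exact: convolP.
Qed.

Lemma convol_dl z a g : sect_supp z `<=` @gunits G ->
  convol z a g = fmulat g (z (rng g)) (a g).
Proof. by move=> zu; apply/convolE/is_conv_diagl. Qed.

Lemma convol_dr z a g : sect_supp z `<=` @gunits G ->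
  convol a z g = fmulat g (a g) (z (src g)).
Proof. by move=> zu; apply/convolE/is_conv_diagr. Qed.

Lemma convol_defined_dl z a : sect_supp z `<=` @gunits G -> convol_defined z a.
Proof.
by move=> zu; apply/convol_definedP => g; rewrite convol_dl //; exact: is_conv_diagl.
Qed.

Lemma convol_defined_dr z a : sect_supp z `<=` @gunits G -> convol_defined a z.
Proof.
by move=> zu; apply/convol_definedP => g; rewrite convol_dr //; exact: is_conv_diagr.
Qed.

Lemma Dr_good z : Dr F z -> good z.
Proof. by move=> [/(Cr_good hu)]. Qed.

Lemma Dr0 : Dr F 0.
Proof. by split; [exact: Cr0 | move=> g]. Qed.

Lemma DrD z w : Dr F z -> Dr F w -> Dr F (z + w).
Proof.
move=> [zC zu] [wC wu]; split; first exact: CrD.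
move=> g zw; apply: contrapT => gu; apply: zw.
have zg : z g = 0 by apply: contrapT => h; apply: gu; exact: zu.
have wg : w g = 0 by apply: contrapT => h; apply: gu; exact: wu.
by rewrite /GRing.add /= zg wg addr0.
Qed.

Lemma DrZ (l : R[i]) z : Dr F z -> Dr F (l *: z).
Proof.
move=> [zC zu]; split; first exact: CrZ.
move=> g zw; apply: zu => zg; apply: zw.
by rewrite /GRing.scale /= /sect_scale zg scaler0.
Qed.

Lemma DrB z w : Dr F z -> Dr F w -> Dr F (z - w).
Proof. by move=> hz hw; have := DrD hz (DrZ (-1) hw); rewrite scaleN1r. Qed.

Lemma Dr_convol z w : Dr F z -> Dr F w -> Dr F (convol z w).
Proof.
move=> [zC zu] [wC wu]; split; first exact: Cr_convol.
move=> g; rewrite /sect_supp /= convol_dl // => zw; apply: wu => wg; apply: zw.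
by rewrite wg fmulat0r // /composable src_unit //; exact: gunits_rng.
Qed.

Lemma sect_star_unit a y : gunits y -> sect_star a y = fstarat y (a y).
Proof. by move=> hy; rewrite sect_starE ginv_unit. Qed.

Lemma Dr_star z : Dr F z -> Dr F (sect_star z).
Proof.
move=> [zC zu]; split; first exact: Cr_star.
move=> g zg; have gu : gunits (ginv g).
  by apply: zu => z0; apply: zg; rewrite sect_starE z0 fstarat0.
by have := ginv_unit gu; rewrite ginvK => E; rewrite E.
Qed.

Lemma convol_unit z w y : sect_supp z `<=` @gunits G -> gunits y ->
  convol z w y = fmulat y (z y) (w y).
Proof.
by move=> zu hy; rewrite convol_dl // rng_unit.
Qed.

Definition ev y (hy : gunits y) a : calg (fibA hu hy) := a y.

Lemma evM y (hy : gunits y) z w : sect_supp z `<=` @gunits G ->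
  ev hy (convol z w) = ev hy z * ev hy w.
Proof. by move=> zu; rewrite /ev convol_unit. Qed.

Definition unit_interval z : Prop := forall y (hy : gunits y),
  cpos (ev hy z) /\ cpos (1 - ev hy z).

(** The constant section 1 need not be diagonal, so [1 - (1 - z)^n] is reached by [w + z - z w],
    which multiplies the complement [1 - w] by [1 - z]. *)
Lemma Dr_pow z : Dr F z -> forall n, exists2 w, Dr F w &
  forall y (hy : gunits y), 1 - ev hy w = (1 - ev hy z) ^+ n.
Proof.
move=> hz; elim=> [|n [w hw E]].
  by exists 0; [exact: Dr0 | move=> y hy; rewrite expr0 /ev subr0].
exists (w + z - convol z w).
  by apply: DrB; [exact: DrD | exact: Dr_convol].
move=> y hy; rewrite exprS -E.
have -> : ev hy (w + z - convol z w) = ev hy w + ev hy z - ev hy z * ev hy w.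
  by rewrite -evM //; case: hz.
by rewrite mulrBr mulr1 mulrBl mul1r; abel.
Qed.

Lemma unit_interval_pow z w n : unit_interval z ->
  (forall y (hy : gunits y), 1 - ev hy w = (1 - ev hy z) ^+ n) -> unit_interval w.
Proof.
move=> hz E y hy; have [zp zp'] := hz y hy.
have xp : cpos (1 - ev hy z) by [].
split; last by rewrite E; exact: cposX.
have -> : ev hy w = 1 - (1 - ev hy z) ^+ n by rewrite -E; abel.
rewrite -{1}(crs1 (fibA hu hy)); apply: cpos_crsB; first exact: (cpos_sa (cposX n xp)).
apply: cpos_le => //; first exact: cposX.
rewrite crs1; elim: n {E} => [|n IH]; first by rewrite expr0 subrr; exact: cpos0.
have -> : 1 - (1 - ev hy z) ^+ n.+1 =
   (1 - (1 - ev hy z) ^+ n) + ev hy z * (1 - ev hy z) ^+ n.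
  by rewrite exprS mulrBl mul1r; abel.
apply: cposD => //; apply: cposM => //; first exact: cposX.
by apply: commrX; apply: commrB; [exact: commr1|].
Qed.

Lemma unit_interval_norm z y (hy : gunits y) : unit_interval z -> vnorm (z y) <= 1.
Proof.
move=> /(_ y hy)[zp zp']; apply: (@cpos_le _ _ (fibA hu hy) (ev hy z)) => //.
by rewrite crs1.
Qed.

Lemma diag_bbd z C : 0 <= C -> sect_supp z `<=` @gunits G ->
  (forall y, gunits y -> vnorm (z y) <= C) -> bbd z C.
Proof.
move=> C0 zu zC; apply: (slice_bbd hu (slice_units G) zu C0) => g.
have [gu|gu] := pselect (gunits g); first exact: zC.
have -> : z g = 0 by apply: contrapT => zg; apply: gu; exact: zu.
by rewrite vnorm0.
Qed.

Lemma unit_interval_bbd z : Dr F z -> unit_interval z -> bbd z 1.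
Proof.
by move=> [_ zu] hz; apply: diag_bbd => // y hy; exact: unit_interval_norm.
Qed.

Lemma exp_small (q e : R) : 0 <= q -> q < 1 -> 0 < e -> exists n, q ^+ n <= e.
Proof.
move=> q0 q1 e0; have : `|q| < 1 by rewrite ger0_norm.
move=> /cvg_expr /cvgr0_norm_le /(_ _ e0) [n _ /(_ n (leqnn n))] /=.
by rewrite ger0_norm ?exprn_ge0 //; exists n.
Qed.

Section UnitFull.
Hypothesis uf : unit_full F.

Lemma Dr_unit_ex x : gunits x -> exists2 d, Dr F d & fibre_unit (d x).
Proof. exact: uf. Qed.

Lemma fibre_unit_fone y (hy : gunits y) (u : fib F y) : fibre_unit u -> u = fone hu hy.
Proof.
move=> uu; have ru := rng_unit hy; have su := src_unit hy.
by rewrite -[LHS](fibre_unitr (e := fone hu hy) u hy (foneP hu hy) su) (fibre_unitl _ hy uu).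
Qed.

Lemma Dr_starM_pos d y (hy : gunits y) : Dr F d -> cpos (ev hy (convol (sect_star d) d)).
Proof.
move=> hd; have [_ du] := Dr_star hd.
rewrite (evM hy _ du) /ev sect_star_unit //; exact: cpos_starM.
Qed.

(** The sum of [d_x^* d_x] over the listed units [x]: positive everywhere, and its term for [x] is 1
    at [x]. The [d_x] themselves need not be positive. *)
Lemma Dr_sum_ex (s : seq G) : {in s, forall y, gunits y} -> exists w, [/\ Dr F w,
  forall y (hy : gunits y), cpos (ev hy w) &
  forall y (hy : gunits y), y \in s -> cpos (ev hy w - 1)].
Proof.
elim: s => [|x s IH] hs.
  by exists 0; split => //; [exact: Dr0 | move=> y hy; exact: cpos0].
have [|w [hw wp ws]] := IH; first by move=> y ys; apply: hs; rewrite inE ys orbT.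
have hx : gunits x by apply: hs; rewrite mem_head.
have [d hd dx] := Dr_unit_ex hx.
exists (w + convol (sect_star d) d); split.
- by apply: DrD => //; apply: Dr_convol => //; exact: Dr_star.
- by move=> y hy; apply: (cposD (wp y hy)); exact: Dr_starM_pos.
move=> y hy; rewrite inE => /orP[/eqP E|ys].
  subst y; have [_ du] := Dr_star hd.
  have -> : ev hy (w + convol (sect_star d) d) - 1 = ev hy w.
    have -> : ev hy (w + convol (sect_star d) d) = ev hy w + ev hy (sect_star d) * ev hy d.
      by rewrite -evM.
    have -> : ev hy d = 1 by exact: fibre_unit_fone.
    have -> : ev hy (sect_star d) = 1.
      rewrite /ev sect_star_unit // (fibre_unit_fone hy dx).
      exact: (cstar1 (fibA hu hy)).
    by rewrite mulr1 addrK.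
  exact: wp.
have -> : ev hy (w + convol (sect_star d) d) - 1 =
   (ev hy w - 1) + ev hy (convol (sect_star d) d).
  by rewrite addrAC.
by apply: cposD; [exact: ws | exact: Dr_starM_pos].
Qed.

Lemma local_unit (s : seq G) e : {in s, forall y, gunits y} -> 0 < e ->
  exists z, [/\ Dr F z, unit_interval z &
    forall y (hy : gunits y), y \in s -> vnorm (1 - ev hy z : fib F y) <= e].
Proof.
move=> hs e0; have [w [hw wp ws]] := Dr_sum_ex hs.
have [[C wC] _] := Dr_good hw; have C0 := bbd_ge0 wC.
(* Dividing [w] by [M] brings it into [0, 1] and leaves at least [1 / M] at the listed units, where
   [1 - T] then has powers tending to 0. *)
pose M := C + 1; have M0 : 0 < M by rewrite /M; lra.
have MV : 0 <= M^-1 by rewrite invr_ge0 ltW.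
have MV1 : M^-1 <= 1 by rewrite invf_le1 // /M; lra.
pose T : sect F := (M^-1)%:C *: w.
have hT : Dr F T by exact: DrZ.
have TE y (hy : gunits y) : ev hy T = (M^-1)%:C *: ev hy w by [].
have Tu : unit_interval T.
  move=> y hy; split; first by rewrite TE; apply: cposZ => //; exact: wp.
  rewrite -(crs1 (fibA hu hy)); apply: cpos_crsB.
    by rewrite TE; apply: csaZ; apply: cpos_sa; exact: wp.
  rewrite TE cnormZ ger0_norm // mulrC ler_pdivrMr // mul1r.
  apply: le_trans (bbd_vnorm hu y wC) _; rewrite /M; lra.
have [n hn] : exists n, (1 - M^-1) ^+ n <= e.
  by apply: exp_small => //; [lra | rewrite ltrBlDr ltrDl invr_gt0].
have [z hz zE] := Dr_pow hT n.
exists z; split => //; first exact: unit_interval_pow zE.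
move=> y hy ys; rewrite zE; apply: le_trans hn.
have Tn : cnorm (1 - ev hy T) <= 1 - M^-1.
  apply: cpos_le; [lra | by case: (Tu y hy)|].
  have -> : crs (fibA hu hy) (1 - M^-1) - (1 - ev hy T) =
     (M^-1)%:C *: (ev hy w - 1).
    by rewrite TE crsB crs1 scalerBr; abel.
  by apply: cposZ => //; exact: ws.
change (cnorm ((1 - ev hy T) ^+ n) <= (1 - M^-1) ^+ n); elim: n {zE} => [|n IH].
  by rewrite !expr0 cnorm1_le1.
rewrite !exprS; apply: le_trans (cnormM _ _) _.
by apply: ler_pM => //; exact: cnorm_ge0.
Qed.

End UnitFull.

Lemma fip_star x g (u : fib F g) (v : fib F (ginv g)) :
  fip x (fstarat (ginv g) u) v = fmulat x u v.
Proof.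
by rewrite /fip ginvK fstaratK.
Qed.

(* [(1 - s s^* / N)^n s -> 0]. *)
Lemma Csect_approx K s e : bicompact K -> Csect F K s -> 0 < e ->
  exists2 z, Dr F z & bbd (s - convol z s) e.
Proof.
move=> bK Ks e0; have sK : slice K by exact: bicompact_slice.
have [sKs cs] := Ks; have [_ cK _] := bK.
have [C C0 hC] := compact_bounded cK Ks.
have [c hc cKL] := Csect_convol bK (bicompact_ginv bK) Ks (Csect_star Ks).
have cu : sect_supp c `<=` @gunits G.
  move=> k /(cKL.1) [g [_ [Kg [h Kh <-] gh <-]]].
  have E : g = h.
    case: sK => Ksrc _; apply: Ksrc; rewrite ?mem_set //.
    by move: gh; rewrite /composable rng_inv.
  by rewrite E; exact: gunits_rng.
have hcD : Dr F c.
  by split => //; exact: (Cc_Cr hu (Csect_Cc (bicompact_gprod bK (bicompact_ginv bK)) cKL)).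
have cg g : K g -> c (rng g) = fmulat (rng g) (s g) (fstarat (ginv g) (s g)).
  move=> Kg; apply: is_conv_unique (hc (rng g)) _.
  have := @slice_is_conv _ _ F (@ginv G @` K) s (sect_star s) (rng g) (ginv g)
    (slice_ginv sK) (Csect_star Ks).1.
  rewrite sect_starV => H; have gg : gdiv (rng g) (ginv g) = g.
    by rewrite /gdiv ginvK rng_gmul.
  rewrite gg in H; apply: H; first by exists g.
  by rewrite src_inv src_unit //; exact: gunits_rng.
have c0 y : ~ (@rng G @` K) y -> c y = 0.
  move=> ny; apply: contrapT => cy; have [g [_ [Kg [h Kh <-] gh E]]] := cKL.1 _ cy.
  by apply: ny; exists g => //; rewrite -(rng_mul gh) E; apply: rng_unit; exact: cu.
have cpy y (hy : gunits y) : cpos (ev hy c) /\ vnorm (c y) <= C ^+ 2.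
  have [[g Kg gy]|/c0 cy0] := pselect ((@rng G @` K) y); last first.
    rewrite /ev cy0 vnorm0; split; [exact: cpos0 | exact: sqr_ge0].
  subst y; have sg : src (ginv g) = rng g by exact: src_inv.
  rewrite /ev (cg g Kg) -fip_star; split; first exact/fposP/fpos_fip.
  by rewrite vnorm_fip // vnorm_fstarat // ler_pXn2r ?nnegrE ?vnorm_ge0.
pose M := C ^+ 2 + 1; have M0 : 0 < M by rewrite /M; have := sqr_ge0 C; lra.
have MV : 0 <= M^-1 by rewrite invr_ge0 ltW.
pose T : sect F := (M^-1)%:C *: c.
have hT : Dr F T by exact: DrZ.
have TE y (hy : gunits y) : ev hy T = (M^-1)%:C *: ev hy c by [].
have cT y (hy : gunits y) : ev hy c = M%:C *: ev hy T.
  by rewrite TE scalerA -rmorphM mulfV ?scale1r // gt_eqF.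
have Tu : unit_interval T.
  move=> y hy; have [cp cn] := cpy y hy.
  split; first by rewrite TE; exact: cposZ.
  rewrite -(crs1 (fibA hu hy)); apply: cpos_crsB.
    by rewrite TE; apply: csaZ; exact: cpos_sa.
  rewrite TE cnormZ ger0_norm // mulrC ler_pdivrMr // mul1r.
  by apply: le_trans cn _; rewrite /M lerDl.
(* The target is [e^2] because the square of the norm of [(1 - z) s] is what gets estimated. *)
have [n hn] := exists_inv_le M (exprn_gt0 2 e0).
have [z hz zE] := Dr_pow hT n.
exists z => //; have [_ zu] := hz.
have sz g : (s - convol z s) g = s g - fmulat g (z (rng g)) (s g).
  by rewrite -convol_dl.
have s0 g : ~ K g -> s g = 0.
  by move=> nK; apply: contrapT => sg; apply: nK; exact: sKs.
have cmp g : composable (rng g) g.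
  by rewrite /composable src_unit //; exact: gunits_rng.
apply: (slice_bbd hu sK) => [g sg||g]; last 1 first.
rewrite sz; have [Kg|/s0 ->] := pselect (K g); last first.
  by rewrite fmulat0r ?subr0 ?vnorm0 ?ltW.
have hy := gunits_rng g; set y := rng g in hy *.
have yy := unit_comp hy; have myy := gmul_unit hy; have vyy := ginv_unit hy.
have yg : gmul y g = g by exact: rng_gmul.
have cyg : composable y g := cmp g.
have cgV : composable g (ginv g) by exact: composableV.
pose q : fib F y := fone hu hy - z y.
have -> : s g - fmulat g (z y) (s g) = fmulat g q (s g).
  by rewrite /q (fmulatBl _ _ _ _ (cmp g)) (fibre_unitl _ hy (foneP hu hy)).
rewrite -(ler_pXn2r (n := 2)) ?nnegrE ?vnorm_ge0 ?(ltW e0) //.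
apply: le_trans hn.
(* Squaring as [v v^*] rather than [v^* v] moves the computation to the range [y], where [s s^*]
   becomes [c(y)]. *)
rewrite -(vnorm_fstarat (h := ginv g) _ erefl) -(vnorm_fip (x := y)) ?src_inv //.
rewrite fip_star (@fstaratM _ _ _ _ (ginv g) y) //.
have -> : fmulat y (fmulat g q (s g)) (fmulat (ginv g) (fstarat (ginv g) (s g)) (fstarat y q))
   = fmulat y q (fmulat y (c y) (fstarat y q)).
  have gy : gmul (ginv g) y = ginv g by rewrite /y -src_inv gmul_src.
  have cgy : composable (ginv g) y by rewrite /composable src_inv (rng_unit hy).
  rewrite (@fmulatA _ _ _ g y) // -(@fmulatA _ _ _ y (ginv g)) //.
  by rewrite [c y](cg g Kg).
pose Q : calg (fibA hu hy) := 1 - ev hy z.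
have Qsa : cstar Q = Q.
  by rewrite /Q zE; apply: csaX; apply: csaB; [exact: csa1 | exact: (cpos_sa (Tu y hy).1)].
have -> : fstarat y q = q by exact: Qsa.
change (cnorm (Q * (ev hy c * Q)) <= M / n.+1%:R).
have [Tp Tp'] := Tu y hy.
have cTQ : GRing.comm (ev hy T) (1 - ev hy T) by apply: commrB; [exact: commr1|].
(* [c = M T] commutes with [Q = (1 - T)^n]. The resulting bound [1 / (2n + 1)] is then weakened to
   [1 / (n + 1)]. *)
have -> : Q * (ev hy c * Q) = M%:C *: (ev hy T * (1 - ev hy T) ^+ (n + n)).
  rewrite cT -cscaleAl -cscaleAr; congr (_ *: _).
  by rewrite /Q zE mulrA -(commrX n cTQ) -mulrA -exprD.
rewrite cnormZ ger0_norm ?(ltW M0) // ler_pM2l //.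
apply: le_trans (cnorm_mul_pow _ Tp Tp') _.
by rewrite lef_pV2 ?posrE ?ltr0n // ler_nat ltnS leq_addr.
  apply: contrapT => nK; apply: sg.
  by rewrite sz s0 // fmulat0r ?subr0.
exact: ltW.
Qed.

End Diagonal.

(** * Multipliers *)

Section Boundedness.
Variables (R : realType) (G : etaleGroupoidType) (F : fellBundle R G).
Hypothesis hu : forall x : G, gunits x -> exists e : fib F x, fibre_unit e.
Implicit Types (g h x y : G) (C D e t : R) (a b c f m s z : sect F) (E H K : {fset G}).

Lemma nn_mull x H f (w : forall y, fib F y) C : gunits x -> over x H -> 0 <= C ->
  {in H, forall h, vnorm (w (rng h)) <= C} ->
  nn x H (fun h => fmulat h (w (rng h)) (f h)) <= C * nn x H f.
Proof.
move=> hx oH C0 wC.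
rewrite -(ler_pXn2r (n := 2)) ?nnegrE ?mulr_ge0 ?nn_ge0 // exprMn !nn_sqr.
have -> : C ^+ 2 * vnorm (vip x H f f) = vnorm ((C ^+ 2)%:C *: vip x H f f).
  by rewrite vnormZr ger0_norm // sqr_ge0.
apply: (@fpos_mono _ _ _ hu).
  by apply: fpos_sum => // h hH; apply: fpos_fip => //; exact: oH.
rewrite /vip scaler_sumr -sumrB; apply: fpos_sum => // h hH.
apply: (fip_contract hu) => //.
- exact: oH.
- by rewrite /composable src_unit //; exact: gunits_rng.
- exact: rng_gmul.
- exact: wC.
Qed.

Lemma apply_at_convol_dr x H m z f g : over x H -> src g = x ->
  sect_supp z `<=` @gunits G ->
  apply_at (convol m z) H f g = apply_at m H (fun h => fmulat h (z (rng h)) (f h)) g.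
Proof.
move=> oH gx zu; rewrite /apply_at !big_seq; apply: eq_bigr => h hH.
have gh : src g = src h by rewrite gx (oH _ hH).
have hy := gunits_rng h.
have ch : composable (rng h) h by rewrite /composable src_unit.
rewrite (convol_dr _ _ zu) (src_div gh).
have cd : composable (gdiv g h) (rng h) by rewrite /composable (src_div gh) (rng_unit hy).
have e1 : gmul (gdiv g h) (rng h) = gdiv g h by rewrite -(src_div gh) gmul_src.
by rewrite (fmulatA _ _ _ _ cd ch e1 (rng_gmul h)).
Qed.

Section GeometricSum.
Variable d : nat -> sect F.
Hypotheses (dD : forall n, Dr F (d n)) (du : forall n, unit_interval hu (d n)).
Local Notation q n := (2^-1 ^+ n : R).

Definition geo n : sect F := \sum_(j < n) (q j)%:C *: d j.

Lemma q_gt0 n : 0 < q n. Proof. by rewrite exprn_gt0 // invr_gt0. Qed.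

Lemma geoS n : geo n.+1 = geo n + (q n)%:C *: d n.
Proof. by rewrite /geo big_ord_recr. Qed.

Lemma geo_Dr n : Dr F (geo n).
Proof.
elim: n => [|n IH]; first by rewrite /geo big_ord0; exact: Dr0.
by rewrite geoS; apply: DrD => //; exact: DrZ.
Qed.

Lemma d_vnorm n g : vnorm (d n g) <= 1.
Proof. by apply: (bbd_vnorm hu); exact: unit_interval_bbd. Qed.

Lemma geo_dist n (k : nat) g : vnorm (geo (n + k) g - geo n g) <= 2 * q n - 2 * q (n + k).
Proof.
elim: k => [|k IH]; first by rewrite addn0 !subrr vnorm0.
rewrite addnS geoS.
have -> : (geo (n + k) + (q (n + k))%:C *: d (n + k)%N) g - geo n g =
   (geo (n + k) g - geo n g) + (q (n + k))%:C *: d (n + k)%N g by rewrite addrAC.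
apply: le_trans (vnormD _ _) _.
rewrite vnormZr ger0_norm ?(ltW (q_gt0 _)) // exprS.
by have := d_vnorm (n + k) g; have := q_gt0 (n + k); nra.
Qed.

Lemma geo_dist_le n p g : (n <= p)%N -> vnorm (geo p g - geo n g) <= 2 * q n.
Proof.
move=> np; have := geo_dist n (p - n) g; rewrite subnKC //.
by have := q_gt0 p; lra.
Qed.

Lemma q_small e : 0 < e -> exists n, 2 * q n <= e.
Proof.
move=> e0; have [|||n hn] := @exp_small R 2^-1 (e / 2).
- by rewrite invr_ge0.
- by rewrite invf_lt1 // ltr1n.
- by rewrite divr_gt0.
by exists n; move: hn; lra.
Qed.

Lemma geo_lim_ex g : exists l, forall n, vnorm (l - geo n g) <= 2 * q n.
Proof.
have [|l hl] := @vnorm_complete R (fib F g) (fun n => geo n g).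
  move=> e e0; have [|n hn] := @q_small (e / 2); first by lra.
  exists n => p r np nr.
  have -> : geo p g - geo r g = (geo p g - geo n g) - (geo r g - geo n g) by abel.
  apply: le_trans (vnormB _ _) _.
  by have := geo_dist_le g np; have := geo_dist_le g nr; lra.
exists l => n; apply/ler_addgt0Pl => e e0; have [k hk] := hl e e0.
have -> : l - geo n g = (geo (maxn n k) g - geo n g) - (geo (maxn n k) g - l) by abel.
apply: le_trans (vnormB _ _) _.
have := geo_dist_le g (leq_maxl n k); have := hk _ (leq_maxr n k); lra.
Qed.

Definition geo_lim : sect F := fun g => projT1 (cid (geo_lim_ex g)).

Lemma geo_limP n g : vnorm (geo_lim g - geo n g) <= 2 * q n.
Proof. exact: (projT2 (cid (geo_lim_ex g))). Qed.

Lemma geo_lim_Dr : Dr F geo_lim.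
Proof.
have su : sect_supp geo_lim `<=` @gunits G.
  move=> g zg; apply: contrapT => gu; apply: zg; apply: vnorm_le0 => e /q_small[n hn].
  apply: le_trans hn; have := geo_limP n g.
  have -> : geo n g = 0 by apply: contrapT => h; apply: gu; case: (geo_Dr n) => _; exact.
  by rewrite subr0.
split=> //; apply: (Cr_lim hu) => e /q_small[n hn].
exists (geo n); first by case: (geo_Dr n).
apply: bbd_le hn _; apply: (diag_bbd hu).
- by rewrite mulr_ge0 // ltW // q_gt0.
- move=> g zg; apply: contrapT => gu; apply: zg.
  have zg : geo_lim g = 0 by apply: contrapT => h; apply: gu; exact: su.
  have sg : geo n g = 0 by apply: contrapT => h; apply: gu; case: (geo_Dr n) => _; exact.
  by rewrite /GRing.add /GRing.opp /= zg sg subr0.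
- by move=> y _; exact: geo_limP.
Qed.

(** All terms of the series are positive, so it dominates its [n]-th term [q n * d n], and [d n] is
    at least 1/2 at [y]. *)
Lemma geo_lim_ge n y (hy : gunits y) : vnorm (1 - ev hu hy (d n) : fib F y) <= 2^-1 ->
  cpos (ev hu hy geo_lim - crs (fibA hu hy) (q n / 2)).
Proof.
move=> dn.
have gp k : cpos (ev hu hy (geo k)).
  elim: k => [|k IH]; first by rewrite /geo big_ord0; exact: cpos0.
  rewrite geoS; apply: (cposD IH); apply: cposZ; first exact/ltW/q_gt0.
  by case: (du k hy).
have gn k : cpos (ev hu hy (geo (n.+1 + k)) - (q n)%:C *: ev hu hy (d n)).
  elim: k => [|k IH].
    rewrite addn0 geoS.
    have -> : ev hu hy (geo n + (q n)%:C *: d n) - (q n)%:C *: ev hu hy (d n) =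
      ev hu hy (geo n) by exact: addrK.
    exact: gp.
  rewrite addnS geoS.
  have -> : ev hu hy (geo (n.+1 + k) + (q (n.+1 + k))%:C *: d (n.+1 + k)%N)
     - (q n)%:C *: ev hu hy (d n) =
     (ev hu hy (geo (n.+1 + k)) - (q n)%:C *: ev hu hy (d n)) +
     (q (n.+1 + k))%:C *: ev hu hy (d (n.+1 + k)%N) by exact: addrAC.
  apply: (cposD IH); apply: cposZ; first exact/ltW/q_gt0.
  by case: (du (n.+1 + k) hy).
have dp : cpos ((q n)%:C *: ev hu hy (d n) - crs (fibA hu hy) (q n / 2)).
  have -> : (q n)%:C *: ev hu hy (d n) - crs (fibA hu hy) (q n / 2) =
    (q n)%:C *: (crs (fibA hu hy) (2^-1) - (1 - ev hu hy (d n))).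
    have E : crs (fibA hu hy) (2^-1) + crs (fibA hu hy) (2^-1) = 1.
      by rewrite -crsD -(crs1 (fibA hu hy)); congr crs; field.
    rewrite -E [crs _ (q n / 2)]crsM crs_mull -scalerBr; congr (_ *: _); abel.
  apply: cposZ; first exact/ltW/q_gt0.
  apply: cpos_crsB => //; apply: csaB; first exact: csa1.
  by apply: cpos_sa; case: (du n hy).
apply: cpos_lim => e /q_small[k hk].
exists (ev hu hy (geo (n.+1 + k)) - crs (fibA hu hy) (q n / 2)).
  have -> : ev hu hy (geo (n.+1 + k)) - crs (fibA hu hy) (q n / 2) =
    (ev hu hy (geo (n.+1 + k)) - (q n)%:C *: ev hu hy (d n)) +
    ((q n)%:C *: ev hu hy (d n) - crs (fibA hu hy) (q n / 2)) by abel.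
  exact: cposD.
have -> : ev hu hy geo_lim - crs (fibA hu hy) (q n / 2) -
  (ev hu hy (geo (n.+1 + k)) - crs (fibA hu hy) (q n / 2)) =
  ev hu hy geo_lim - ev hu hy (geo (n.+1 + k)) by abel.
apply: le_trans hk; apply: le_trans (geo_limP (n.+1 + k) y) _.
rewrite ler_pM2l // exprD; have := q_gt0 k; have := q_gt0 n.+1.
have : q n.+1 <= 1 by rewrite exprn_ile1 // ?invr_ge0 // invf_le1 // ler1n.
nra.
Qed.

End GeometricSum.

(* Gliding hump: otherwise some [z] in the diagonal has [m z] unbounded. *)
Lemma multiplier_bounded m : unit_full F -> (forall z, Dr F z -> Cr F (convol m z)) ->
  exists C, bbd m C.
Proof.
move=> uf mz; apply: contrapT => nob.
pose q n := (2^-1 ^+ n : R).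
(* [p] is [(x, E, H, f, z)]: a block on which [m] exceeds [n] times [2 / q n], and a local unit [z]
   for the ranges of [H]. The factor [2 / q n] pays in advance for inverting the weighted sum of
   these local units. *)
have hump n : exists p : G * {fset G} * {fset G} * sect F * sect F,
    [/\ gunits p.1.1.1.1, over p.1.1.1.1 p.1.1.1.2, over p.1.1.1.1 p.1.1.2,
       n%:R * (q n / 2)^-1 * nn p.1.1.1.1 p.1.1.2 p.1.2 <
         nn p.1.1.1.1 p.1.1.1.2 (apply_at m p.1.1.2 p.1.2) &
       [/\ Dr F p.2, unit_interval hu p.2 &
         forall y (hy : gunits y), y \in [seq rng h | h <- p.1.1.2] ->
           vnorm (1 - ev hu hy p.2 : fib F y) <= 2^-1]].
  apply: contrapT => np; apply: nob; exists (n%:R * (q n / 2)^-1); split.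
    by rewrite mulr_ge0 // invr_ge0 divr_ge0 // ltW // q_gt0.
  move=> x E H f hx oE oH; rewrite leNgt; apply/negP => lt.
  have [||z [hz uz ez]] := @local_unit _ _ _ hu uf [seq rng h | h <- H] (2^-1).
  - by move=> y /mapP[h _ ->]; exact: gunits_rng.
  - by rewrite invr_gt0.
  by apply: np; exists (x, E, H, f, z).
have {hump} [p hp] := choice hump.
pose d n := (p n).2.
have dD n : Dr F (d n) by case: (hp n) => _ _ _ _ [].
have du n : unit_interval hu (d n) by case: (hp n) => _ _ _ _ [].
pose z := geo_lim dD du; have hz : Dr F z by exact: geo_lim_Dr.
have [[D mzD] _] := Cr_good hu (mz z hz).
have D0 := bbd_ge0 mzD.
pose n := (archimedean.Num.truncn D).+1.
have Dn : D < n%:R by rewrite -archimedean.Num.Theory.truncn_le_nat.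
have := hp n; set x := (p n).1.1.1.1; set E := (p n).1.1.1.2.
set H := (p n).1.1.2; set f := (p n).1.2 => -[hx oE oH lt [_ _ dH]].
pose t := q n / 2; have t0 : 0 < t by rewrite divr_gt0 // q_gt0.
have inv h : h \in H -> exists w : fib F (rng h),
    fmulat (rng h) (z (rng h)) w = fone hu (gunits_rng h) /\ vnorm w <= t^-1.
  move=> hH; have hy := gunits_rng h.
  have zp : cpos (ev hu (gunits_rng h) z - crs (fibA hu (gunits_rng h)) t).
    by apply: geo_lim_ge; apply: dH; apply/mapP; exists h.
  have zsa : csa (ev hu (gunits_rng h) z).
    rewrite -[ev _ _ _](subrK (crs (fibA hu (gunits_rng h)) t)).
    by apply: csaD; [exact: cpos_sa | exact: csa_crs].
  exact: (inverse_ex zsa t0 zp).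
(* The inverse of [z] at the ranges of [H], with default 0 elsewhere. *)
pose W y : fib F y :=
  match pselect (exists w : fib F y, (exists hy : gunits y,
      fmulat y (z y) w = fone hu hy) /\ vnorm w <= t^-1) with
  | left h => projT1 (cid h)
  | right _ => 0
  end.
have WP h : h \in H -> fmulat (rng h) (z (rng h)) (W (rng h)) = fone hu (gunits_rng h) /\
    vnorm (W (rng h)) <= t^-1.
  move=> hH; rewrite /W; case: pselect => [h'|[]].
    case: (cid h') => w /= [[hy zw] wt]; split => //.
    by rewrite zw (Prop_irrelevance hy (gunits_rng h)).
  have [w [zw wt]] := inv h hH; exists w; split => //.
  by exists (gunits_rng h).
pose f' : sect F := fun h => fmulat h (W (rng h)) (f h).
(* [m f = (m z) (z^-1 f)], so on this block [m] is bounded by [D / t], while the hump exceeds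
   [n / t] with [n > D]. *)
have ff' : nn x E (apply_at m H f) = nn x E (apply_at (convol m z) H f').
  apply: eq_nn => g gE; rewrite (apply_at_convol_dr _ _ oH (oE _ gE) hz.2).
  apply: eq_apply_at => h hH; rewrite /f'.
  have [zW _] := WP h hH; have hy := gunits_rng h.
  have ch : composable (rng h) h by rewrite /composable src_unit.
  rewrite -(fmulatA _ _ _ _ (unit_comp hy) ch (gmul_unit hy) (rng_gmul h)) zW.
  by rewrite fibre_unitl //; exact: foneP.
have := nn_ge0 x H f; move: lt; rewrite ff' -/t.
have : nn x E (apply_at (convol m z) H f') <= D * (t^-1 * nn x H f).
  case: mzD => _ h; apply: le_trans (h _ _ _ _ hx oE oH) _.
  rewrite ler_wpM2l //; apply: nn_mull => //; first by rewrite invr_ge0 ltW.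
  by move=> h' /WP[].
move=> h1 h2 h3.
have := le_lt_trans (le_refl _) (lt_le_trans h2 h1).
rewrite mulrA ltNge => /negP; apply.
by rewrite ler_wpM2r // ler_wpM2r ?ltW // ?invr_gt0.
Qed.

End Boundedness.

(** * The algebra of multipliers *)

Section Multipliers.
Variables (R : realType) (G : etaleGroupoidType) (F : fellBundle R G).
Hypothesis uf : unit_full F.
Implicit Types (g h x y : G) (C D e t : R) (a b c f m n s z : sect F) (E H K : {fset G}).
Local Notation M := (rho_multipliers F).

Lemma units_ex x : gunits x -> exists e : fib F x, fibre_unit e.
Proof. by move=> /uf[d _ du]; exists (d x). Qed.
Let hu := units_ex.

Lemma multiplierI m : (forall z, Dr F z -> Cr F (convol z m) /\ Cr F (convol m z)) -> M m.
Proof.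
move=> h z hz; have [h1 h2] := h z hz; have [_ zu] := hz; split => //.
  exact: convol_defined_dl.
exact: convol_defined_dr.
Qed.

Lemma multiplier_l m z : M m -> Dr F z -> Cr F (convol z m).
Proof. by move=> hm /hm[]. Qed.

Lemma multiplier_r m z : M m -> Dr F z -> Cr F (convol m z).
Proof. by move=> hm /hm[]. Qed.

Lemma unit_convolr a z g : Dr F z -> fibre_unit (z (src g)) -> convol a z g = a g.
Proof.
by move=> [_ zu] ze; rewrite convol_dr // fibre_unitr //; exact: gunits_src.
Qed.

Lemma unit_convoll a z g : Dr F z -> fibre_unit (z (rng g)) -> convol z a g = a g.
Proof.
by move=> [_ zu] ze; rewrite convol_dl // fibre_unitl //; exact: gunits_rng.
Qed.

Lemma multiplier_good m : M m -> good m.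
Proof.
move=> hm; split.
  by apply: (multiplier_bounded hu uf) => z; exact: multiplier_r.
apply: ccau_local => x hx; have [z hz ze] := Dr_unit_ex uf hx.
exists (convol m z); first by have [] := Cr_good hu (multiplier_r hm hz).
by move=> g gx; rewrite unit_convolr // gx.
Qed.

Lemma multiplier_star m : M m -> M (sect_star m).
Proof.
move=> hm; have gm := multiplier_good hm; apply: multiplierI => z hz.
have hz' := Dr_star hu hz; have gz' := Dr_good hu hz'.
rewrite -(sect_starK z); split.
  by rewrite -(convol_star gm gz'); apply: (Cr_star hu); exact: multiplier_r.
by rewrite -(convol_star gz' gm); apply: (Cr_star hu); exact: multiplier_l.
Qed.

Lemma multiplier_linear (l : R[i]) m n : M m -> M n -> M (l *: m + n).
Proof.
move=> hm hn; have gm := multiplier_good hm; have gn := multiplier_good hn.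
apply: multiplierI => z hz; have gz := Dr_good hu hz; have glm := goodZ l gm.
split.
  rewrite (convolDr gz glm gn) (convolZr l gz gm).
  by apply: (CrD hu); [apply: (CrZ hu)|]; exact: multiplier_l.
rewrite (convolDl glm gn gz) (convolZl l gm gz).
by apply: (CrD hu); [apply: (CrZ hu)|]; exact: multiplier_r.
Qed.

(** For [s] on a bicompact set, [m s] is a limit of [m (z s) = (m z) s], where [m z] lies in [Cr] by
    definition. The bound of [m] justifies both this limit and the passage to the closure. *)
Lemma Cr_multl m a : M m -> Cr F a -> Cr F (convol m a).
Proof.
move=> hm ha; have gm := multiplier_good hm; have [[C mC] _] := gm.
have C0 := bbd_ge0 mC.
have small e : 0 < e -> 0 < e / (C + 1) /\ C * (e / (C + 1)) <= e.
  move=> e0; have C1 : 0 < C + 1 by lra.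
  split; first by rewrite divr_gt0.
  by rewrite mulrA ler_pdivrMr //; nra.
apply: (Cr_lim hu) => e e0; have [d0 de] := small e e0.
have [c hc ac] := (CrP hu a).1 ha _ d0.
have ga := Cr_good hu ha; have gc := Cc_good hu hc.
exists (convol m c); last first.
  rewrite -(convolBr gm ga gc); apply: bbd_le de _.
  exact: (good_bbd_convol hu mC ac gm (goodB hu ga gc)).
(* [good] is carried through the induction because additivity of the convolution requires it. *)
suff [] : Cr F (convol m c) /\ good c by [].
move: c hc {ac gc}; apply: (@Cc_ind _ _ F (fun c => Cr F (convol m c) /\ good c)).
- have g0 : good (0 : sect F) by exact: (Cr_good hu (Cr0 hu)).
  split; last exact: g0.
  by have := convolZr 0 gm g0; rewrite !scale0r => ->; exact: (Cr0 hu).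
- move=> a1 b1 [h1 g1] [h2 g2]; split; last exact: (goodD hu).
  by rewrite (convolDr gm g1 g2); exact: (CrD hu).
- move=> l a1 [h1 g1]; split; last exact: goodZ.
  by rewrite (convolZr l gm g1); exact: (CrZ hu).
move=> K s bK Ks; have gs := Cc_good hu (Csect_Cc bK Ks); split; last exact: gs.
apply: (Cr_lim hu) => r r0; have [t0 tr] := small r r0.
have [z hz zs] := Csect_approx hu bK Ks t0.
have gz := Dr_good hu hz.
have sC : Cr F s := Cc_Cr hu (Csect_Cc bK Ks).
have gzs : good (convol z s) by apply: (Cr_good hu); apply: (Cr_convol hu); [case: hz | exact: sC].
exists (convol m (convol z s)).
  by rewrite -(convolA hu gm gz gs); apply: (Cr_convol hu); [exact: multiplier_r | exact: sC].
rewrite -(convolBr gm gs gzs); apply: bbd_le tr _.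
exact: (good_bbd_convol hu mC zs gm (goodB hu gs gzs)).
Qed.

Lemma Cr_multr m a : M m -> Cr F a -> Cr F (convol a m).
Proof.
move=> hm ha; have gm := multiplier_good (multiplier_star hm).
have ga := Cr_good hu (Cr_star hu ha).
have := Cr_star hu (Cr_multl (multiplier_star hm) (Cr_star hu ha)).
by rewrite (convol_star gm ga) !sect_starK.
Qed.

Lemma multiplier_convol m n : M m -> M n -> M (convol m n).
Proof.
move=> hm hn; have gm := multiplier_good hm; have gn := multiplier_good hn.
apply: multiplierI => z hz; have gz := Dr_good hu hz; split.
  rewrite -(convolA hu gz gm gn); apply: Cr_multr; [exact: hn | exact: multiplier_l].
rewrite (convolA hu gm gn gz); apply: Cr_multl; [exact: hm | exact: multiplier_r].
Qed.

(** On a given block, [z] almost 1 at the ranges of [H] makes [m f] close to [(m z) f]. *)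
Lemma bbd_opnorm m (L : R) : M m -> 0 <= L ->
  (forall z, Dr F z -> unit_interval hu z -> bbd (convol m z) L) -> bbd m L.
Proof.
move=> hm L0 mL; split => // x E H f hx oE oH.
have [[C mC] _] := multiplier_good hm; have C0 := bbd_ge0 mC.
have n0 := nn_ge0 x H f.
apply/ler_addgt0Pl => e e0.
(* Chosen so that [C * d * nn x H f <= e], the cost of replacing [f] by [z f]. *)
pose d := e / ((C + 1) * (nn x H f + 1)).
have d0 : 0 < d by rewrite divr_gt0 // mulr_gt0 //; lra.
have [|z [hz uz ez]] := @local_unit _ _ _ hu uf [seq rng h | h <- H] d _ d0.
  by move=> y /mapP[h _ ->]; exact: gunits_rng.
pose zf : sect F := fun h => fmulat h (z (rng h)) (f h).
pose w y : fib F y := match pselect (gunits y) with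
  | left hy => fone hu hy - z y | right _ => 0 end.
have fE : nn x H (f - zf) <= d * nn x H f.
  have -> : nn x H (f - zf) = nn x H (fun h => fmulat h (w (rng h)) (f h)).
    apply: eq_nn => h hH; rewrite /w; case: pselect => [hy|[]]; last exact: gunits_rng.
    have ch : composable (rng h) h by rewrite /composable src_unit.
    by rewrite (fmulatBl _ _ _ _ ch) (fibre_unitl _ hy (foneP hu hy)).
  apply: (nn_mull hu) => //; first exact: ltW.
  move=> h hH; rewrite /w; case: pselect => [hy|_]; last by rewrite vnorm0 ltW.
  by apply: (ez _ hy); apply/mapP; exists h.
have -> : nn x E (apply_at m H f) =
    nn x E (apply_at (convol m z) H f + apply_at m H (f - zf)).
  apply: eq_nn => g gE; have gx := oE _ gE; have [_ zu] := hz.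
  rewrite {1}/GRing.add /= (apply_at_convol_dr _ _ oH gx zu) (apply_atBr oH) //.
  by rewrite addrC subrK.
apply: le_trans (nnD hu _ _ hx oE) _; rewrite addrC; apply: lerD.
  case: mC => _ mC'; apply: le_trans (mC' _ _ _ _ hx oE oH) _.
  apply: le_trans (ler_wpM2l C0 fE) _.
  have dE : d * ((C + 1) * (nn x H f + 1)) = e.
    by rewrite /d divfK // gt_eqF // mulr_gt0 //; lra.
  by have := mulr_ge0 C0 n0; have := mulr_ge0 (ltW d0) n0; have := mulr_ge0 (ltW d0) C0; nra.
by case: (mL z hz uz) => _; apply.
Qed.

End Multipliers.

(** * The isomorphism *)

Section MultiplierMap.
Variables (R : realType) (G : etaleGroupoidType) (F : fellBundle R G).
Hypothesis uf : unit_full F.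
Implicit Types (g h x y : G) (C D e t : R) (a b c f m n s z : sect F).
Local Notation M := (rho_multipliers F).
Local Notation CrA := (sect_algebra (F := F) (Cr F)).
Let hu := units_ex uf.

Lemma convol0r a : convol a 0 = 0.
Proof. by apply: functional_extensionality_dep => g; apply/convolE/is_conv0r. Qed.

Lemma convol0l a : convol 0 a = 0.
Proof.
apply: functional_extensionality_dep => g; apply: convolE => e e0.
exists fset0; first exact: over0.
move=> H oH _; rewrite /apply_at big_seq big1 ?subr0 ?vnorm0 ?ltW // => h hH.
by rewrite fmulat0l //; apply: gdiv_compl; rewrite oH.
Qed.

Lemma patch_in (f : sect F -> sect F) a : Cr F a -> patch (fun=> 0) (Cr F) f a = f a.
Proof. by move=> ha; rewrite /patch mem_set. Qed.

Lemma patch_out (f : sect F -> sect F) a : ~ Cr F a -> patch (fun=> 0) (Cr F) f a = 0.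
Proof. by move=> ha; rewrite /patch memNset. Qed.

Lemma multiplier_star_closed : star_closed (sect_algebra (F := F) M).
Proof.
have M0 : M 0.
  by apply: multiplierI => z hz; rewrite convol0l convol0r; split; exact: (Cr0 hu).
split => /=.
- exact: M0.
- by move=> l a b ha hb; exact: multiplier_linear uf l _ _ ha hb.
- by move=> a b ha hb; exact: multiplier_convol uf _ _ ha hb.
- by move=> a ha; exact: multiplier_star uf _ ha.
Qed.

Lemma right_action_multiplier m : M m ->
  right_multiplier (A := CrA) (patch (fun=> 0) (Cr F) (fun a => convol a m)).
Proof.
move=> hm; have gm := multiplier_good uf hm; split.
  split => /= [a ha|l a b ha hb|a ha].
  - by rewrite (patch_in _ ha); exact: (Cr_multr uf hm ha).
  - have hlab : Cr F (l *: a + b) := CrD hu (CrZ hu l ha) hb.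
    have ga := Cr_good hu ha; have gb := Cr_good hu hb.
    rewrite (patch_in _ hlab) (patch_in _ ha) (patch_in _ hb).
    by rewrite (convolDl (goodZ l ga) gb gm) (convolZl l ga gm).
  - exact: patch_out.
move=> a b /= ha hb; have hab := Cr_convol hu ha hb.
have ga := Cr_good hu ha; have gb := Cr_good hu hb.
by rewrite (patch_in _ hab) (patch_in _ hb) (convolA hu ga gb gm).
Qed.

Lemma left_action_multiplier m : M m ->
  left_multiplier (A := CrA) (patch (fun=> 0) (Cr F) (fun a => convol m a)).
Proof.
move=> hm; have gm := multiplier_good uf hm; split.
  split => /= [a ha|l a b ha hb|a ha].
  - by rewrite (patch_in _ ha); exact: (Cr_multl uf hm ha).
  - have hlab : Cr F (l *: a + b) := CrD hu (CrZ hu l ha) hb.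
    have ga := Cr_good hu ha; have gb := Cr_good hu hb.
    rewrite (patch_in _ hlab) (patch_in _ ha) (patch_in _ hb).
    by rewrite (convolDr gm (goodZ l ga) gb) (convolZr l gm ga).
  - exact: patch_out.
move=> a b /= ha hb; have hab := Cr_convol hu ha hb.
have ga := Cr_good hu ha; have gb := Cr_good hu hb.
by rewrite (patch_in _ hab) (patch_in _ ha) (convolA hu gm ga gb).
Qed.

Lemma multiplier_map_inj m n : M m -> M n ->
  multiplier_map F m = multiplier_map F n -> m = n.
Proof.
move=> hm hn [_ E]; apply: functional_extensionality_dep => g.
have [z hz ze] := Dr_unit_ex uf (gunits_src g).
rewrite -(unit_convolr m hz ze) -(unit_convolr n hz ze).
have [zC _] := hz; have := congr1 (fun u : sect F -> sect F => u z) E.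
by rewrite /= !(patch_in _ zC) => ->.
Qed.

Section Surjective.
Variables r l : sect F -> sect F.
Hypotheses (hr : right_multiplier (A := CrA) r) (hl : left_multiplier (A := CrA) l).
Hypothesis hrl : forall a b, Cr F a -> Cr F b -> convol (r a) b = convol a (l b).

Let Cr_r a : Cr F a -> Cr F (r a). Proof. by case: hr => -[h _ _] _; exact: h. Qed.
Let Cr_l a : Cr F a -> Cr F (l a). Proof. by case: hl => -[h _ _] _; exact: h. Qed.

Let du x (hx : gunits x) := cid2 (Dr_unit_ex uf hx).
Let dd x (hx : gunits x) : sect F := s2val (du hx).
Let ddD x (hx : gunits x) : Dr F (dd hx). Proof. by rewrite /dd; case: (du hx). Qed.
Let dd1 x (hx : gunits x) : fibre_unit (dd hx x).
Proof. by rewrite /dd; case: (du hx). Qed.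

Definition multiplier_of : sect F := fun g => r (dd (gunits_rng g)) g.

(** With [d] the diagonal section whose value at the range of [g] is the unit, [l(z)(g)] is the
    value at [g] of [d l(z) = r(d) z], which is [r(d)(g) z(s(g))]. Only single-term products occur,
    so nothing about [multiplier_of] has to be known yet. *)
Lemma multiplier_of_l z : Dr F z -> l z = convol multiplier_of z.
Proof.
move=> hz; have [zC zu] := hz; apply: functional_extensionality_dep => g.
have hd := ddD (gunits_rng g); have [dC _] := hd.
rewrite -(unit_convoll (l z) hd (dd1 _)) -(hrl dC zC).
by rewrite !convol_dr.
Qed.

Lemma multiplier_of_r z : Dr F z -> r z = convol z multiplier_of.
Proof.
move=> hz; have [zC zu] := hz; apply: functional_extensionality_dep => g.
have hd := ddD (gunits_src g); have [dC du'] := hd.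
rewrite -(unit_convolr (r z) hd (dd1 _)) (hrl zC dC) (multiplier_of_l hd).
by rewrite !(convol_dl _ _ zu) (unit_convolr _ hd (dd1 _)).
Qed.

Lemma multiplier_ofP : M multiplier_of.
Proof.
apply: multiplierI => z hz; have [zC _] := hz.
by rewrite -(multiplier_of_l hz) -(multiplier_of_r hz); split; [exact: Cr_r | exact: Cr_l].
Qed.

(** For non-diagonal [a] the step from [(d m) a] to [d (m a)] is a genuine associativity, available
    once [m] is known to be a multiplier and hence bounded. *)
Lemma multiplier_of_lE a : Cr F a -> l a = convol multiplier_of a.
Proof.
move=> ha; have gm := multiplier_good uf multiplier_ofP; have ga := Cr_good hu ha.
apply: functional_extensionality_dep => g.
have hd := ddD (gunits_rng g); have [dC _] := hd; have gd := Dr_good hu hd.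
rewrite -(unit_convoll (l a) hd (dd1 _)) -(hrl dC ha) (multiplier_of_r hd).
by rewrite (convolA hu gd gm ga) (unit_convoll _ hd (dd1 _)).
Qed.

Lemma multiplier_of_rE a : Cr F a -> r a = convol a multiplier_of.
Proof.
move=> ha; have gm := multiplier_good uf multiplier_ofP; have ga := Cr_good hu ha.
apply: functional_extensionality_dep => g.
have hd := ddD (gunits_src g); have [dC _] := hd; have gd := Dr_good hu hd.
rewrite -(unit_convolr (r a) hd (dd1 _)) (hrl ha dC) (multiplier_of_l hd).
by rewrite -(convolA hu ga gm gd) (unit_convolr _ hd (dd1 _)).
Qed.

End Surjective.

Lemma opnorm_multiplier m : M m ->
  opnorm (A := CrA) (patch (fun=> 0) (Cr F) (fun a => convol m a)) = bnorm m.
Proof.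
move=> hm; have gm := multiplier_good uf hm; have [[C mC] _] := gm.
apply/eqP; rewrite eq_le; apply/andP; split.
  have [t [-> t0 mt]] := bnorm_fin hu mC.
  apply: ge_ereal_sup => _ [a [/= ha a1] <-]; rewrite (patch_in _ ha).
  have ga := Cr_good hu ha.
  apply: (bbd_bnorm hu); rewrite -[t]mulr1; apply: (good_bbd_convol hu mt _ gm ga).
  exact: (bnorm_bbd hu).
set L := opnorm _.
have ub a : Cr F a -> (bnorm a <= 1)%E -> (bnorm (convol m a) <= L)%E.
  by move=> ha a1; apply: ereal_sup_ubound; exists a; [split | rewrite /= (patch_in _ ha)].
have L0 : (0 <= L)%E.
  apply: le_trans (bnorm_ge0 (convol m 0)) _; apply: ub; first exact: Cr0 hu.
  by apply: le_trans (bbd_bnorm hu (bbd0 F)) _; rewrite lee_fin.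
(* If [L] is infinite there is nothing to prove. If finite, it bounds every [m z] with [z] diagonal
   in [0, 1], since such [z] are contractions in [Cr]. *)
case LE : L L0 ub => [t| |] //= t0 ub; last by rewrite leey.
rewrite lee_fin in t0; apply: (bbd_bnorm hu).
apply: (bbd_opnorm hm t0) => z hz uz; apply: (bnorm_bbd hu t0); apply: ub.
  by case: hz.
by apply: (bbd_bnorm hu); exact: unit_interval_bbd uz.
Qed.

End MultiplierMap.

(** [convol] is a total function, so convergence of the products and closure of the multipliers
    under the operations have to be claimed separately from the isomorphism. *)
Theorem corollary3p17 (R : realType) (G : etaleGroupoidType)
    (F : fellBundle R G) (F_unit_full : unit_full F) :
  [/\ forall m a : sect F, rho_multipliers F m -> Cr F a ->
        convol_defined a m /\ convol_defined m a,
      forall m n : sect F, rho_multipliers F m -> rho_multipliers F n ->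
        convol_defined m n,
      star_closed (sect_algebra (F := F) (rho_multipliers F)) &
      star_isomorphism (multiplier_map F)].
Proof.
have hu := units_ex F_unit_full; have uf := F_unit_full.
split.
- move=> m a /(multiplier_good uf) gm /(Cr_good hu) ga.
  by split; exact: good_defined.
- move=> m n /(multiplier_good uf) gm /(multiplier_good uf) gn.
  exact: good_defined.
- exact: (multiplier_star_closed uf).
split.
  split.
  - move=> m hm; split => /=.
    + exact: (right_action_multiplier uf hm).
    + exact: (left_action_multiplier uf hm).
    + move=> a b ha hb; rewrite (patch_in _ ha) (patch_in _ hb).
      exact: (convolA hu (Cr_good hu ha) (multiplier_good uf hm) (Cr_good hu hb)).
  - by move=> m n /set_mem hm /set_mem hn E; exact: (multiplier_map_inj uf hm hn E).
  - move=> [r l] [/= hr hl hrl]; exists (multiplier_of uf r).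
      exact: (multiplier_ofP uf hr hl hrl).
    have [[_ _ r0] _] := hr; have [[_ _ l0] _] := hl.
    congr (_, _); apply/funext => a; have [ha|ha] := pselect (Cr F a).
    + by rewrite (patch_in _ ha) -(multiplier_of_rE uf hr hl hrl).
    + by rewrite (patch_out _ ha) r0.
    + by rewrite (patch_in _ ha) -(multiplier_of_lE uf hr hl hrl).
    + by rewrite (patch_out _ ha) l0.
split => /=.
- move=> c m n hm hn; have gm := multiplier_good uf hm; have gn := multiplier_good uf hn.
  congr (_, _); apply/funext => a; have [ha|ha] := pselect (Cr F a).
  + rewrite [RHS]/GRing.add /= /GRing.scale /= !(patch_in _ ha).
    have ga := Cr_good hu ha.
    by rewrite (convolDr ga (goodZ c gm) gn) (convolZr c ga gm).
  + by rewrite [RHS]/GRing.add /= /GRing.scale /= !(patch_out _ ha) scaler0 addr0.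
  + rewrite [RHS]/GRing.add /= /GRing.scale /= !(patch_in _ ha).
    have ga := Cr_good hu ha.
    by rewrite (convolDl (goodZ c gm) gn ga) (convolZl c gm ga).
  + by rewrite [RHS]/GRing.add /= /GRing.scale /= !(patch_out _ ha) scaler0 addr0.
- move=> m n hm hn; have gm := multiplier_good uf hm; have gn := multiplier_good uf hn.
  have cr0 := Cr0 (F := F) hu.
  congr (_, _); apply/funext => a /=; have [ha|ha] := pselect (Cr F a).
  + have ga := Cr_good hu ha.
    rewrite !(patch_in _ ha) (patch_in _ (Cr_multr uf hm ha)).
    by rewrite (convolA hu ga gm gn).
  (* Outside [Cr] the inner map returns 0, which lies in [Cr], so the outer map really convolves
     with 0. *)
  + by rewrite !(patch_out _ ha) (patch_in _ cr0) convol0l.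
  + have ga := Cr_good hu ha.
    rewrite !(patch_in _ ha) (patch_in _ (Cr_multl uf hn ha)).
    by rewrite (convolA hu gm gn ga).
  + by rewrite !(patch_out _ ha) (patch_in _ cr0) convol0r.
- move=> m hm; have gm := multiplier_good uf hm.
  have gms := multiplier_good uf (multiplier_star uf hm).
  have Crs a : ~ Cr F a -> ~ Cr F (sect_star a).
    by move=> ha /(Cr_star hu); rewrite sect_starK.
  congr (_, _); apply/funext => a; rewrite /endo_adj /=; have [ha|ha] := pselect (Cr F a).
  + have hs := Cr_star hu ha; have gs := Cr_good hu hs.
    by rewrite (patch_in _ hs) (patch_in _ ha) (convol_star gm gs) sect_starK.
  + by rewrite (patch_out _ ha) (patch_out _ (Crs _ ha)) sect_star0.
  + have hs := Cr_star hu ha; have gs := Cr_good hu hs.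
    by rewrite (patch_in _ hs) (patch_in _ ha) (convol_star gs gm) sect_starK.
  + by rewrite (patch_out _ ha) (patch_out _ (Crs _ ha)) sect_star0.
- by move=> m hm; exact: (opnorm_multiplier uf hm).
Qed.
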